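(* Let $0\le\alpha<1$. (a) The function $f_\nu$ is starlike of order $\alpha$ in $\mathbb{D}$ if and only if $\nu\ge\nu_\alpha^\star(f_\nu)$, where $\nu_\alpha^\star(f_\nu)$ is the unique root of the equation (in $\nu$) $$2J_\nu(1)I_\nu(1)-(\alpha(2\nu+1)+1)\left(J_{\nu+1}(1)I_\nu(1)+J_\nu(1)I_{\nu+1}(1)\right)=0.$$ In particular, $f_\nu$ is starlike in $\mathbb{D}$ if and only if $\nu\ge\nu_0^\star(f_\nu)\simeq-0.44\ldots$, where $\nu_0^\star(f_\nu)$ is the unique root of this equation when $\alpha=0$. (b) The function $g_\nu$ is starlike of order $\alpha$ in $\mathbb{D}$ if and only if $\nu\ge\nu_\alpha^\star(g_\nu)$, where $\nu_\alpha^\star(g_\nu)$ is the unique root of the equation (in $\nu$) $$2J_\nu(1)I_\nu(1)-(\alpha+2\nu+1)\left(J_{\nu+1}(1)I_\nu(1)+J_\nu(1)I_{\nu+1}(1)\right)=0.$$ In particular, $g_\nu$ is starlike in $\mathbb{D}$ if and only if $\nu\ge\nu_0^\star(g_\nu)\simeq-0.87\ldots$, where $\nu_0^\star(g_\nu)$ is the unique root of this equation when $\alpha=0$. (c) The function $h_\nu$ is starlike of order $\alpha$ in $\mathbb{D}$ if and only if $\nu\ge\nu_\alpha^\star(h_\nu)$, where $\nu_\alpha^\star(h_\nu)$ is the unique root of the equation (in $\nu$) $$J_\nu(1)I_\nu(1)-(2\alpha+\nu-1)\left(J_{\nu+1}(1)I_\nu(1)+J_\nu(1)I_{\nu+1}(1)\right)=0.$$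 In particular, $h_\nu$ is starlike in $\mathbb{D}$ if and only if $\nu\ge\nu_0^\star(h_\nu)\simeq-0.94\ldots$, where $\nu_0^\star(h_\nu)$ is the unique root of this equation when $\alpha=0$.
   Context: $J_\nu,I_\nu$ are the Bessel and modified Bessel functions of the first kind, and $$\mathbf{\Phi}_\nu(z)=J_\nu(z)I_\nu'(z)-J_\nu'(z)I_\nu(z)=J_{\nu+1}(z)I_\nu(z)+J_\nu(z)I_{\nu+1}(z)=2\sum_{n\ge0}\frac{(-1)^n(z/2)^{2\nu+4n+1}}{n!\,\Gamma(\nu+n+1)\Gamma(\nu+2n+2)}.$$ For $\nu>-1$ the normalized functions are defined by $$f_\nu(z)=\left(2^{2\nu}\Gamma(\nu+1)\Gamma(\nu+2)\mathbf{\Phi}_\nu(z)\right)^{\frac{1}{2\nu+1}}\ (\nu\ne-\tfrac12),\quad g_\nu(z)=2^{2\nu}z^{-2\nu}\Gamma(\nu+1)\Gamma(\nu+2)\mathbf{\Phi}_\nu(z),$$ $$h_\nu(z)=2^{2\nu}z^{-\frac{\nu}{2}+\frac34}\Gamma(\nu+1)\Gamma(\nu+2)\mathbf{\Phi}_\nu(\sqrt[4]{z}),$$ each normalized so as to be analytic near $0$ with value $0$ and derivative $1$ at $0$. $\mathbb{D}$ is the open unit disk. A function $f$ analytic in $\mathbb{D}$ with $f(0)=f'(0)-1=0$ is starlike of order $\alpha$ in $\mathbb{D}$ if it is univalent and $\operatorname{Re}(zf'(z)/f(z))>\alpha$ for all $z\in\mathbb{D}$; starlike means starlike of order $0$.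
   Formalization: In (a) the equivalence is stated only for ν > -1/2, not for all ν > -1, ν ≠ -1/2: for example f_ν with ν = -0.8 is starlike although -0.8 < ν_0 ≈ -0.44. The root in (a) is still unique among all ν > -1. *)

(* Defs.v *)
From Stdlib Require Import Reals Factorial.
From Coquelicot Require Import Coquelicot.

Open Scope R_scope.

(** Euler's integral.  All arguments below are positive, because only orders
    [nu > -1] occur. *)
Definition Gamma (x : R) : R :=
  RInt_gen (fun t => Rpower t (x - 1) * exp (- t))
           (at_right 0) (Rbar_locally p_infty).

Definition Cexp (z : C) : C :=
  (exp (Re z) * cos (Im z), exp (Re z) * sin (Im z)).

(** Principal argument, with values in [(-PI, PI]] for [z <> 0]. *)
Definition Carg (z : C) : R :=
  if Rle_dec 0 (Im z) then acos (Re z / Cmod z) else - acos (Re z / Cmod z).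

Definition Clog (z : C) : C := (ln (Cmod z), Carg z).

(** Principal value of [z ^ a] for a real exponent, with [0 ^ 0 = 1] and
    [0 ^ a = 0] for [a <> 0]. *)
Definition Cpower (z : C) (a : R) : C :=
  if Ceq_dec z 0 then (if Req_EM_T a 0 then RtoC 1 else RtoC 0)
  else Cexp (RtoC a * Clog z)%C.

Definition CSeries (a : nat -> C) : C :=
  (Series (fun n => Re (a n)), Series (fun n => Im (a n))).

Definition bessel_J (nu : R) (z : C) : C :=
  (Cpower (z / 2) nu *
   CSeries (fun n =>
     RtoC ((-1) ^ n / (INR (fact n) * Gamma (nu + INR n + 1)))
     * (z / 2) ^ (2 * n)))%C.

Definition bessel_I (nu : R) (z : C) : C :=
  (Cpower (z / 2) nu *
   CSeries (fun n =>
     RtoC (1 / (INR (fact n) * Gamma (nu + INR n + 1)))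
     * (z / 2) ^ (2 * n)))%C.

(** The cross-product [J_nu I_nu' - J_nu' I_nu], in its derivative-free form:
    the principal values of [J_nu] and [I_nu] jump across the negative real
    axis, so the derivatives would be meaningless there. *)
Definition cross_product (nu : R) (z : C) : C :=
  (bessel_J (nu + 1) z * bessel_I nu z
   + bessel_J nu z * bessel_I (nu + 1) z)%C.

Definition norm_const (nu : R) : R :=
  Rpower 2 (2 * nu) * Gamma (nu + 1) * Gamma (nu + 2).

(** Only the branch of [(norm_const nu * cross_product nu z) ^ (1/(2 nu + 1))]
    that is analytic near 0 with derivative 1 there is meant.  It is obtained by
    taking the factor [z ^ (2 nu + 1)] out of the root: the remaining base
    [norm_const nu * z ^ -(2 nu + 1) * cross_product nu z] is an entire function
    of [z] (up to its removable singularity at 0) with value 1 at 0, and its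
    root is principal.  Taking the principal root of the whole product would
    instead give a function that is discontinuous near 0. *)
Definition f_norm (nu : R) (z : C) : C :=
  (z * Cpower (RtoC (norm_const nu) * Cpower z (- (2 * nu + 1))
               * cross_product nu z)
              (1 / (2 * nu + 1)))%C.

(** In [g_norm] and [h_norm] the principal powers combine, for every [z <> 0],
    into the single-valued factor [z]; at 0 both take the value 0. *)
Definition g_norm (nu : R) (z : C) : C :=
  (RtoC (norm_const nu) * Cpower z (- (2 * nu)) * cross_product nu z)%C.

Definition h_norm (nu : R) (z : C) : C :=
  (RtoC (norm_const nu) * Cpower z (- nu / 2 + 3 / 4)
   * cross_product nu (Cpower z (1 / 4)))%C.

(** At [z = 0] the quotient [z f'(z) / f(z)] has the limit 1, which exceeds
    every admissible order, whereas [0 / 0] evaluates to 0; hence the condition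
    [z <> 0]. *)
Definition starlike_of_order (alpha : R) (f : C -> C) : Prop :=
  (forall z : C, Cmod z < 1 ->
     ex_derive (K := C_AbsRing) (V := C_NormedModule) f z) /\
  f (RtoC 0) = RtoC 0 /\
  C_derive f (RtoC 0) = RtoC 1 /\
  (forall z w : C, Cmod z < 1 -> Cmod w < 1 -> f z = f w -> z = w) /\
  (forall z : C, Cmod z < 1 -> z <> RtoC 0 ->
     alpha < Re (z * C_derive f z / f z)%C).

Definition starlike (f : C -> C) : Prop := starlike_of_order 0 f.

Definition f_equation (alpha nu : R) : Prop :=
  (2 * bessel_J nu 1 * bessel_I nu 1
   - RtoC (alpha * (2 * nu + 1) + 1)
     * (bessel_J (nu + 1) 1 * bessel_I nu 1
        + bessel_J nu 1 * bessel_I (nu + 1) 1))%C = RtoC 0.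

Definition g_equation (alpha nu : R) : Prop :=
  (2 * bessel_J nu 1 * bessel_I nu 1
   - RtoC (alpha + 2 * nu + 1)
     * (bessel_J (nu + 1) 1 * bessel_I nu 1
        + bessel_J nu 1 * bessel_I (nu + 1) 1))%C = RtoC 0.

Definition h_equation (alpha nu : R) : Prop :=
  (bessel_J nu 1 * bessel_I nu 1
   - RtoC (2 * alpha + nu - 1)
     * (bessel_J (nu + 1) 1 * bessel_I nu 1
        + bessel_J nu 1 * bessel_I (nu + 1) 1))%C = RtoC 0.

(** Uniqueness is among all the orders [nu > -1] that are considered. *)
Definition is_unique_root (eqn : R -> Prop) (nu0 : R) : Prop :=
  unique (fun nu => -1 < nu /\ eqn nu) nu0.

(* Main.v *)
Require Import Defs.
From Stdlib Require Import Reals Factorial Lra Lia.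
From Coquelicot Require Import Coquelicot.
Open Scope R_scope.

(** Write [t_n = 1 / (16^n n! (nu+1)_n (nu+2)_{2n})] and
    [P(w) = sum_n (-1)^n t_n w^n].  Multiplying out the Bessel series and
    evaluating the resulting alternating convolutions ([conv_rec]) shows that
    the normalized cross-product is [z^(2 nu + 1) P(z^4)], so that
    [f = z P(z^4)^(1/(2 nu + 1))], [g = z P(z^4)] and [h = z P(z)].  With
    [w = z^4], resp. [w = z], the quantity [z F'(z) / F(z)] is
    [1 + m w P'(w) / P(w)], where [m] is [4 / (2 nu + 1)], [4] and [1].  In the
    same way the three equations become
    [(1 - alpha) P(1) + m P'(1) = 0]: they say that [z F'(z) / F(z)] takes the
    value [alpha] at the point 1.

    The theorem thus amounts to three facts.

    First, the real part of [w P'(w) / P(w)] in the disk exceeds its value at 1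
    ([Re_theta_over_P]).  This is usually derived from the positivity of
    the zeros of [P].  Here it follows from the rapid decay
    [t_{n+1} <= t_n / 384] for [n >= 1], which makes [P] a small perturbation of
    [1 - t_1 w], a function for which the claim is explicit.  All errors are
    measured against [1 - Re w], through
    [1 - Re w^n <= n^2 (1 - Re w)] and [|1 - w|^2 <= 2 (1 - Re w)]; this is what
    keeps the comparison sharp at the point 1 itself, for every order.
    Conversely, injectivity forbids zeros of [P] on the radius, and letting the
    point tend to 1 along the radius gives the necessity of the condition
    ([balance_of_radius]).

    Second, the functions are injective.  For [g] and [h] the derivative has
    positive real part ([injective_of_Re_derivative_pos]).  For [f = z e^q] one
    has [|q'| <= 1] ([dP_over_P]), which also implies injectivity
    ([injective_exp_multiple]).

    Third, the condition at 1 is monotone in [nu].  The differences of the [t_n]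
    between two orders decay like the [t_n] ([tcoef_diff_ratio]), so [P(1)] and
    [P'(1)] vary like their leading terms [- t_1]; both increase strictly and
    continuously with [nu].  The intermediate value theorem gives the unique
    root, and the signs at two decimal endpoints locate it. *)

(** * Euler's integral for the Gamma function *)

Definition gamma_density (x t : R) : R := Rpower t (x - 1) * exp (- t).

Lemma gamma_density_pos x t : 0 < gamma_density x t.
Proof. apply Rmult_lt_0_compat; apply exp_pos. Qed.

Lemma gamma_density_derivable x t : 0 < t -> ex_derive (gamma_density x) t.
Proof.
  intros Ht. unfold gamma_density, Rpower. auto_derive. exact Ht.
Qed.

Lemma gamma_density_continuous x t : 0 < t -> continuous (gamma_density x) t.
Proof. intros Ht. apply (ex_derive_continuous (gamma_density x)), gamma_density_derivable, Ht. Qed.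

Lemma gamma_density_integrable x a b :
  0 < a -> 0 < b -> ex_RInt (gamma_density x) a b.
Proof.
  intros Ha Hb. apply (ex_RInt_continuous (V := R_CompleteNormedModule)).
  intros t [Ht _]. apply gamma_density_continuous.
  apply Rlt_le_trans with (2 := Ht). now apply Rmin_glb_lt.
Qed.

Lemma gamma_integral_mono x a0 b0 a b :
  0 < a <= a0 -> a0 <= b0 <= b ->
  RInt (gamma_density x) a0 b0 <= RInt (gamma_density x) a b.
Proof.
  intros [Ha Ha0] [Hab Hb].
  assert (H : forall u v, 0 < u -> u <= v -> 0 <= RInt (gamma_density x) u v).
  { intros u v Hu Huv. apply RInt_ge_0; auto.
    - apply gamma_density_integrable; lra.
    - intros; left; apply gamma_density_pos. }
  rewrite <- (RInt_Chasles (gamma_density x) a a0 b)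
    by (apply gamma_density_integrable; lra).
  rewrite <- (RInt_Chasles (gamma_density x) a0 b0 b)
    by (apply gamma_density_integrable; lra).
  assert (H1 := H a a0 Ha Ha0).
  assert (H2 : 0 <= RInt (gamma_density x) b0 b) by (apply H; lra).
  unfold plus; simpl. lra.
Qed.

Definition gamma_boundary (x t : R) : R := Rpower t x * exp (- t).

(** Integration by parts; it serves both to bound the integrals for
    [0 < x < 1] and, in the limit, as the functional equation. *)
Lemma gamma_integral_step x a b :
  0 < a -> a <= b ->
  RInt (gamma_density (x + 1)) a b =
  x * RInt (gamma_density x) a b - (gamma_boundary x b - gamma_boundary x a).
Proof.
  intros Ha Hab.
  assert (H : is_RInt (fun t => x * gamma_density x t - gamma_density (x + 1) t) a b
                (gamma_boundary x b - gamma_boundary x a)).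
  { apply (is_RInt_derive (gamma_boundary x)).
    - intros t Ht. rewrite Rmin_left in Ht by assumption.
      assert (Ht0 : 0 < t) by lra.
      unfold gamma_boundary, gamma_density, Rpower.
      auto_derive; [exact Ht0|].
      replace ((x - 1) * ln t) with (x * ln t - ln t) by ring.
      replace ((x + 1 - 1) * ln t) with (x * ln t) by ring.
      replace (exp (x * ln t - ln t)) with (exp (x * ln t) / t).
      2:{ unfold Rminus. now rewrite exp_plus, (exp_Ropp (ln t)), (exp_ln t). }
      field. lra.
    - intros t Ht. rewrite Rmin_left in Ht by assumption.
      assert (Ht0 : 0 < t) by lra.
      apply (continuous_minus (V := R_NormedModule)).
      + apply (continuous_scal_r (V := R_NormedModule)).
        now apply gamma_density_continuous.
      + now apply gamma_density_continuous. }
  assert (H' : is_RInt (fun t => x * gamma_density x t - gamma_density (x + 1) t) a b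
     (x * RInt (gamma_density x) a b - RInt (gamma_density (x + 1)) a b)).
  { apply (is_RInt_minus (V := R_NormedModule)).
    - apply (is_RInt_scal (V := R_NormedModule)).
      apply (RInt_correct (V := R_CompleteNormedModule)), gamma_density_integrable; lra.
    - apply (RInt_correct (V := R_CompleteNormedModule)), gamma_density_integrable; lra. }
  apply (is_RInt_unique (V := R_CompleteNormedModule)) in H. apply (is_RInt_unique (V := R_CompleteNormedModule)) in H'. lra.
Qed.

Lemma ln_le_linear c t : 0 < c -> 0 < t -> ln t <= t / c + (ln c - 1).
Proof.
  intros Hc Ht.
  assert (H0 : 0 < t / c) by now apply Rdiv_lt_0_compat.
  assert (H : ln (t / c) <= t / c - 1).
  { destruct (Req_dec (ln (t / c)) 0) as [E|E].
    - rewrite E. rewrite <- (exp_ln (t / c)) by assumption. rewrite E, exp_0. lra.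
    - rewrite <- (exp_ln (t / c)) at 2 by assumption.
      assert (H1 := exp_ineq1 _ E). lra. }
  rewrite ln_div in H by assumption. lra.
Qed.

Lemma gamma_boundary_decay x : 0 <= x ->
  exists K, 0 < K /\ forall t, 0 < t -> gamma_boundary x t <= K * exp (- t / 2).
Proof.
  intros Hx. set (c := 2 * x + 1).
  exists (exp (x * (ln c - 1))). split; [apply exp_pos|].
  intros t Ht. unfold gamma_boundary, Rpower. rewrite <- !exp_plus.
  assert (H : x * ln t + - t <= x * (ln c - 1) + - t / 2).
  { assert (H := ln_le_linear c t ltac:(unfold c; lra) Ht).
    assert (H1 : x * ln t <= x * (t / c + (ln c - 1))) by now apply Rmult_le_compat_l.
    assert (H2 : x * (t / c) <= t / 2).
    { replace (x * (t / c)) with (t * (x / c)) by (unfold c; field; lra).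
      replace (t / 2) with (t * (1 / 2)) by field.
      apply Rmult_le_compat_l; [lra|].
      apply Rmult_le_reg_r with c; [unfold c; lra|].
      unfold c; field_simplify; lra. }
    lra. }
  destruct H as [H|H]; [left; now apply exp_increasing|right; now rewrite H].
Qed.

Lemma gamma_integral_bounded x : 0 < x ->
  exists M, forall a b, 0 < a -> a <= b -> RInt (gamma_density x) a b <= M.
Proof.
  intros Hx.
  destruct (gamma_boundary_decay x ltac:(lra)) as [K [HK Hd]].
  exists ((K + 2 * K) / x). intros a b Ha Hab.
  assert (Hstep := gamma_integral_step x a b Ha Hab).
  assert (Hb : gamma_boundary x b <= K).
  { apply Rle_trans with (1 := Hd b ltac:(lra)).
    rewrite <- (Rmult_1_r K) at 2. apply Rmult_le_compat_l; [lra|].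
    rewrite <- exp_0. left. apply exp_increasing. lra. }
  assert (Ha' : 0 < gamma_boundary x a) by (apply Rmult_lt_0_compat; apply exp_pos).
  assert (HI : RInt (gamma_density (x + 1)) a b <= 2 * K).
  { assert (He : is_RInt (fun t => K * exp (- t / 2)) a b
                   (- 2 * K * exp (- b / 2) - - 2 * K * exp (- a / 2))).
    { apply (is_RInt_derive (fun t => - 2 * K * exp (- t / 2))).
      - intros t _. auto_derive; [trivial|]. unfold Rdiv. field.
      - intros t _. apply (ex_derive_continuous (fun t => K * exp (- t / 2))).
        auto_derive. trivial. }
    apply Rle_trans with (RInt (fun t => K * exp (- t / 2)) a b).
    - apply RInt_le; auto.
      + apply gamma_density_integrable; lra.
      + eexists; exact He.
      + intros t Ht. unfold gamma_density.
        replace (x + 1 - 1) with x by ring. apply (Hd t). lra.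
    - rewrite (is_RInt_unique (V := R_CompleteNormedModule) _ _ _ _ He).
      assert (0 < exp (- b / 2)) by apply exp_pos.
      assert (exp (- a / 2) < 1) by (rewrite <- exp_0; apply exp_increasing; lra).
      nra. }
  apply Rmult_le_reg_l with x; [assumption|].
  replace (x * ((K + 2 * K) / x)) with (K + 2 * K) by (field; lra). lra.
Qed.

(** The integrals over compact subintervals increase with the interval, so that
    their supremum is the improper integral at both ends. *)
Lemma Gamma_is_sup x : 0 < x ->
  is_RInt_gen (gamma_density x) (at_right 0) (Rbar_locally p_infty) (Gamma x) /\
  (forall a b, 0 < a -> a <= b -> RInt (gamma_density x) a b <= Gamma x).
Proof.
  intros Hx.
  set (E := fun y => exists a b, 0 < a /\ a <= b /\ y = RInt (gamma_density x) a b).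
  destruct (completeness E) as [S [HS1 HS2]].
  { destruct (gamma_integral_bounded x Hx) as [M HM]. exists M.
    intros y [a [b [Ha [Hab ->]]]]. now apply HM. }
  { exists (RInt (gamma_density x) 1 1). exists 1, 1. lra. }
  assert (HS : forall a b, 0 < a -> a <= b -> RInt (gamma_density x) a b <= S).
  { intros a b Ha Hab. apply HS1. now exists a, b. }
  assert (HG : is_RInt_gen (gamma_density x) (at_right 0) (Rbar_locally p_infty) S).
  { intros Q [eps HQ].
    assert (Hex : exists a0 b0, 0 < a0 /\ a0 <= b0 /\
                    S - eps < RInt (gamma_density x) a0 b0).
    { apply Classical_Prop.NNPP. intros Hn.
      assert (S <= S - eps); [|destruct eps; simpl in *; lra].
      apply HS2. intros y [a [b [Ha [Hab ->]]]].
      apply Rnot_lt_le. intros Hlt. apply Hn. now exists a, b. }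
    destruct Hex as [a0 [b0 [Ha0 [Hab0 Hlt]]]].
    apply Filter_prod with (fun a => 0 < a <= a0) (fun b => b0 <= b).
    - exists (mkposreal a0 Ha0). intros y Hy Hy0.
      unfold ball in Hy; simpl in Hy; unfold AbsRing_ball, abs, minus, plus, opp in Hy;
      simpl in Hy. apply Rabs_lt_between in Hy. lra.
    - exists b0. intros y Hy. lra.
    - intros a b Ha Hb. exists (RInt (gamma_density x) a b). split.
      + simpl. apply (RInt_correct (V := R_CompleteNormedModule)), gamma_density_integrable; lra.
      + apply HQ. unfold ball; simpl; unfold AbsRing_ball, abs, minus, plus, opp; simpl.
        assert (H1 := gamma_integral_mono x a0 b0 a b Ha ltac:(lra)).
        assert (H2 := HS a b ltac:(lra) ltac:(lra)).
        apply Rabs_lt_between. lra. }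
  assert (Heq : Gamma x = S).
  { unfold Gamma. now apply is_RInt_gen_unique. }
  rewrite Heq. now split.
Qed.

Lemma Gamma_pos x : 0 < x -> 0 < Gamma x.
Proof.
  intros Hx. destruct (Gamma_is_sup x Hx) as [_ H].
  apply Rlt_le_trans with (RInt (gamma_density x) 1 2); [|apply H; lra].
  apply RInt_gt_0; [lra| |].
  - intros; apply gamma_density_pos.
  - intros t Ht. apply gamma_density_continuous. lra.
Qed.

Lemma gamma_boundary_at_0 x : 0 < x ->
  filterlim (gamma_boundary x) (at_right 0) (locally 0).
Proof.
  intros Hx. apply filterlim_locally. intros eps.
  exists (mkposreal _ (exp_pos (ln eps / x))). intros t Ht Ht0.
  unfold ball in *; simpl in *; unfold AbsRing_ball, abs, minus, plus, opp in *; simpl in *.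
  rewrite Ropp_0, Rplus_0_r in *.
  rewrite (Rabs_pos_eq t) in Ht by lra.
  rewrite Rabs_pos_eq by (left; apply Rmult_lt_0_compat; apply exp_pos).
  unfold gamma_boundary, Rpower. rewrite <- exp_plus.
  rewrite <- (exp_ln eps) by apply cond_pos. apply exp_increasing.
  assert (H : ln t < ln eps / x).
  { rewrite <- (ln_exp (ln eps / x)). now apply ln_increasing. }
  assert (x * ln t < x * (ln eps / x)) by now apply Rmult_lt_compat_l.
  replace (x * (ln eps / x)) with (ln eps) in H0 by (field; lra). lra.
Qed.

Lemma gamma_boundary_at_infinity x : 0 < x ->
  filterlim (gamma_boundary x) (Rbar_locally p_infty) (locally 0).
Proof.
  intros Hx. destruct (gamma_boundary_decay x ltac:(lra)) as [K [HK Hd]].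
  apply filterlim_locally. intros eps.
  exists (Rmax 0 (- 2 * ln (eps / K))). intros t Ht.
  assert (Ht0 := Rmax_l 0 (- 2 * ln (eps / K))).
  assert (Ht1 := Rmax_r 0 (- 2 * ln (eps / K))).
  unfold ball; simpl; unfold AbsRing_ball, abs, minus, plus, opp; simpl.
  rewrite Ropp_0, Rplus_0_r.
  rewrite Rabs_pos_eq by (left; apply Rmult_lt_0_compat; apply exp_pos).
  apply Rle_lt_trans with (1 := Hd t ltac:(lra)).
  apply Rlt_le_trans with (K * (eps / K)).
  - apply Rmult_lt_compat_l; [assumption|].
    rewrite <- (exp_ln (eps / K)) by (apply Rdiv_lt_0_compat; [apply cond_pos|assumption]).
    apply exp_increasing. lra.
  - right. field. lra.
Qed.

Lemma Gamma_succ x : 0 < x -> Gamma (x + 1) = x * Gamma x.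
Proof.
  intros Hx.
  destruct (Gamma_is_sup x Hx) as [HG _].
  unfold Gamma at 1. apply is_RInt_gen_unique.
  intros Q [eps HQ].
  set (e := pos eps / (x + 2)).
  assert (He : 0 < e) by (apply Rdiv_lt_0_compat; [apply cond_pos|lra]).
  assert (HB : locally (Gamma x) (ball (Gamma x) e)) by (exists (mkposreal e He); auto).
  specialize (HG _ HB).
  assert (H0 := gamma_boundary_at_0 x Hx _ (locally_ball 0 (mkposreal e He))).
  assert (H1 := gamma_boundary_at_infinity x Hx _ (locally_ball 0 (mkposreal e He))).
  assert (Hab : filter_prod (at_right 0) (Rbar_locally p_infty)
                  (fun ab => 0 < fst ab <= snd ab)).
  { apply Filter_prod with (fun a => 0 < a <= 1) (fun b => 1 <= b).
    - exists (mkposreal 1 Rlt_0_1). intros y Hy Hy0.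
      unfold ball in Hy; simpl in Hy; unfold AbsRing_ball, abs, minus, plus, opp in Hy;
      simpl in Hy. apply Rabs_lt_between in Hy. lra.
    - exists 1. intros y Hy. lra.
    - simpl. intros; lra. }
  assert (H01 : filter_prod (at_right 0) (Rbar_locally p_infty)
     (fun ab => ball 0 e (gamma_boundary x (fst ab)) /\ ball 0 e (gamma_boundary x (snd ab)))).
  { eapply Filter_prod; [exact H0|exact H1|]. simpl. intros; split; assumption. }
  unfold filtermapi in *.
  generalize (filter_and _ _ HG (filter_and _ _ Hab H01)).
  apply filter_imp. intros [a b] [[y [Hy1 Hy2]] [[Ha Hb] [Hba Hbb]]]. simpl in *.
  exists (RInt (gamma_density (x + 1)) a b). split.
  - apply (RInt_correct (V := R_CompleteNormedModule)), gamma_density_integrable; lra.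
  - apply HQ. apply (is_RInt_unique (V := R_CompleteNormedModule)) in Hy1.
    rewrite gamma_integral_step by lra.
    replace (RInt (gamma_density x) a b) with y by (symmetry; exact Hy1).
    unfold ball in *; simpl in *; unfold AbsRing_ball, abs, minus, plus, opp in *; simpl in *.
    rewrite Ropp_0, Rplus_0_r in Hba, Hbb.
    apply Rabs_lt_between in Hy2. apply Rabs_lt_between in Hba. apply Rabs_lt_between in Hbb.
    assert (Hee : (x + 2) * e = eps) by (unfold e; field; lra).
    apply Rabs_lt_between. nra.
Qed.

(** * Complex exponential, logarithm and powers *)

Lemma Cexp_plus a b : Cexp (a + b) = (Cexp a * Cexp b)%C.
Proof.
  destruct a as [a1 a2], b as [b1 b2]. unfold Cexp; simpl.
  rewrite exp_plus, cos_plus, sin_plus. unfold Cmult; simpl. f_equal; ring.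
Qed.

Lemma Cmod_Cexp a : Cmod (Cexp a) = exp (Re a).
Proof.
  unfold Cmod, Cexp; simpl fst; simpl snd.
  replace ((exp (Re a) * cos (Im a)) ^ 2 + (exp (Re a) * sin (Im a)) ^ 2)
    with (exp (Re a) ^ 2).
  - apply sqrt_pow2. left; apply exp_pos.
  - assert (H := sin2_cos2 (Im a)). unfold Rsqr in H.
    replace (exp (Re a) ^ 2) with (exp (Re a) ^ 2 * 1) by ring. rewrite <- H. ring.
Qed.

Lemma Cexp_neq_0 a : Cexp a <> RtoC 0.
Proof.
  intros H. assert (H1 := Cmod_Cexp a). rewrite H, Cmod_0 in H1.
  assert (H2 := exp_pos (Re a)). lra.
Qed.

Lemma Cexp_RtoC x : Cexp (RtoC x) = RtoC (exp x).
Proof. unfold Cexp, RtoC; simpl. rewrite cos_0, sin_0. f_equal; ring. Qed.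

Lemma Cexp_nat n a : Cexp (RtoC (INR n) * a) = (Cexp a ^ n)%C.
Proof.
  induction n.
  - simpl INR. simpl Cpow. rewrite Cmult_0_l.
    rewrite Cexp_RtoC, exp_0. reflexivity.
  - rewrite S_INR, RtoC_plus.
    replace ((RtoC (INR n) + RtoC 1) * a)%C with (RtoC (INR n) * a + a)%C by ring.
    rewrite Cexp_plus, IHn. simpl. ring.
Qed.

Lemma Cmod_sqr (z : C) : Cmod z * Cmod z = Re z * Re z + Im z * Im z.
Proof.
  generalize (Cmod2_alt z). simpl. rewrite !Rmult_1_r. auto.
Qed.

(** The defining property of the argument; the case distinction in [Carg] only
    restores the sign that [acos] loses. *)
Lemma Carg_cos_sin (z : C) : z <> 0 ->
  Cmod z * cos (Carg z) = Re z /\ Cmod z * sin (Carg z) = Im z.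
Proof.
  intros Hz. assert (Hm := proj1 (Cmod_gt_0 z) Hz).
  assert (Hs := Cmod_sqr z).
  assert (Hre := re_le_Cmod z).
  assert (Hr : -1 <= Re z / Cmod z <= 1).
  { apply Rabs_le_between in Hre.
    split; apply Rmult_le_reg_r with (Cmod z); auto; unfold Rdiv;
      rewrite Rmult_assoc, Rinv_l by lra; lra. }
  assert (Hsin : Cmod z * sin (acos (Re z / Cmod z)) = Rabs (Im z)).
  { rewrite sin_acos by exact Hr.
    rewrite <- (sqrt_Rsqr (Cmod z)) at 1 by lra.
    rewrite <- sqrt_mult_alt by apply Rle_0_sqr.
    rewrite <- sqrt_Rsqr_abs. f_equal. unfold Rsqr.
    replace (Im z * Im z) with (Cmod z * Cmod z - Re z * Re z) by lra.
    field. lra. }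
  unfold Carg. destruct (Rle_dec 0 (Im z)) as [H|H].
  - rewrite cos_acos by exact Hr. split; [field; lra|].
    rewrite Hsin. now apply Rabs_pos_eq.
  - rewrite cos_neg, sin_neg, cos_acos by exact Hr. split; [field; lra|].
    rewrite Ropp_mult_distr_r_reverse, Hsin, Rabs_left by lra. ring.
Qed.

Lemma Cexp_Clog (z : C) : z <> 0 -> Cexp (Clog z) = z.
Proof.
  intros Hz. destruct (Carg_cos_sin z Hz) as [H1 H2].
  assert (Hm := proj1 (Cmod_gt_0 z) Hz).
  unfold Cexp, Clog; simpl. rewrite exp_ln by assumption.
  rewrite H1, H2. now destruct z.
Qed.

Lemma Clog_Cexp x : - PI < Im x <= PI -> Clog (Cexp x) = x.
Proof.
  intros Hx. unfold Clog, Carg. rewrite Cmod_Cexp, ln_exp.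
  assert (He := exp_pos (Re x)).
  unfold Cexp; simpl Re; simpl Im. unfold Re, Im in *; simpl fst; simpl snd.
  replace (exp (fst x) * cos (snd x) / exp (fst x)) with (cos (snd x)) by (field; lra).
  destruct x as [u v]; simpl in *. f_equal.
  destruct (Rle_dec 0 (exp u * sin v)) as [H|H].
  - apply acos_cos. destruct (Rle_dec 0 v); [lra|]. exfalso.
    assert (0 < sin (- v)) by (apply sin_gt_0; lra). rewrite sin_neg in *. nra.
  - assert (v < 0).
    { apply Rnot_le_lt. intros Hv. apply H.
      assert (0 <= sin v) by (apply sin_ge_0; lra). nra. }
    rewrite <- (cos_neg v), acos_cos by lra. ring.
Qed.

Lemma Carg_bounds (z : C) : z <> 0 -> - PI < Carg z <= PI.
Proof.
  intros Hz. assert (Hm := proj1 (Cmod_gt_0 z) Hz). assert (Hp := PI_RGT_0).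
  unfold Carg. assert (Hb := acos_bound (Re z / Cmod z)).
  destruct (Rle_dec 0 (Im z)) as [H|H]; [lra|].
  split; [|lra]. apply Ropp_lt_contravar.
  destruct (Rle_lt_or_eq_dec _ _ (proj2 Hb)) as [Hl|He]; auto. exfalso.
  (* an argument of modulus [PI] belongs to a real number *)
  destruct (Carg_cos_sin z Hz) as [_ H2]. unfold Carg in H2.
  destruct (Rle_dec 0 (Im z)); [lra|].
  rewrite He, sin_neg, sin_PI in H2. lra.
Qed.

Lemma Clog_scal (z : C) c : 0 < c -> z <> 0 -> Clog (z * RtoC c) = (Clog z + RtoC (ln c))%C.
Proof.
  intros Hc Hz.
  rewrite <- (Cexp_Clog z) at 1 by assumption.
  rewrite <- (exp_ln c) at 1 by assumption.
  rewrite <- Cexp_RtoC, <- Cexp_plus. apply Clog_Cexp.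
  simpl. rewrite Rplus_0_r. now apply Carg_bounds.
Qed.

Lemma Cpower_def (z : C) a : z <> 0 -> Cpower z a = Cexp (RtoC a * Clog z).
Proof. intros Hz. unfold Cpower. now destruct (Ceq_dec z 0). Qed.

Lemma Cpower_0 (a : R) : a <> 0 -> Cpower 0 a = RtoC 0.
Proof.
  intros Ha. unfold Cpower. destruct (Ceq_dec 0 0) as [_|H]; [|now elim H].
  now destruct (Req_EM_T a 0).
Qed.

Lemma Cpower_neq_0 (z : C) a : z <> 0 -> Cpower z a <> 0.
Proof. intros Hz. rewrite Cpower_def by assumption. apply Cexp_neq_0. Qed.

Lemma Cpower_plus (z : C) a b : z <> 0 -> (Cpower z a * Cpower z b)%C = Cpower z (a + b).
Proof.
  intros Hz. rewrite !Cpower_def, <- Cexp_plus, RtoC_plus by assumption.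
  f_equal. ring.
Qed.

Lemma Cpower_1_r (z : C) : Cpower z 1 = z.
Proof.
  destruct (Ceq_dec z 0) as [->|Hz]; [apply Cpower_0; lra|].
  rewrite Cpower_def, Cmult_1_l by assumption. now apply Cexp_Clog.
Qed.

Lemma Cpower_0_r (z : C) : Cpower z 0 = RtoC 1.
Proof.
  unfold Cpower. destruct (Ceq_dec z 0).
  - now destruct (Req_EM_T 0 0).
  - rewrite Cmult_0_l, Cexp_RtoC, exp_0. reflexivity.
Qed.

Lemma Cpower_half (z : C) a : z <> 0 ->
  Cpower (z / 2) a = (Cpower z a * RtoC (Rpower 2 (- a)))%C.
Proof.
  intros Hz.
  assert (H2 : (z / 2)%C = (z * RtoC (/ 2))%C) by (rewrite RtoC_inv by lra; reflexivity).
  assert (Hz2 : (z / 2)%C <> 0).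
  { rewrite H2. apply Cmult_neq_0; auto. intros E. injection E. lra. }
  rewrite !Cpower_def by assumption. rewrite H2, Clog_scal by (auto; lra).
  rewrite ln_Rinv by lra. unfold Rpower.
  rewrite <- Cexp_RtoC, <- Cexp_plus. f_equal.
  rewrite RtoC_mult, !RtoC_opp. ring.
Qed.

Lemma Clog_root4 (z : C) : z <> 0 -> Clog (Cpower z (1 / 4)) = (RtoC (1 / 4) * Clog z)%C.
Proof.
  intros Hz. rewrite Cpower_def by assumption. apply Clog_Cexp.
  simpl. assert (H := Carg_bounds z Hz). lra.
Qed.

Lemma root4_pow4 (z : C) : (Cpower z (1 / 4) ^ 4)%C = z.
Proof.
  destruct (Ceq_dec z 0) as [->|Hz].
  - rewrite Cpower_0 by lra. simpl. ring.
  - rewrite Cpower_def, <- Cexp_nat by assumption.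
    rewrite Cmult_assoc, <- RtoC_mult.
    replace (INR 4 * (1 / 4)) with 1 by (simpl; field).
    rewrite Cmult_1_l. now apply Cexp_Clog.
Qed.

(** * Complex series *)

Definition Csummable (a : nat -> C) : Prop := ex_series (fun n => Cmod (a n)).

Lemma Im_le_Cmod (z : C) : Rabs (Im z) <= Cmod z.
Proof. apply Rle_trans with (2 := Rmax_Cmod z). apply Rmax_r. Qed.

Lemma Csummable_Re a : Csummable a -> ex_series (fun n => Rabs (Re (a n))).
Proof.
  intros H. apply (ex_series_le (V := R_CompleteNormedModule)) with (2 := H).
  intros n. simpl. unfold norm; simpl; unfold abs; simpl.
  rewrite Rabs_Rabsolu. apply re_le_Cmod.
Qed.

Lemma Csummable_Im a : Csummable a -> ex_series (fun n => Rabs (Im (a n))).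
Proof.
  intros H. apply (ex_series_le (V := R_CompleteNormedModule)) with (2 := H).
  intros n. simpl. unfold norm; simpl; unfold abs; simpl.
  rewrite Rabs_Rabsolu. apply Im_le_Cmod.
Qed.

Definition is_CSeries (a : nat -> C) (l : C) : Prop :=
  is_series (fun n => Re (a n)) (Re l) /\ is_series (fun n => Im (a n)) (Im l).

Lemma CSeries_correct a : Csummable a -> is_CSeries a (CSeries a).
Proof.
  intros H. split; apply Series_correct, ex_series_Rabs.
  - now apply Csummable_Re.
  - now apply Csummable_Im.
Qed.

Lemma is_CSeries_unique a l : is_CSeries a l -> CSeries a = l.
Proof.
  intros [H1 H2]. unfold CSeries.
  rewrite (is_series_unique _ _ H1), (is_series_unique _ _ H2). now destruct l.
Qed.

Lemma CSeries_ext a b : (forall n, a n = b n) -> CSeries a = CSeries b.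
Proof.
  intros H. unfold CSeries. f_equal; apply Series_ext; intros n; now rewrite H.
Qed.

Lemma is_CSeries_ext a b l : (forall n, a n = b n) -> is_CSeries a l -> is_CSeries b l.
Proof.
  intros H [H1 H2]. split; [eapply is_series_ext; [|exact H1]|eapply is_series_ext; [|exact H2]];
    intros n; simpl; now rewrite H.
Qed.

Lemma is_CSeries_plus a b la lb :
  is_CSeries a la -> is_CSeries b lb -> is_CSeries (fun n => a n + b n)%C (la + lb)%C.
Proof.
  intros [H1 H2] [H3 H4]. split.
  - exact (is_series_plus _ _ _ _ H1 H3).
  - exact (is_series_plus _ _ _ _ H2 H4).
Qed.

Lemma is_CSeries_scal c a l : is_CSeries a l -> is_CSeries (fun n => c * a n)%C (c * l)%C.
Proof.
  intros [H1 H2]. destruct c as [c1 c2]. split.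
  - exact (is_series_minus _ _ _ _ (is_series_scal c1 _ _ H1) (is_series_scal c2 _ _ H2)).
  - exact (is_series_plus _ _ _ _ (is_series_scal c1 _ _ H2) (is_series_scal c2 _ _ H1)).
Qed.

Lemma Csummable_scal c a : Csummable a -> Csummable (fun n => c * a n)%C.
Proof.
  intros H. unfold Csummable.
  apply ex_series_ext with (fun n => Cmod c * Cmod (a n)).
  - intros n. symmetry. apply Cmod_mult.
  - now apply (ex_series_scal (V := R_NormedModule)).
Qed.

Lemma Re_CSeries_le a : Csummable a -> Re (CSeries a) <= Series (fun n => Cmod (a n)).
Proof.
  intros H. simpl.
  apply Rle_trans with (1 := Rle_abs _).
  apply Rle_trans with (1 := Series_Rabs _ (Csummable_Re _ H)).
  apply Series_le; [|exact H]. intros n. split; [apply Rabs_pos|apply re_le_Cmod].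
Qed.

(** Multiplying by the conjugate of the sum makes the sum real, which reduces
    the triangle inequality to that for real parts. *)
Lemma Cmod_CSeries_le a : Csummable a -> Cmod (CSeries a) <= Series (fun n => Cmod (a n)).
Proof.
  intros H. destruct (Req_dec (Cmod (CSeries a)) 0) as [E|E].
  - rewrite E. rewrite <- (Rmult_0_l (Series (fun _ => 0))).
    rewrite <- Series_scal_l. apply Series_le; [|exact H].
    intros n. split; [lra|]. rewrite Rmult_0_l. apply Cmod_ge_0.
  - assert (Hp : 0 < Cmod (CSeries a)) by (assert (H0 := Cmod_ge_0 (CSeries a)); lra).
    apply Rmult_le_reg_l with (1 := Hp).
    assert (H1 := Re_CSeries_le _ (Csummable_scal (Cconj (CSeries a)) _ H)).
    rewrite (is_CSeries_unique _ _ (is_CSeries_scal (Cconj (CSeries a)) _ _ (CSeries_correct _ H))) in H1.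
    rewrite (Series_ext _ (fun n => Cmod (CSeries a) * Cmod (a n))) in H1
      by (intros n; now rewrite Cmod_mult, Cmod_conj).
    rewrite Series_scal_l in H1.
    apply Rle_trans with (2 := H1). right. rewrite Cmod_sqr. simpl. ring.
Qed.

Lemma is_CSeries_decr_1 a l :
  is_CSeries (fun n => a (S n)) (l - a 0%nat)%C -> is_CSeries a l.
Proof.
  intros [H1 H2]. split; apply is_series_decr_1; assumption.
Qed.

Lemma is_CSeries_even a l :
  (forall n, a (2 * n + 1)%nat = RtoC 0) ->
  is_CSeries a l -> is_CSeries (fun n => a (2 * n)%nat) l.
Proof.
  assert (HR : forall (b : nat -> R) (x : R), (forall n, b (2 * n + 1)%nat = 0) ->
             is_series b x -> is_series (fun n => b (2 * n)%nat) x).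
  { intros b x Hb Hx.
    apply filterlim_ext with (fun n => sum_n b (2 * n)).
    - induction x0 as [|n IH].
      + now rewrite !sum_O.
      + replace (2 * S n)%nat with (S (S (2 * n))) by lia.
        rewrite !sum_Sn, IH. replace (S (2 * n)) with (2 * n + 1)%nat by lia.
        rewrite Hb.
        replace (2 * n + 1)%nat with (S (2 * n)) by lia.
        unfold plus; cbn -[Nat.mul]. rewrite Rplus_0_r. f_equal. f_equal. lia.
    - apply filterlim_comp with eventually; [|exact Hx].
      intros P [N HN]. exists N. intros n Hn. apply HN. lia. }
  intros Ha [H1 H2]. split; [apply (HR (fun n => Re (a n)))|apply (HR (fun n => Im (a n)))];
    auto; intros n; rewrite Ha; reflexivity.
Qed.

Fixpoint Csum (a : nat -> C) (n : nat) : C :=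
  match n with O => a O | S k => (Csum a k + a (S k))%C end.

Lemma Re_Csum a n : Re (Csum a n) = sum_f_R0 (fun k => Re (a k)) n.
Proof. induction n; simpl; auto. unfold Re in *. simpl. now rewrite IHn. Qed.

Lemma Im_Csum a n : Im (Csum a n) = sum_f_R0 (fun k => Im (a k)) n.
Proof. induction n; simpl; auto. unfold Im in *. simpl. now rewrite IHn. Qed.

(** The real and imaginary parts of a product reduce the claim to four real
    Cauchy products. *)
Lemma is_CSeries_mult a b : Csummable a -> Csummable b ->
  is_CSeries (fun n => Csum (fun k => a k * b (n - k)%nat)%C n) (CSeries a * CSeries b)%C.
Proof.
  intros Ha Hb.
  destruct (CSeries_correct a Ha) as [A1 A2]. destruct (CSeries_correct b Hb) as [B1 B2].
  assert (A1' := Csummable_Re _ Ha). assert (A2' := Csummable_Im _ Ha).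
  assert (B1' := Csummable_Re _ Hb). assert (B2' := Csummable_Im _ Hb).
  split.
  - eapply is_series_ext;
      [|exact (is_series_minus _ _ _ _ (is_series_mult _ _ _ _ A1 B1 A1' B1')
                                (is_series_mult _ _ _ _ A2 B2 A2' B2'))].
    intros n. rewrite Re_Csum. unfold plus, opp; simpl.
    rewrite <- Rminus_def, <- minus_sum. apply sum_eq. intros; reflexivity.
  - eapply is_series_ext;
      [|exact (is_series_plus _ _ _ _ (is_series_mult _ _ _ _ A1 B2 A1' B2')
                                (is_series_mult _ _ _ _ A2 B1 A2' B1'))].
    intros n. rewrite Im_Csum. unfold plus; simpl.
    rewrite <- plus_sum. apply sum_eq. intros; reflexivity.
Qed.

(** * The alternating convolution of the Bessel coefficients *)

(** Rising factorial [(x)_n]. *)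
Fixpoint poch (x : R) (n : nat) : R :=
  match n with O => 1 | S k => poch x k * (x + INR k) end.

Lemma poch_pos x n : 0 < x -> 0 < poch x n.
Proof.
  intros Hx. induction n; simpl; [lra|].
  apply Rmult_lt_0_compat; auto. assert (H := pos_INR n). lra.
Qed.

Lemma poch_shift x n : x * poch (x + 1) n = poch x n * (x + INR n).
Proof.
  induction n; simpl poch; [simpl; ring|].
  rewrite <- Rmult_assoc, IHn, S_INR. ring.
Qed.

Lemma Gamma_poch nu n : -1 < nu ->
  Gamma (nu + INR n + 1) = Gamma (nu + 1) * poch (nu + 1) n.
Proof.
  intros Hnu. induction n.
  - simpl. rewrite Rplus_0_r. ring.
  - rewrite S_INR. replace (nu + (INR n + 1) + 1) with ((nu + INR n + 1) + 1) by ring.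
    assert (H := pos_INR n).
    rewrite Gamma_succ, IHn by lra. simpl. ring.
Qed.

Definition bessel_coef (mu : R) (n : nat) : R := / (INR (fact n) * poch (mu + 1) n).

Lemma bessel_coef_pos mu n : -1 < mu -> 0 < bessel_coef mu n.
Proof.
  intros Hmu. apply Rinv_0_lt_compat, Rmult_lt_0_compat.
  - apply INR_fact_lt_0.
  - apply poch_pos; lra.
Qed.

Lemma bessel_coef_succ mu n : -1 < mu ->
  INR (S n) * (INR (S n) + mu) * bessel_coef mu (S n) = bessel_coef mu n.
Proof.
  intros Hmu. unfold bessel_coef. rewrite fact_simpl, mult_INR, S_INR. simpl poch.
  assert (H := pos_INR n). assert (H1 := INR_fact_lt_0 n).
  assert (H2 := poch_pos (mu + 1) n ltac:(lra)). field. lra.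
Qed.

Lemma bessel_coef_shift nu n : -1 < nu ->
  (nu + 1) * bessel_coef nu n = (nu + 1 + INR n) * bessel_coef (nu + 1) n.
Proof.
  intros Hnu. unfold bessel_coef.
  assert (H := pos_INR n). assert (H1 := INR_fact_lt_0 n).
  assert (H2 := poch_pos (nu + 1) n ltac:(lra)).
  assert (H3 := poch_pos (nu + 1 + 1) n ltac:(lra)).
  assert (H4 := poch_shift (nu + 1) n).
  apply Rmult_eq_reg_l with (INR (fact n) * poch (nu + 1) n * poch (nu + 1 + 1) n).
  - field_simplify; try lra.
  - apply Rmult_integral_contrapositive_currified; nra.
Qed.

(** With [phi = 1] this is the coefficient of degree [N] in the product of the
    series of [J_mu] and [I_mu]; its recurrence needs the other weights. *)
Definition moment (mu : R) (phi : nat -> R) (N : nat) : R :=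
  sum_f_R0 (fun k => phi k * ((-1) ^ k * bessel_coef mu k * bessel_coef mu (N - k)%nat)) N.

Lemma moment_lin mu c1 c2 phi1 phi2 N :
  moment mu (fun k => c1 * phi1 k + c2 * phi2 k) N
  = c1 * moment mu phi1 N + c2 * moment mu phi2 N.
Proof.
  unfold moment. rewrite !scal_sum, <- plus_sum. apply sum_eq. intros; ring.
Qed.

Lemma moment_ext mu phi1 phi2 N :
  (forall k, (k <= N)%nat -> phi1 k = phi2 k) -> moment mu phi1 N = moment mu phi2 N.
Proof. intros H. apply sum_eq. intros k Hk. now rewrite H. Qed.

Lemma moment_shift_l mu psi N : -1 < mu ->
  moment mu (fun k => INR k * (INR k + mu) * psi k) (S N)
  = - moment mu (fun k => psi (S k)) N.
Proof.
  intros Hmu. unfold moment. rewrite decomp_sum by lia. simpl pred.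
  rewrite Rmult_0_l, !Rmult_0_l, Rplus_0_l.
  replace (- sum_f_R0 (fun k : nat =>
      psi (S k) * ((-1) ^ k * bessel_coef mu k * bessel_coef mu (N - k))) N)
    with (-1 * sum_f_R0 (fun k : nat =>
      psi (S k) * ((-1) ^ k * bessel_coef mu k * bessel_coef mu (N - k))) N) by ring.
  rewrite scal_sum. apply sum_eq. intros k Hk.
  rewrite <- (bessel_coef_succ mu k Hmu). replace (S N - S k)%nat with (N - k)%nat by lia.
  change ((-1) ^ S k) with (-1 * (-1) ^ k). ring.
Qed.

Lemma moment_shift_r mu psi N : -1 < mu ->
  moment mu (fun k => INR (S N - k) * (INR (S N - k) + mu) * psi k) (S N)
  = moment mu psi N.
Proof.
  intros Hmu. unfold moment. rewrite tech5, Nat.sub_diag. simpl (INR 0).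
  rewrite Rmult_0_l, !Rmult_0_l, Rplus_0_r.
  apply sum_eq. intros k Hk. rewrite Nat.sub_succ_l by assumption.
  rewrite <- (bessel_coef_succ mu (N - k) Hmu). ring.
Qed.

Definition conv (mu : R) (N : nat) : R := moment mu (fun _ => 1) N.

(** Both [k (k + mu)] and [m (m + mu)], where [k + m = N], act on the moments as
    shifts of [N], with opposite signs because of the factor [(-1) ^ k].  The
    symmetric combination yields the moment of [k m], and the antisymmetric one,
    used twice, that of [(k - m) ^ 2]. *)
Lemma conv_rec mu M : -1 < mu ->
  (INR M + 2 + mu) * (INR M + 1 + mu) * (INR M + 2) * (INR M + 2 + 2 * mu) * conv mu (S (S M))
  = -4 * conv mu M.
Proof.
  intros Hmu.
  assert (Hm : forall N k, (k <= S N)%nat -> INR (S N - k) = INR N + 1 - INR k).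
  { intros N k Hk. rewrite minus_INR, S_INR by assumption. ring. }
  set (km := fun N k => INR k * (INR N - INR k)).
  set (df := fun N k => 2 * INR k - INR N).
  assert (HC : forall N, let n := INR N + 1 in
     2 * moment mu (km (S N)) (S N) = n * (n + mu) * conv mu (S N)).
  { intros N n.
    assert (H := moment_shift_l mu (fun _ => 1) N Hmu).
    assert (H' := moment_shift_r mu (fun _ => 1) N Hmu).
    assert (H0 : 1 * moment mu (fun k => INR k * (INR k + mu) * 1) (S N)
               + 1 * moment mu (fun k => INR (S N - k) * (INR (S N - k) + mu) * 1) (S N)
               = n * (n + mu) * conv mu (S N) + -2 * moment mu (km (S N)) (S N)).
    { unfold conv. rewrite <- !moment_lin. apply moment_ext. intros k Hk.
      rewrite Hm by assumption. unfold km, n. rewrite S_INR. ring. }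
    lra. }
  assert (HB : forall N, (INR N + 1 + mu) * moment mu (df (S N)) (S N) = -2 * conv mu N).
  { intros N.
    assert (H := moment_shift_l mu (fun _ => 1) N Hmu).
    assert (H' := moment_shift_r mu (fun _ => 1) N Hmu).
    assert (H0 : 1 * moment mu (fun k => INR k * (INR k + mu) * 1) (S N)
               + -1 * moment mu (fun k => INR (S N - k) * (INR (S N - k) + mu) * 1) (S N)
               = (INR N + 1 + mu) * moment mu (df (S N)) (S N) + 0 * conv mu (S N)).
    { unfold conv. rewrite <- !moment_lin. apply moment_ext. intros k Hk.
      rewrite Hm by assumption. unfold df. rewrite S_INR. ring. }
    unfold conv in *. lra. }
  assert (HD : forall N, let n := INR N + 1 in
     (n + mu) * (n * n * conv mu (S N) - 4 * moment mu (km (S N)) (S N))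
     = -2 * moment mu (df N) N).
  { intros N n.
    assert (H := moment_shift_l mu (df (S N)) N Hmu).
    assert (H' := moment_shift_r mu (df (S N)) N Hmu).
    assert (H0 : 1 * moment mu (fun k => INR k * (INR k + mu) * df (S N) k) (S N)
               + -1 * moment mu (fun k => INR (S N - k) * (INR (S N - k) + mu) * df (S N) k) (S N)
               = ((n + mu) * n * n) * conv mu (S N)
                 + - (4 * (n + mu)) * moment mu (km (S N)) (S N)).
    { unfold conv. rewrite <- !moment_lin. apply moment_ext. intros k Hk.
      rewrite Hm by assumption. unfold df, km, n. rewrite S_INR. ring. }
    rewrite H, H' in H0.
    assert (H1 : 1 * moment mu (fun k => df (S N) (S k)) N + 1 * moment mu (df (S N)) N
               = 2 * moment mu (df N) N + 0 * moment mu (df N) N).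
    { rewrite <- !moment_lin. apply moment_ext. intros k Hk.
      unfold df. rewrite !S_INR. ring. }
    lra. }
  specialize (HC (S M)). specialize (HD (S M)). specialize (HB M).
  cbv zeta in HC, HD. rewrite S_INR in HC, HD.
  replace (INR M + 1 + 1) with (INR M + 2) in * by ring.
  set (n := INR M + 2) in *. set (A2 := conv mu (S (S M))) in *.
  set (A0 := conv mu M) in *. set (C2 := moment mu (km (S (S M))) (S (S M))) in *.
  set (B1 := moment mu (df (S M)) (S M)) in *. set (r := INR M + 1 + mu) in *.
  transitivity (r * ((n + mu) * (2 * (n * (n + mu) * A2) - n * n * A2))); [ring|].
  rewrite <- HC.
  transitivity (- r * ((n + mu) * (n * n * A2 - 4 * C2))); [ring|].
  rewrite HD. transitivity (2 * (r * B1)); [ring|]. rewrite HB. ring.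
Qed.

(** The recurrence [conv_rec] relates indices of equal parity; it starts from
    the values 1 at 0 and 0 at 1. *)
Lemma conv_odd mu n : -1 < mu -> conv mu (2 * n + 1) = 0.
Proof.
  intros Hmu. induction n.
  - unfold conv, moment. simpl. ring.
  - replace (2 * S n + 1)%nat with (S (S (2 * n + 1))) by lia.
    assert (H := conv_rec mu (2 * n + 1) Hmu). rewrite IHn, Rmult_0_r in H.
    rewrite plus_INR, mult_INR in H. simpl INR in H. assert (H0 := pos_INR n).
    apply Rmult_integral in H. destruct H as [H|H]; auto. exfalso. revert H.
    repeat apply Rmult_integral_contrapositive_currified; lra.
Qed.

Lemma conv_even mu n : -1 < mu ->
  conv mu (2 * n)
  = (-1) ^ n / (INR (fact n) * poch (mu + 1) n * poch (mu + 1) (2 * n)).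
Proof.
  intros Hmu. induction n.
  - unfold conv, moment, bessel_coef. simpl. field.
  - replace (2 * S n)%nat with (S (S (2 * n))) by lia.
    assert (H := conv_rec mu (2 * n) Hmu). rewrite IHn, mult_INR in H. simpl (INR 2) in H.
    assert (H0 := pos_INR n). assert (H1 := INR_fact_lt_0 n).
    assert (H2 := poch_pos (mu + 1) n ltac:(lra)).
    assert (H3 := poch_pos (mu + 1) (2 * n) ltac:(lra)).
    rewrite fact_simpl, mult_INR. cbn [poch].
    change ((-1) ^ S n) with (-1 * (-1) ^ n).
    rewrite !S_INR, mult_INR. simpl (INR 2).
    match type of H with ?c * _ = _ => apply Rmult_eq_reg_l with c end.
    + rewrite H. field. repeat split; lra.
    + repeat apply Rmult_integral_contrapositive_currified; lra.
Qed.

(** * Products of the Bessel series *)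

Lemma geometric_decay (u : nat -> R) rho :
  0 <= rho -> (forall n, u (S (S n)) <= rho * u (S n)) -> forall n, u (S n) <= u 1%nat * rho ^ n.
Proof.
  intros Hrho Hu n. induction n; simpl; [lra|].
  apply Rle_trans with (1 := Hu n).
  replace (u 1%nat * (rho * rho ^ n)) with (rho * (u 1%nat * rho ^ n)) by ring.
  now apply Rmult_le_compat_l.
Qed.

Lemma ex_series_geometric_bound (u : nat -> R) K rho :
  0 <= rho < 1 -> (forall n, Rabs (u (S n)) <= K * rho ^ n) -> ex_series u.
Proof.
  intros Hrho Hu. apply ex_series_incr_1.
  apply (ex_series_le (V := R_CompleteNormedModule)) with (fun n => K * rho ^ n).
  - exact Hu.
  - apply (ex_series_scal (V := R_NormedModule)), ex_series_geom.
    rewrite Rabs_pos_eq; lra.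
Qed.

Lemma bessel_summable mu (s : nat -> R) x : -1 < mu -> Cmod x <= 1 ->
  (forall n, Rabs (s n) <= 1) ->
  Csummable (fun n => RtoC (s n * bessel_coef mu n) * x ^ n)%C.
Proof.
  intros Hmu Hx Hs.
  apply ex_series_geometric_bound with (bessel_coef mu 1) (1 / 2); [lra|].
  intros n. rewrite Rabs_pos_eq by apply Cmod_ge_0.
  rewrite Cmod_mult, Cmod_pow, Cmod_R, Rabs_mult.
  assert (Hb := bessel_coef_pos mu (S n) Hmu).
  rewrite (Rabs_pos_eq (bessel_coef _ _)) by lra.
  apply Rle_trans with (bessel_coef mu (S n)).
  - assert (Hp : 0 <= Cmod x ^ S n <= 1).
    { split; [apply pow_le, Cmod_ge_0|]. rewrite <- (pow1 (S n)). apply pow_incr.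
      split; auto. apply Cmod_ge_0. }
    assert (H := Hs (S n)). assert (H' := Rabs_pos (s (S n))).
    rewrite <- (Rmult_1_r (bessel_coef mu (S n))) at 2.
    replace (Rabs (s (S n)) * bessel_coef mu (S n) * Cmod x ^ S n)
      with (bessel_coef mu (S n) * (Rabs (s (S n)) * Cmod x ^ S n)) by ring.
    apply Rmult_le_compat_l; [lra|].
    rewrite <- (Rmult_1_r 1). apply Rmult_le_compat; lra.
  - apply geometric_decay; [lra|]. intros k.
    rewrite <- (bessel_coef_succ mu (S k) Hmu).
    assert (H2 := bessel_coef_pos mu (S (S k)) Hmu).
    rewrite !S_INR. assert (H3 := pos_INR k).
    replace (bessel_coef mu (S (S k))) with (1 * bessel_coef mu (S (S k))) at 1 by ring.
    rewrite <- Rmult_assoc. apply Rmult_le_compat_r; nra.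
Qed.

Definition series_J (mu : R) (x : C) : C :=
  CSeries (fun n => RtoC ((-1) ^ n * bessel_coef mu n) * x ^ n)%C.
Definition series_I (mu : R) (x : C) : C :=
  CSeries (fun n => RtoC (1 * bessel_coef mu n) * x ^ n)%C.

Lemma pow_m1_abs n : Rabs ((-1) ^ n) = 1.
Proof. rewrite <- RPow_abs, Rabs_m1. apply pow1. Qed.

Lemma series_J_summable mu x : -1 < mu -> Cmod x <= 1 ->
  Csummable (fun n => RtoC ((-1) ^ n * bessel_coef mu n) * x ^ n)%C.
Proof. intros. apply bessel_summable; auto. intros; rewrite pow_m1_abs; lra. Qed.

Lemma series_I_summable mu x : -1 < mu -> Cmod x <= 1 ->
  Csummable (fun n => RtoC (1 * bessel_coef mu n) * x ^ n)%C.
Proof. intros. apply (bessel_summable mu (fun _ => 1)); auto. intros; rewrite Rabs_R1; lra. Qed.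

Lemma Csum_RtoC (u v : nat -> R) (x : C) N :
  Csum (fun k => (RtoC (u k) * x ^ k) * (RtoC (v (N - k)%nat) * x ^ (N - k)))%C N
  = (RtoC (sum_f_R0 (fun k => (u k * v (N - k)%nat)%R) N) * x ^ N)%C.
Proof.
  assert (H : forall j, (j <= N)%nat ->
    Csum (fun k => (RtoC (u k) * x ^ k) * (RtoC (v (N - k)%nat) * x ^ (N - k)))%C j
    = (RtoC (sum_f_R0 (fun k => (u k * v (N - k)%nat)%R) j) * x ^ N)%C).
  { assert (Hp : forall k, (k <= N)%nat -> (x ^ N)%C = (x ^ k * x ^ (N - k))%C).
    { intros k Hk. rewrite <- Cpow_add_r. f_equal. lia. }
    induction j; intros Hj; simpl Csum; simpl sum_f_R0.
    - rewrite (Hp 0%nat), RtoC_mult by lia. ring.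
    - rewrite IHj, RtoC_plus, RtoC_mult by lia. rewrite (Hp (S j)) by lia. change (x ^ S j)%C with (x * x ^ j)%C. ring. }
  apply H. lia.
Qed.

Lemma Csq_pow (x : C) n : (x ^ (2 * n))%C = ((x * x) ^ n)%C.
Proof. rewrite Cpow_mult_r. f_equal. simpl. ring. Qed.

Lemma series_JI mu x : -1 < mu -> Cmod x <= 1 ->
  is_CSeries (fun n => RtoC (conv mu (2 * n)) * (x * x) ^ n)%C (series_J mu x * series_I mu x)%C.
Proof.
  intros Hmu Hx.
  assert (H := is_CSeries_mult _ _ (series_J_summable mu x Hmu Hx) (series_I_summable mu x Hmu Hx)).
  assert (H' : is_CSeries (fun N => RtoC (conv mu N) * x ^ N)%C (series_J mu x * series_I mu x)%C).
  { eapply is_CSeries_ext; [|exact H]. intros N.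
    etransitivity; [exact (Csum_RtoC (fun k => (-1) ^ k * bessel_coef mu k)
                             (fun k => 1 * bessel_coef mu k) x N)|].
    f_equal. f_equal.
    unfold conv, moment. apply sum_eq. intros; ring. }
  apply is_CSeries_even in H'.
  - eapply is_CSeries_ext; [|exact H']. intros n. cbv beta. now rewrite Csq_pow.
  - intros n. rewrite conv_odd by assumption. apply Cmult_0_l.
Qed.

(** Both products are convolutions with orders [nu] and [nu + 1];
    [bessel_coef_shift] turns their sum into a multiple of the convolution of
    order [nu + 1] alone. *)
Lemma series_cross nu x : -1 < nu -> Cmod x <= 1 ->
  is_CSeries (fun n => RtoC (2 * (nu + 1 + INR n) / (nu + 1) * conv (nu + 1) (2 * n)) * (x * x) ^ n)%C
    (series_J (nu + 1) x * series_I nu x + series_J nu x * series_I (nu + 1) x)%C.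
Proof.
  intros Hnu Hx. assert (Hnu' : -1 < nu + 1) by lra.
  assert (H1 := is_CSeries_mult _ _ (series_J_summable _ x Hnu' Hx) (series_I_summable _ x Hnu Hx)).
  assert (H2 := is_CSeries_mult _ _ (series_J_summable _ x Hnu Hx) (series_I_summable _ x Hnu' Hx)).
  assert (H := is_CSeries_plus _ _ _ _ H1 H2). clear H1 H2.
  fold (series_J nu x) (series_J (nu + 1) x) (series_I nu x) (series_I (nu + 1) x) in H.
  assert (H' : is_CSeries (fun N => RtoC ((2 * (nu + 1) + INR N) / (nu + 1) * conv (nu + 1) N) * x ^ N)%C
    (series_J (nu + 1) x * series_I nu x + series_J nu x * series_I (nu + 1) x)%C).
  { eapply is_CSeries_ext; [|exact H]. intros N.
    etransitivity; [exact (f_equal2 Cplus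
      (Csum_RtoC (fun k => (-1) ^ k * bessel_coef (nu + 1) k) (fun k => 1 * bessel_coef nu k) x N)
      (Csum_RtoC (fun k => (-1) ^ k * bessel_coef nu k) (fun k => 1 * bessel_coef (nu + 1) k) x N))|].
    rewrite <- Cmult_plus_distr_r, <- RtoC_plus. f_equal. f_equal.
    rewrite <- plus_sum. unfold conv, moment. rewrite scal_sum. apply sum_eq. intros k Hk.
    assert (Ha := bessel_coef_shift nu k Hnu).
    assert (Hb := bessel_coef_shift nu (N - k) Hnu).
    rewrite minus_INR in Hb by assumption.
    apply Rmult_eq_reg_l with (nu + 1); [|lra].
    transitivity ((-1) ^ k * (bessel_coef (nu + 1) k * ((nu + 1) * bessel_coef nu (N - k)%nat)
                    + ((nu + 1) * bessel_coef nu k) * bessel_coef (nu + 1) (N - k)%nat)); [ring|].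
    rewrite Ha, Hb. field. lra. }
  apply is_CSeries_even in H'.
  - eapply is_CSeries_ext; [|exact H']. intros n. cbv beta. rewrite Csq_pow.
    f_equal. f_equal. f_equal. rewrite mult_INR. simpl (INR 2). f_equal. ring.
  - intros n. rewrite conv_odd by assumption. rewrite Rmult_0_r. apply Cmult_0_l.
Qed.

(** * The coefficients of the cross-product *)

Definition tcoef (nu : R) (n : nat) : R :=
  / (16 ^ n * INR (fact n) * poch (nu + 1) n * poch (nu + 2) (2 * n)).

Lemma tcoef_denom_pos nu n : -1 < nu ->
  0 < 16 ^ n * INR (fact n) * poch (nu + 1) n * poch (nu + 2) (2 * n).
Proof.
  intros Hnu. repeat apply Rmult_lt_0_compat.
  - apply pow_lt; lra.
  - apply INR_fact_lt_0.
  - apply poch_pos; lra.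
  - apply poch_pos; lra.
Qed.

Lemma tcoef_pos nu n : -1 < nu -> 0 < tcoef nu n.
Proof. intros. now apply Rinv_0_lt_compat, tcoef_denom_pos. Qed.

Lemma tcoef_0 nu : tcoef nu 0 = 1.
Proof. unfold tcoef. simpl. field. Qed.

Definition tratio (nu : R) (n : nat) : R :=
  / (16 * (INR n + 1) * (nu + INR n + 1) * (nu + 2 * INR n + 2) * (nu + 2 * INR n + 3)).

Lemma tratio_pos nu n : -1 < nu -> 0 < tratio nu n.
Proof.
  intros Hnu. assert (H := pos_INR n). apply Rinv_0_lt_compat.
  repeat apply Rmult_lt_0_compat; lra.
Qed.

Lemma tcoef_succ nu n : -1 < nu -> tcoef nu (S n) = tcoef nu n * tratio nu n.
Proof.
  intros Hnu. unfold tcoef, tratio. replace (2 * S n)%nat with (S (S (2 * n))) by lia.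
  rewrite fact_simpl, mult_INR. cbn [poch pow]. rewrite !S_INR, mult_INR. simpl (INR 2).
  assert (H := pos_INR n). assert (H1 := INR_fact_lt_0 n).
  assert (H2 := poch_pos (nu + 1) n ltac:(lra)).
  assert (H3 := poch_pos (nu + 2) (2 * n) ltac:(lra)).
  assert (H4 := pow_lt 16 n ltac:(lra)).
  field. repeat split; lra.
Qed.

Lemma tcoef_1 nu : tcoef nu 1 = / (16 * (nu + 1) * (nu + 2) * (nu + 3)).
Proof.
  unfold tcoef. simpl. f_equal. rewrite !Rplus_0_r. ring.
Qed.

Lemma tratio_le nu n : -1 < nu -> tratio nu (S n) <= 1 / 384.
Proof.
  intros Hnu. assert (H := pos_INR n). unfold tratio. rewrite S_INR.
  replace (1 / 384) with (/ (16 * 2 * 1 * 3 * 4)) by field.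
  apply Rinv_le_contravar; [lra|].
  repeat apply Rmult_le_compat; lra.
Qed.

Lemma tcoef_decay nu n : -1 < nu -> tcoef nu (S n) <= tcoef nu 1 * (1 / 384) ^ n.
Proof.
  intros Hnu. apply geometric_decay; [lra|]. intros k.
  rewrite (tcoef_succ nu (S k)), Rmult_comm by assumption.
  apply Rmult_le_compat_r; [left; now apply tcoef_pos|now apply tratio_le].
Qed.

Definition pcoef (nu : R) (n : nat) : R := (-1) ^ n * tcoef nu n.

Lemma pcoef_abs nu n : -1 < nu -> Rabs (pcoef nu n) = tcoef nu n.
Proof.
  intros Hnu. unfold pcoef. rewrite Rabs_mult, pow_m1_abs, Rmult_1_l.
  apply Rabs_pos_eq. left; now apply tcoef_pos.
Qed.

Lemma cross_coef nu n : -1 < nu ->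
  2 * (nu + 1 + INR n) / (nu + 1) * conv (nu + 1) (2 * n) = 2 * (16 ^ n * pcoef nu n).
Proof.
  intros Hnu. rewrite conv_even by lra. unfold pcoef, tcoef.
  replace (nu + 1 + 1) with (nu + 2) by ring.
  assert (Hs := poch_shift (nu + 1) n). replace (nu + 1 + 1) with (nu + 2) in Hs by ring.
  assert (H := pos_INR n). assert (H1 := INR_fact_lt_0 n).
  assert (H2 := poch_pos (nu + 1) n ltac:(lra)).
  assert (H3 := poch_pos (nu + 2) (2 * n) ltac:(lra)).
  assert (H5 := poch_pos (nu + 2) n ltac:(lra)).
  assert (H4 := pow_lt 16 n ltac:(lra)).
  replace (nu + 1 + INR n) with ((nu + 1) * poch (nu + 2) n / poch (nu + 1) n)
    by (rewrite Hs; field; lra).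
  field. repeat split; lra.
Qed.

Lemma square_coef nu n : -1 < nu ->
  (nu + 1) * conv nu (2 * n) = 16 ^ n * ((nu + 1 + 2 * INR n) * pcoef nu n).
Proof.
  intros Hnu. rewrite conv_even by lra. unfold pcoef, tcoef.
  assert (Hs := poch_shift (nu + 1) (2 * n)).
  replace (nu + 1 + 1) with (nu + 2) in Hs by ring.
  rewrite mult_INR in Hs. simpl (INR 2) in Hs.
  assert (H := pos_INR n). assert (H1 := INR_fact_lt_0 n).
  assert (H2 := poch_pos (nu + 1) n ltac:(lra)).
  assert (H3 := poch_pos (nu + 2) (2 * n) ltac:(lra)).
  assert (H5 := poch_pos (nu + 1) (2 * n) ltac:(lra)).
  assert (H4 := pow_lt 16 n ltac:(lra)).
  replace (nu + 1 + 2 * INR n) with ((nu + 1) * poch (nu + 2) (2 * n) / poch (nu + 1) (2 * n))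
    by (rewrite Hs; field; lra).
  field. repeat split; lra.
Qed.

(** The entire function with value 1 at 0 to which, in the variable [z ^ 4],
    the cross-product reduces once its power of [z] is split off. *)
Definition Pfun (nu : R) (w : C) : C := CSeries (fun n => RtoC (pcoef nu n) * w ^ n)%C.

(** * The normalized functions *)

Lemma Cmod_half (z : C) : Cmod (z / 2) = Cmod z / 2.
Proof.
  rewrite Cmod_div by (intros E; injection E; lra).
  rewrite Cmod_R, Rabs_pos_eq by lra. reflexivity.
Qed.

Lemma Cmod_half_sqr (z : C) : Cmod z <= 1 -> Cmod (z / 2 * (z / 2)) <= 1.
Proof.
  intros Hz. rewrite Cmod_mult, Cmod_half. assert (H := Cmod_ge_0 z). nra.
Qed.

Lemma bessel_term mu (s : nat -> R) (z : C) l : -1 < mu ->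
  is_CSeries (fun n => RtoC (s n * bessel_coef mu n) * (z / 2 * (z / 2)) ^ n)%C l ->
  CSeries (fun n => RtoC (s n / (INR (fact n) * Gamma (mu + INR n + 1))) * (z / 2) ^ (2 * n))%C
  = (RtoC (/ Gamma (mu + 1)) * l)%C.
Proof.
  intros Hmu Hl. apply is_CSeries_unique.
  eapply is_CSeries_ext; [|exact (is_CSeries_scal (RtoC (/ Gamma (mu + 1))) _ _ Hl)].
  intros n. cbv beta. rewrite Csq_pow, Cmult_assoc, <- RtoC_mult. f_equal. f_equal.
  rewrite Gamma_poch by assumption. unfold bessel_coef.
  assert (H1 := INR_fact_lt_0 n).
  assert (H2 := poch_pos (mu + 1) n ltac:(lra)).
  assert (H3 := Gamma_pos (mu + 1) ltac:(lra)).
  field. repeat split; lra.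
Qed.

Lemma bessel_J_eq mu z : -1 < mu -> Cmod z <= 1 ->
  bessel_J mu z
  = (Cpower (z / 2) mu * (RtoC (/ Gamma (mu + 1)) * series_J mu (z / 2 * (z / 2))))%C.
Proof.
  intros Hmu Hz. unfold bessel_J. f_equal. apply bessel_term; [assumption|].
  apply CSeries_correct, series_J_summable; auto using Cmod_half_sqr.
Qed.

Lemma bessel_I_eq mu z : -1 < mu -> Cmod z <= 1 ->
  bessel_I mu z
  = (Cpower (z / 2) mu * (RtoC (/ Gamma (mu + 1)) * series_I mu (z / 2 * (z / 2))))%C.
Proof.
  intros Hmu Hz. unfold bessel_I. f_equal. apply (bessel_term mu (fun _ => 1)); [assumption|].
  apply CSeries_correct, series_I_summable; auto using Cmod_half_sqr.
Qed.

Lemma quarter_pow4 (z : C) n :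
  ((z / 2 * (z / 2) * (z / 2 * (z / 2))) ^ n * RtoC (16 ^ n))%C = ((z ^ 4) ^ n)%C.
Proof.
  rewrite RtoC_pow, <- Cpow_mult_l. f_equal.
  replace (RtoC 16) with (2 * 2 * 2 * 2)%C by (rewrite <- !RtoC_mult; f_equal; ring).
  simpl. field; try (intros E; injection E; lra).
Qed.

Lemma Pfun_cross nu z : -1 < nu -> Cmod z <= 1 ->
  let x := (z / 2 * (z / 2))%C in
  (series_J (nu + 1) x * series_I nu x + series_J nu x * series_I (nu + 1) x)%C
  = (2 * Pfun nu (z ^ 4))%C.
Proof.
  intros Hnu Hz x.
  assert (H := series_cross nu x Hnu (Cmod_half_sqr z Hz)).
  assert (H2 : is_CSeries (fun n => (RtoC (pcoef nu n) * (z ^ 4) ^ n))%C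
     (RtoC (/ 2) * (series_J (nu + 1) x * series_I nu x + series_J nu x * series_I (nu + 1) x))%C).
  { eapply is_CSeries_ext; [|exact (is_CSeries_scal (RtoC (/ 2)) _ _ H)].
    intros n. cbv beta. rewrite cross_coef by assumption.
    rewrite <- quarter_pow4. fold x. rewrite !RtoC_mult, RtoC_inv by lra.
    field; try (intros E; injection E; lra). }
  unfold Pfun. rewrite (is_CSeries_unique _ _ H2), RtoC_inv by lra.
  field; try (intros E; injection E; lra).
Qed.

Lemma norm_const_pos nu : -1 < nu -> 0 < norm_const nu.
Proof.
  intros Hnu. unfold norm_const.
  repeat apply Rmult_lt_0_compat; try (apply Gamma_pos; lra). apply exp_pos.
Qed.

Lemma Chalf_neq_0 (z : C) : z <> RtoC 0 -> (z / 2)%C <> RtoC 0.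
Proof.
  intros Hz E. apply Hz. replace z with (2 * (z / 2))%C.
  - rewrite E. ring.
  - field.
Qed.

Lemma cross_product_eq nu z : -1 < nu -> z <> RtoC 0 -> Cmod z <= 1 ->
  cross_product nu z
  = (Cpower z (2 * nu + 1) * (RtoC (/ norm_const nu) * Pfun nu (z ^ 4)))%C.
Proof.
  intros Hnu Hz0 Hz. unfold cross_product.
  rewrite !bessel_J_eq, !bessel_I_eq by (auto; lra).
  assert (H := Pfun_cross nu z Hnu Hz). cbv zeta in H.
  set (x := (z / 2 * (z / 2))%C) in *.
  set (A := Cpower (z / 2) (nu + 1)). set (B := Cpower (z / 2) nu).
  transitivity ((A * B) * (RtoC (/ Gamma (nu + 1 + 1)) * RtoC (/ Gamma (nu + 1)))
    * (series_J (nu + 1) x * series_I nu x + series_J nu x * series_I (nu + 1) x))%C; [ring|].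
  rewrite H. unfold A, B. rewrite Cpower_plus by now apply Chalf_neq_0.
  rewrite Cpower_half by assumption.
  replace (nu + 1 + nu) with (2 * nu + 1) by ring.
  replace (nu + 1 + 1) with (nu + 2) by ring.
  rewrite <- RtoC_mult.
  transitivity (Cpower z (2 * nu + 1) *
    (RtoC (Rpower 2 (- (2 * nu + 1)) * (/ Gamma (nu + 2) * / Gamma (nu + 1)) * 2)
     * Pfun nu (z ^ 4)))%C; [rewrite !RtoC_mult; ring|].
  do 3 f_equal. unfold norm_const.
  assert (H1 := Gamma_pos (nu + 1) ltac:(lra)).
  assert (H2 := Gamma_pos (nu + 2) ltac:(lra)).
  rewrite Rpower_Ropp. rewrite Rpower_plus, Rpower_1 by lra.
  assert (H3 : 0 < Rpower 2 (2 * nu)) by apply exp_pos.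
  field. repeat split; lra.
Qed.

Lemma cross_product_0 nu : -1 < nu -> cross_product nu (RtoC 0) = RtoC 0.
Proof.
  intros Hnu. unfold cross_product, bessel_J, bessel_I.
  replace (RtoC 0 / 2)%C with (RtoC 0) by field.
  rewrite (Cpower_0 (nu + 1)) by lra. ring.
Qed.

Lemma cross_product_normalized nu z : -1 < nu -> z <> RtoC 0 -> Cmod z <= 1 ->
  (RtoC (norm_const nu) * cross_product nu z)%C = (Cpower z (2 * nu + 1) * Pfun nu (z ^ 4))%C.
Proof.
  intros Hnu Hz0 Hz. rewrite cross_product_eq by assumption.
  assert (H := norm_const_pos nu Hnu).
  rewrite RtoC_inv by lra. field; try (intros E; injection E; lra).
Qed.

Lemma f_norm_eq nu z : -1 < nu -> Cmod z <= 1 ->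
  f_norm nu z = (z * Cpower (Pfun nu (z ^ 4)) (1 / (2 * nu + 1)))%C.
Proof.
  intros Hnu Hz. unfold f_norm. destruct (Ceq_dec z 0) as [->|Hz0]; [ring|].
  do 2 f_equal.
  transitivity (Cpower z (- (2 * nu + 1)) * (RtoC (norm_const nu) * cross_product nu z))%C; [ring|].
  rewrite cross_product_normalized, Cmult_assoc, Cpower_plus by assumption.
  replace (- (2 * nu + 1) + (2 * nu + 1)) with 0 by ring.
  rewrite Cpower_0_r. ring.
Qed.

Lemma g_norm_eq nu z : -1 < nu -> Cmod z <= 1 -> g_norm nu z = (z * Pfun nu (z ^ 4))%C.
Proof.
  intros Hnu Hz. unfold g_norm. destruct (Ceq_dec z 0) as [->|Hz0].
  { rewrite cross_product_0 by assumption. ring. }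
  transitivity (Cpower z (- (2 * nu)) * (RtoC (norm_const nu) * cross_product nu z))%C; [ring|].
  rewrite cross_product_normalized, Cmult_assoc, Cpower_plus by assumption.
  replace (- (2 * nu) + (2 * nu + 1)) with 1 by ring.
  now rewrite Cpower_1_r.
Qed.

Lemma h_norm_eq nu z : -1 < nu -> Cmod z <= 1 -> h_norm nu z = (z * Pfun nu z)%C.
Proof.
  intros Hnu Hz. unfold h_norm. destruct (Ceq_dec z 0) as [->|Hz0].
  { rewrite (Cpower_0 (1 / 4)), cross_product_0 by lra. ring. }
  set (y := Cpower z (1 / 4)).
  assert (Hy0 : y <> RtoC 0) by now apply Cpower_neq_0.
  assert (Hy : Cmod y <= 1).
  { assert (H4 : Cmod y ^ 4 = Cmod z) by (rewrite <- Cmod_pow; unfold y; now rewrite root4_pow4).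
    apply Rnot_lt_le. intros Hlt. assert (1 < Cmod y ^ 4); [|lra].
    apply Rlt_pow_R1; [assumption|lia]. }
  transitivity (Cpower z (- nu / 2 + 3 / 4) * (RtoC (norm_const nu) * cross_product nu y))%C; [ring|].
  rewrite cross_product_normalized by assumption.
  replace (y ^ 4)%C with z by (symmetry; apply root4_pow4).
  rewrite Cmult_assoc. f_equal.
  rewrite (Cpower_def y) by assumption. unfold y. rewrite Clog_root4, Cpower_def by assumption.
  rewrite <- Cexp_plus. etransitivity; [|now apply Cexp_Clog].
  f_equal. transitivity (RtoC (- nu / 2 + 3 / 4 + (2 * nu + 1) * (1 / 4)) * Clog z)%C.
  - rewrite (RtoC_plus (- nu / 2 + 3 / 4)), (RtoC_mult (2 * nu + 1)). ring.
  - replace (- nu / 2 + 3 / 4 + (2 * nu + 1) * (1 / 4)) with 1 by field. ring.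
Qed.

(** * Values at 1 *)

Definition Pval (nu : R) : R := Series (pcoef nu).
(** Minus the derivative of [Pfun nu] at 1. *)
Definition Yval (nu : R) : R := Series (fun n => - INR n * pcoef nu n).

Lemma INR_le_pow2_S n : INR (S n) <= 2 ^ n.
Proof.
  induction n; [simpl; lra|]. rewrite S_INR.
  change (2 ^ S n) with (2 * 2 ^ n).
  assert (1 <= 2 ^ n) by (apply pow_R1_Rle; lra). lra.
Qed.

(** The decay of the coefficients leaves room for cubic weights. *)
Lemma weighted_summable nu (c : nat -> R) K : -1 < nu -> 0 <= K ->
  (forall n, Rabs (c (S n)) <= K * INR (S n) ^ 3) ->
  ex_series (fun n => Rabs (c n * pcoef nu n)).
Proof.
  intros Hnu HK Hc.
  apply ex_series_geometric_bound with (K * tcoef nu 1) (1 / 48); [lra|].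
  intros n. rewrite Rabs_Rabsolu, Rabs_mult, pcoef_abs by assumption.
  replace (1 / 48) with (2 ^ 3 * (1 / 384)) by field.
  rewrite Rpow_mult_distr, <- pow_mult, Nat.mul_comm, pow_mult.
  replace (K * tcoef nu 1 * ((2 ^ n) ^ 3 * (1 / 384) ^ n))
    with ((K * (2 ^ n) ^ 3) * (tcoef nu 1 * (1 / 384) ^ n)) by ring.
  apply Rmult_le_compat.
  - apply Rabs_pos.
  - left; now apply tcoef_pos.
  - apply Rle_trans with (1 := Hc n). apply Rmult_le_compat_l; [assumption|].
    apply pow_incr. split; [apply pos_INR|apply INR_le_pow2_S].
  - now apply tcoef_decay.
Qed.

Lemma INR_S_ge_1 n : 1 <= INR (S n).
Proof. rewrite S_INR. assert (H := pos_INR n). lra. Qed.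

Lemma pcoef_summable nu : -1 < nu -> ex_series (fun n => Rabs (pcoef nu n)).
Proof.
  intros Hnu. apply ex_series_ext with (fun n => Rabs (1 * pcoef nu n)).
  { intros n. now rewrite Rmult_1_l. }
  apply (weighted_summable nu (fun _ => 1) 1); [assumption|lra|].
  intros n. rewrite Rabs_R1, Rmult_1_l. apply pow_R1_Rle, INR_S_ge_1.
Qed.

Lemma pow3_ge x : 1 <= x -> x <= x ^ 3.
Proof. intros. simpl. rewrite Rmult_1_r. assert (1 <= x * x) by nra. nra. Qed.

Lemma pcoef_deriv_summable nu : -1 < nu -> ex_series (fun n => Rabs (- INR n * pcoef nu n)).
Proof.
  intros Hnu. apply (weighted_summable nu (fun n => - INR n) 1); [assumption|lra|].
  intros n. rewrite Rabs_Ropp, Rabs_pos_eq, Rmult_1_l by apply pos_INR.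
  apply pow3_ge, INR_S_ge_1.
Qed.

Lemma is_series_RtoC (u : nat -> R) (l : R) : is_series u l -> is_CSeries (fun n => RtoC (u n)) (RtoC l).
Proof.
  intros H. split; [exact H|]. simpl.
  apply is_series_ext with (fun n => scal 0 (u n)).
  - intros n. apply Rmult_0_l.
  - assert (H0 := is_series_scal (V := R_NormedModule) 0 _ _ H).
    exact (eq_rect _ (is_series _) H0 _ (Rmult_0_l l)).
Qed.

Lemma Cpower_1_l (a : R) : Cpower (RtoC 1) a = RtoC 1.
Proof.
  rewrite Cpower_def by (intros E; injection E; lra).
  assert (HL : Clog (RtoC 1) = RtoC 0).
  { rewrite <- exp_0, <- Cexp_RtoC. apply Clog_Cexp.
    simpl. assert (Hp := PI_RGT_0). lra. }
  rewrite HL, Cmult_0_r, Cexp_RtoC, exp_0. reflexivity.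
Qed.

Lemma is_CSeries_zero : is_CSeries (fun _ => RtoC 0) (RtoC 0).
Proof.
  split; simpl; apply is_series_Reals; intros eps Heps; exists 0%nat; intros n _;
    unfold R_dist; rewrite sum_cte, Rmult_0_l, Rminus_0_r, Rabs_R0; exact Heps.
Qed.

Lemma Pfun_1 nu : -1 < nu -> Pfun nu (RtoC 1) = RtoC (Pval nu).
Proof.
  intros Hnu. apply is_CSeries_unique.
  eapply is_CSeries_ext;
    [|apply is_series_RtoC, Series_correct, ex_series_Rabs, pcoef_summable, Hnu].
  intros n. cbv beta. rewrite Cpow_1_l. ring.
Qed.

Lemma square_at_1 nu : -1 < nu ->
  (bessel_J nu (RtoC 1) * bessel_I nu (RtoC 1))%C
  = RtoC (/ norm_const nu * ((nu + 1) * Pval nu - 2 * Yval nu)).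
Proof.
  intros Hnu.
  assert (H1 : Cmod (RtoC 1) <= 1) by (rewrite Cmod_1; lra).
  rewrite bessel_J_eq, bessel_I_eq by assumption.
  set (x := (RtoC 1 / 2 * (RtoC 1 / 2))%C).
  assert (H := series_JI nu x Hnu (Cmod_half_sqr _ H1)).
  assert (HS : is_series (fun n => (nu + 1 + 2 * INR n) * pcoef nu n)
                 ((nu + 1) * Pval nu - 2 * Yval nu)).
  { eapply is_series_ext; [|exact (is_series_minus _ _ _ _
      (is_series_scal (V := R_NormedModule) (nu + 1) _ _ (Series_correct _ (ex_series_Rabs _ (pcoef_summable nu Hnu))))
      (is_series_scal (V := R_NormedModule) 2 _ _ (Series_correct _ (ex_series_Rabs _ (pcoef_deriv_summable nu Hnu)))))].
    intros n. unfold plus, opp, scal; simpl; unfold mult; simpl. ring. }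
  apply is_series_RtoC in HS.
  assert (HE : (series_J nu x * series_I nu x)%C
               = (RtoC (/ (nu + 1)) * RtoC ((nu + 1) * Pval nu - 2 * Yval nu))%C).
  { rewrite <- (is_CSeries_unique _ _ H). apply is_CSeries_unique.
    eapply is_CSeries_ext; [|exact (is_CSeries_scal (RtoC (/ (nu + 1))) _ _ HS)].
    intros n. cbv beta.
    assert (Hq := quarter_pow4 (RtoC 1) n). fold x in Hq.
    replace (RtoC 1 ^ 4)%C with (RtoC 1) in Hq by ring. rewrite Cpow_1_l in Hq.
    replace (conv nu (2 * n)) with (/ (nu + 1) * (16 ^ n * ((nu + 1 + 2 * INR n) * pcoef nu n)))
      by (rewrite <- square_coef by assumption; field; lra).
    rewrite <- (Cmult_1_r (RtoC (/ (nu + 1)) * _)), <- Hq, !RtoC_mult. ring. }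
  transitivity (Cpower (RtoC 1 / 2) nu * Cpower (RtoC 1 / 2) nu
    * (RtoC (/ Gamma (nu + 1)) * RtoC (/ Gamma (nu + 1))) * (series_J nu x * series_I nu x))%C; [ring|].
  assert (H10 : RtoC 1 <> RtoC 0) by (intros E; injection E; lra).
  rewrite HE, Cpower_plus by now apply Chalf_neq_0.
  rewrite Cpower_half by assumption.
  rewrite Cpower_1_l.
  rewrite Cmult_1_l, <- !RtoC_mult. f_equal. unfold norm_const.
  replace (nu + 2) with (nu + 1 + 1) by ring. rewrite (Gamma_succ (nu + 1)) by lra.
  replace (nu + nu) with (2 * nu) by ring. rewrite Rpower_Ropp.
  assert (H2 := Gamma_pos (nu + 1) ltac:(lra)).
  assert (H3 : 0 < Rpower 2 (2 * nu)) by apply exp_pos.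
  field. repeat split; lra.
Qed.

Lemma cross_product_1 nu : -1 < nu ->
  cross_product nu (RtoC 1) = RtoC (/ norm_const nu * Pval nu).
Proof.
  intros Hnu. assert (H10 : RtoC 1 <> RtoC 0) by (intros E; injection E; lra).
  assert (H1 : Cmod (RtoC 1) <= 1) by (rewrite Cmod_1; lra).
  assert (H := cross_product_normalized nu _ Hnu H10 H1).
  replace (RtoC 1 ^ 4)%C with (RtoC 1) in H by ring. rewrite Pfun_1 in H by assumption.
  rewrite Cpower_1_l in H.
  rewrite RtoC_mult, RtoC_inv by (assert (Hn := norm_const_pos nu Hnu); lra).
  rewrite <- (Cmult_1_l (RtoC (Pval nu))), <- H. field.
  intros E; injection E; assert (Hn := norm_const_pos nu Hnu); lra.
Qed.

Lemma equation_iff nu (c d : R) : -1 < nu ->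
  ((RtoC d * bessel_J nu (RtoC 1) * bessel_I nu (RtoC 1)
    - RtoC c * cross_product nu (RtoC 1))%C = RtoC 0
   <-> (d * (nu + 1) - c) * Pval nu = 2 * d * Yval nu).
Proof.
  intros Hnu. assert (Hn := norm_const_pos nu Hnu).
  rewrite <- Cmult_assoc, square_at_1, cross_product_1 by assumption.
  rewrite <- !RtoC_mult, <- RtoC_minus.
  assert (Hi : 0 < / norm_const nu) by now apply Rinv_0_lt_compat.
  split.
  - intros E. injection E. intros E1. nra.
  - intros E. f_equal. nra.
Qed.

Lemma f_equation_iff alpha nu : -1 < nu ->
  (f_equation alpha nu <-> (1 - alpha) * (2 * nu + 1) * Pval nu = 4 * Yval nu).
Proof.
  intros Hnu. etransitivity; [exact (equation_iff nu (alpha * (2 * nu + 1) + 1) 2 Hnu)|].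
  split; intros; lra.
Qed.

Lemma g_equation_iff alpha nu : -1 < nu ->
  (g_equation alpha nu <-> (1 - alpha) * Pval nu = 4 * Yval nu).
Proof.
  intros Hnu. etransitivity; [exact (equation_iff nu (alpha + 2 * nu + 1) 2 Hnu)|].
  split; intros; lra.
Qed.

Lemma h_equation_iff alpha nu : -1 < nu ->
  (h_equation alpha nu <-> (1 - alpha) * Pval nu = Yval nu).
Proof.
  intros Hnu. etransitivity; [|etransitivity; [exact (equation_iff nu (2 * alpha + nu - 1) 1 Hnu)|]].
  - unfold h_equation, cross_product. rewrite Cmult_1_l. reflexivity.
  - split; intros; lra.
Qed.

(** * Dependence on the order *)

Lemma Series_head (u : nat -> R) : ex_series u -> Series u = u 0%nat + Series (fun n => u (S n)).
Proof. intros H. now apply Series_incr_1. Qed.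

(** The ratio 1/192 is twice the bound 1/384 on the ratios of the
    coefficients, so that differences of coefficients are covered too; with the
    linear weights the tail is at most [sum_n (2 / 192)^n = 1 / 95]. *)
Lemma alternating_near_head (u c : nat -> R) K :
  0 <= K -> (forall n, 0 <= u n) -> (forall n, u (S n) <= 1 / 192 * u n) ->
  (forall n, 0 <= c n <= K * (INR n + 1)) ->
  ex_series (fun n => (-1) ^ n * (c n * u n)) /\
  Rabs (Series (fun n => (-1) ^ n * (c n * u n)) - c 0%nat * u 0%nat) <= K * u 0%nat / 95.
Proof.
  intros HK Hu Hd Hc.
  set (v := fun n => (-1) ^ n * (c n * u n)).
  assert (Hg : forall n, u (S n) <= u 0%nat / 192 * (1 / 192) ^ n).
  { intros n. apply Rle_trans with (u 1%nat * (1 / 192) ^ n).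
    - apply geometric_decay; [lra|auto].
    - apply Rmult_le_compat_r; [apply pow_le; lra|]. specialize (Hd 0%nat). lra. }
  assert (Hv : forall n, Rabs (v (S n)) <= K * u 0%nat / 96 * (1 / 96) ^ n).
  { intros n. unfold v. rewrite Rabs_mult, pow_m1_abs, Rmult_1_l.
    specialize (Hc (S n)). specialize (Hu (S n)). specialize (Hg n).
    rewrite Rabs_pos_eq by (apply Rmult_le_pos; tauto).
    replace (K * u 0%nat / 96 * (1 / 96) ^ n)
      with ((K * 2 ^ S n) * (u 0%nat / 192 * (1 / 192) ^ n)).
    - apply Rmult_le_compat; try tauto.
      apply Rle_trans with (1 := proj2 Hc). apply Rmult_le_compat_l; [assumption|].
      assert (H := INR_le_pow2_S (S n)). rewrite S_INR in H. exact H.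
    - replace (1 / 96) with (2 * (1 / 192)) by field. rewrite Rpow_mult_distr. simpl. field. }
  assert (Hex : ex_series v).
  { apply ex_series_geometric_bound with (K * u 0%nat / 96) (1 / 96); [lra|exact Hv]. }
  split; [exact Hex|].
  rewrite (Series_head v Hex). unfold v at 1. simpl (_ ^ 0). rewrite Rmult_1_l.
  replace (c 0%nat * u 0%nat + _ - _) with (Series (fun n => v (S n))) by ring.
  assert (Hgs : ex_series (fun n => K * u 0%nat / 96 * (1 / 96) ^ n)).
  { apply (ex_series_scal (V := R_NormedModule)), ex_series_geom. rewrite Rabs_pos_eq; lra. }
  assert (Hab : ex_series (fun n => Rabs (v (S n)))).
  { apply (ex_series_le (V := R_CompleteNormedModule)) with (2 := Hgs).
    intros n. unfold norm; simpl; unfold abs; simpl. rewrite Rabs_Rabsolu. apply Hv. }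
  apply Rle_trans with (1 := Series_Rabs _ Hab).
  apply Rle_trans with (Series (fun n => K * u 0%nat / 96 * (1 / 96) ^ n)).
  - apply Series_le; [|exact Hgs]. intros n. split; [apply Rabs_pos|apply Hv].
  - rewrite Series_scal_l, Series_geom by (rewrite Rabs_pos_eq; lra).
    right. field.
Qed.

(** At the order -87/100 the sign of [1 - 5 t_1] is decided by about
    [10^-3], so that the error [t_1 / 95] of the two-sided bound is too large;
    for alternating terms one side is exact. *)
Lemma alternating_le_head (u c : nat -> R) :
  (forall n, 0 <= u n) -> (forall n, u (S n) <= 1 / 192 * u n) ->
  (forall n, 1 <= c n <= INR n + 1) ->
  Series (fun n => (-1) ^ n * (c n * u n)) <= c 0%nat * u 0%nat.
Proof.
  intros Hu Hd Hc.
  destruct (alternating_near_head u c 1) as [Hex _]; auto; [lra| |].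
  { intros n. specialize (Hc n). lra. }
  destruct (alternating_near_head (fun n => u (S n)) (fun n => c (S n)) 2) as [_ Ht]; auto; [lra| |].
  { intros n. specialize (Hc (S n)). rewrite S_INR in Hc. assert (H := pos_INR n). lra. }
  rewrite (Series_head _ Hex). simpl (_ ^ 0). rewrite Rmult_1_l.
  rewrite (Series_ext _ (fun n => -1 * ((-1) ^ n * (c (S n) * u (S n))))) by (intros; simpl; ring).
  rewrite Series_scal_l. apply Rabs_le_between in Ht.
  specialize (Hc 1%nat). specialize (Hu 1%nat). nra.
Qed.

Lemma tcoef_ratio nu n : -1 < nu -> tcoef nu (S (S n)) <= 1 / 192 * tcoef nu (S n).
Proof.
  intros Hnu. rewrite (tcoef_succ nu (S n)) by assumption.
  assert (H := tratio_le nu n Hnu). assert (H1 := tcoef_pos nu (S n) Hnu). nra.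
Qed.

(** The part of [Pval] and [Yval] after the constant term, as one alternating
    sum with weights [c]. *)
Definition alt_sum (c : nat -> R) (nu : R) : R :=
  Series (fun n => (-1) ^ n * (c n * tcoef nu (S n))).

Definition weight (c : nat -> R) : Prop := c 0%nat = 1 /\ forall n, 1 <= c n <= INR n + 1.

Lemma weight_1 : weight (fun _ => 1).
Proof. split; auto. intros n. assert (H := pos_INR n). lra. Qed.

Lemma weight_id : weight (fun n => INR n + 1).
Proof. split; [simpl; lra|]. intros n. assert (H := pos_INR n). lra. Qed.

Lemma alt_sum_bounds c nu : weight c -> -1 < nu ->
  tcoef nu 1 * (94 / 95) <= alt_sum c nu <= tcoef nu 1.
Proof.
  intros [Hc0 Hc] Hnu.
  assert (Hu : forall n, 0 <= tcoef nu (S n)) by (intros; left; now apply tcoef_pos).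
  assert (Hd : forall n, tcoef nu (S (S n)) <= 1 / 192 * tcoef nu (S n))
    by (intros; now apply tcoef_ratio).
  destruct (alternating_near_head (fun n => tcoef nu (S n)) c 1) as [_ Ht]; auto; [lra| |].
  { intros n. specialize (Hc n). lra. }
  assert (H := alternating_le_head (fun n => tcoef nu (S n)) c Hu Hd Hc).
  rewrite Hc0, Rmult_1_l in *. apply Rabs_le_between in Ht. unfold alt_sum. lra.
Qed.

Lemma tratio_antitone nu nu' n : -1 < nu -> nu <= nu' -> tratio nu' n <= tratio nu n.
Proof.
  intros Hnu Hle. assert (H := pos_INR n). unfold tratio. apply Rinv_le_contravar.
  - repeat apply Rmult_lt_0_compat; lra.
  - repeat apply Rmult_le_compat; repeat apply Rmult_le_pos; lra.
Qed.

Lemma tcoef_antitone nu nu' n : -1 < nu -> nu <= nu' -> tcoef nu' n <= tcoef nu n.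
Proof.
  intros Hnu Hle. induction n.
  - rewrite !tcoef_0. lra.
  - rewrite !tcoef_succ by lra. apply Rmult_le_compat; auto.
    + left; apply tcoef_pos; lra.
    + left; apply tratio_pos; lra.
    + now apply tratio_antitone.
Qed.

Lemma tcoef_1_ratio nu : -1 < nu -> tcoef nu 1 = tratio nu 0.
Proof. intros. rewrite tcoef_succ, tcoef_0 by assumption. ring. Qed.

(** [(nu + a) / (nu' + a)] increases with [a], so the relative variation in the
    order is largest for the first ratio. *)
Lemma tratio_relative nu nu' n : -1 < nu -> nu <= nu' ->
  tratio nu n * tratio nu' 0 <= tratio nu' n * tratio nu 0.
Proof.
  intros Hnu Hle. assert (H := pos_INR n). unfold tratio. simpl INR. rewrite <- !Rinv_mult.
  apply Rinv_le_contravar.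
  - repeat apply Rmult_lt_0_compat; lra.
  - assert (H1 : (nu' + INR n + 1) * (nu + 1) <= (nu + INR n + 1) * (nu' + 1)) by nra.
    assert (H2 : (nu' + 2 * INR n + 2) * (nu + 2) <= (nu + 2 * INR n + 2) * (nu' + 2)) by nra.
    assert (H3 : (nu' + 2 * INR n + 3) * (nu + 3) <= (nu + 2 * INR n + 3) * (nu' + 3)) by nra.
    replace (16 * (INR n + 1) * (nu' + INR n + 1) * (nu' + 2 * INR n + 2) * (nu' + 2 * INR n + 3)
             * (16 * (0 + 1) * (nu + 0 + 1) * (nu + 2 * 0 + 2) * (nu + 2 * 0 + 3)))
      with (256 * (INR n + 1) * (((nu' + INR n + 1) * (nu + 1))
             * ((nu' + 2 * INR n + 2) * (nu + 2)) * ((nu' + 2 * INR n + 3) * (nu + 3)))) by ring.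
    replace (16 * (INR n + 1) * (nu + INR n + 1) * (nu + 2 * INR n + 2) * (nu + 2 * INR n + 3)
             * (16 * (0 + 1) * (nu' + 0 + 1) * (nu' + 2 * 0 + 2) * (nu' + 2 * 0 + 3)))
      with (256 * (INR n + 1) * (((nu + INR n + 1) * (nu' + 1))
             * ((nu + 2 * INR n + 2) * (nu' + 2)) * ((nu + 2 * INR n + 3) * (nu' + 3)))) by ring.
    apply Rmult_le_compat_l; [lra|].
    apply Rmult_le_compat; [| |apply Rmult_le_compat; [| |exact H1|exact H2]|exact H3];
      repeat apply Rmult_le_pos; lra.
Qed.

Lemma tcoef_relative nu nu' n : -1 < nu -> nu <= nu' ->
  tcoef nu' (S n) * tratio nu 0 <= tcoef nu (S n) * tratio nu' 0.
Proof.
  intros Hnu Hle. induction n.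
  - rewrite !tcoef_1_ratio by lra. lra.
  - rewrite (tcoef_succ nu'), (tcoef_succ nu) by lra.
    assert (H := tratio_antitone nu nu' (S n) Hnu Hle).
    assert (H1 := tratio_pos nu' (S n) ltac:(lra)).
    assert (H2 := tcoef_pos nu (S n) Hnu). assert (H3 := tratio_pos nu' 0 ltac:(lra)).
    apply Rle_trans with (tcoef nu (S n) * tratio nu' 0 * tratio nu' (S n)).
    + replace (tcoef nu' (S n) * tratio nu' (S n) * tratio nu 0)
        with ((tcoef nu' (S n) * tratio nu 0) * tratio nu' (S n)) by ring.
      apply Rmult_le_compat_r; lra.
    + replace (tcoef nu (S n) * tratio nu (S n) * tratio nu' 0)
        with (tcoef nu (S n) * tratio nu' 0 * tratio nu (S n)) by ring.
      apply Rmult_le_compat_l; [nra|assumption].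
Qed.

(** Hence [t_n(nu') / t_n(nu)] is at most the corresponding quotient of the
    next ratio, and the difference [t_n q_n - t_n' q_n'] is at most
    [q_n (t_n - t_n') (t_n + t_n') / t_n <= 2 q_n (t_n - t_n')]. *)
Lemma tcoef_diff_ratio nu nu' n : -1 < nu -> nu <= nu' ->
  tcoef nu (S (S n)) - tcoef nu' (S (S n)) <= 1 / 192 * (tcoef nu (S n) - tcoef nu' (S n)).
Proof.
  intros Hnu Hle.
  assert (H1 := tcoef_relative nu nu' n Hnu Hle).
  assert (H2 := tratio_relative nu nu' (S n) Hnu Hle).
  assert (H3 := tcoef_antitone nu nu' (S n) Hnu Hle).
  assert (H4 := tratio_le nu n Hnu).
  rewrite (tcoef_succ nu (S n)), (tcoef_succ nu' (S n)) by lra.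
  assert (P1 := tcoef_pos nu (S n) Hnu). assert (P2 := tcoef_pos nu' (S n) ltac:(lra)).
  assert (P3 := tratio_pos nu (S n) Hnu). assert (P4 := tratio_pos nu 0 Hnu).
  set (t := tcoef nu (S n)) in *. set (t' := tcoef nu' (S n)) in *.
  set (q := tratio nu (S n)) in *. set (q' := tratio nu' (S n)) in *.
  set (r := tratio nu 0) in *. set (r' := tratio nu' 0) in *.
  assert (H5 : q * t' <= q' * t).
  { apply Rmult_le_reg_r with r; [assumption|].
    apply Rle_trans with (q * (t * r')).
    - rewrite Rmult_assoc. apply Rmult_le_compat_l; lra.
    - replace (q * (t * r')) with (t * (q * r')) by ring.
      replace (q' * t * r) with (t * (q' * r)) by ring.
      apply Rmult_le_compat_l; lra. }
  apply Rmult_le_reg_l with t; [assumption|].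
  assert (H6 : t' * (q * t') <= t' * (q' * t)) by (apply Rmult_le_compat_l; lra).
  apply Rle_trans with (q * ((t - t') * (t + t'))); [nra|].
  apply Rle_trans with (1 / 384 * ((t - t') * (t + t'))).
  - apply Rmult_le_compat_r; [apply Rmult_le_pos|]; lra.
  - assert ((t - t') * (t + t') <= (t - t') * (2 * t)) by (apply Rmult_le_compat_l; lra).
    lra.
Qed.

Lemma alt_sum_diff c nu nu' : weight c -> -1 < nu -> nu <= nu' ->
  (tcoef nu 1 - tcoef nu' 1) * (94 / 95) <= alt_sum c nu - alt_sum c nu'
  <= (tcoef nu 1 - tcoef nu' 1) * (96 / 95).
Proof.
  intros [Hc0 Hc] Hnu Hle.
  assert (Hc' : forall n, 0 <= c n <= 1 * (INR n + 1)) by (intros n; specialize (Hc n); lra).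
  assert (Hex : forall x, -1 < x -> ex_series (fun n => (-1) ^ n * (c n * tcoef x (S n)))).
  { intros x Hx. apply (alternating_near_head (fun n => tcoef x (S n)) c 1); auto; [lra| |].
    - intros; left; now apply tcoef_pos.
    - intros; now apply tcoef_ratio. }
  destruct (alternating_near_head (fun n => tcoef nu (S n) - tcoef nu' (S n)) c 1) as [_ Ht];
    auto; [lra| | |].
  - intros n. assert (H := tcoef_antitone nu nu' (S n) Hnu Hle). lra.
  - intros n. now apply tcoef_diff_ratio.
  - unfold alt_sum. rewrite <- Series_minus by (apply Hex; lra).
    rewrite (Series_ext _ (fun n => (-1) ^ n * (c n * (tcoef nu (S n) - tcoef nu' (S n)))))
      by (intros; ring).
    rewrite Hc0 in Ht. apply Rabs_le_between in Ht. lra.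
Qed.

Lemma tcoef_1_decr nu nu' : -1 < nu -> nu < nu' -> tcoef nu' 1 < tcoef nu 1.
Proof.
  intros Hnu Hlt. rewrite !tcoef_1. apply Rinv_lt_contravar.
  - repeat apply Rmult_lt_0_compat; lra.
  - assert (H1 : (nu + 1) * (nu + 2) < (nu' + 1) * (nu' + 2)) by nra.
    assert (H2 : 0 < (nu + 1) * (nu + 2)) by nra. nra.
Qed.

Lemma alt_sum_decr c nu nu' : weight c -> -1 < nu -> nu < nu' -> alt_sum c nu' < alt_sum c nu.
Proof.
  intros Hc Hnu Hlt. assert (H := alt_sum_diff c nu nu' Hc Hnu ltac:(lra)).
  assert (H1 := tcoef_1_decr nu nu' Hnu Hlt). lra.
Qed.

Lemma alt_sum_continuous c nu : weight c -> -1 < nu -> continuity_pt (alt_sum c) nu.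
Proof.
  intros Hc Hnu.
  assert (Ht : continuity_pt (fun x => tcoef x 1) nu).
  { apply continuity_pt_ext with (fun x => / (16 * (x + 1) * (x + 2) * (x + 3))).
    - intros x. now rewrite tcoef_1.
    - apply derivable_continuous_pt, ex_derive_Reals_0. auto_derive.
      repeat apply Rmult_integral_contrapositive_currified; lra. }
  intros eps Heps. destruct (Ht (eps / 2)) as [d [Hd Hd']]; [lra|].
  exists (Rmin d (nu + 1)). split; [apply Rmin_pos; lra|].
  intros x [HD Hx]. simpl in *. unfold R_dist in *.
  assert (Hx1 : Rabs (tcoef x 1 - tcoef nu 1) < eps / 2).
  { apply Hd'. split; auto. apply Rlt_le_trans with (1 := Hx), Rmin_l. }
  assert (Hx2 : Rabs (x - nu) < nu + 1) by (apply Rlt_le_trans with (1 := Hx), Rmin_r).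
  apply Rabs_lt_between in Hx2. apply Rabs_lt_between in Hx1. apply Rabs_lt_between.
  destruct (Rle_lt_dec nu x) as [Hle|Hlt].
  - assert (H := alt_sum_diff c nu x Hc Hnu Hle).
    assert (H1 := tcoef_antitone nu x 1 Hnu Hle). lra.
  - assert (H := alt_sum_diff c x nu Hc ltac:(lra) ltac:(lra)).
    assert (H1 := tcoef_antitone x nu 1 ltac:(lra) ltac:(lra)). lra.
Qed.

Lemma Pval_eq nu : -1 < nu -> Pval nu = 1 - alt_sum (fun _ => 1) nu.
Proof.
  intros Hnu. unfold Pval, alt_sum.
  rewrite Series_head by apply ex_series_Rabs, pcoef_summable, Hnu.
  unfold pcoef at 1. rewrite tcoef_0.
  rewrite (Series_ext (fun n => pcoef nu (S n))
             (fun n => -1 * ((-1) ^ n * (1 * tcoef nu (S n)))))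
    by (intros; unfold pcoef; simpl; ring).
  rewrite Series_scal_l. simpl. ring.
Qed.

Lemma Yval_eq nu : -1 < nu -> Yval nu = alt_sum (fun n => INR n + 1) nu.
Proof.
  intros Hnu. unfold Yval, alt_sum.
  rewrite Series_head by apply ex_series_Rabs, pcoef_deriv_summable, Hnu.
  rewrite (Series_ext (fun n => - INR (S n) * pcoef nu (S n))
             (fun n => (-1) ^ n * ((INR n + 1) * tcoef nu (S n))))
    by (intros; unfold pcoef; rewrite S_INR; simpl; ring).
  simpl. ring.
Qed.

Lemma Pval_bounds nu : -1 < nu ->
  1 - tcoef nu 1 <= Pval nu <= 1 - tcoef nu 1 * (94 / 95).
Proof.
  intros Hnu. rewrite Pval_eq by assumption.
  assert (H := alt_sum_bounds _ nu weight_1 Hnu). lra.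
Qed.

Lemma Yval_bounds nu : -1 < nu -> tcoef nu 1 * (94 / 95) <= Yval nu <= tcoef nu 1.
Proof. intros Hnu. rewrite Yval_eq by assumption. apply alt_sum_bounds; auto using weight_id. Qed.

Lemma Pval_incr nu nu' : -1 < nu -> nu < nu' -> Pval nu < Pval nu'.
Proof.
  intros Hnu Hlt. rewrite !Pval_eq by lra.
  assert (H := alt_sum_decr _ nu nu' weight_1 Hnu Hlt). lra.
Qed.

Lemma Yval_decr nu nu' : -1 < nu -> nu < nu' -> Yval nu' < Yval nu.
Proof. intros Hnu Hlt. rewrite !Yval_eq by lra. apply alt_sum_decr; auto using weight_id. Qed.

(** All three equations say that one of these functions vanishes. *)
Definition balance (s : R -> R) (m : R) (nu : R) : R := s nu * Pval nu - m * Yval nu.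

Lemma balance_continuous s m nu : -1 < nu ->
  continuity_pt s nu -> continuity_pt (balance s m) nu.
Proof.
  intros Hnu Hs.
  assert (HP : continuity_pt Pval nu).
  { apply continuity_pt_ext_loc with (fun x => 1 - alt_sum (fun _ => 1) x).
    - exists (mkposreal (nu + 1) ltac:(lra)). intros x Hx.
      unfold ball in Hx; simpl in Hx; unfold AbsRing_ball, abs, minus, plus, opp in Hx; simpl in Hx.
      apply Rabs_lt_between in Hx. symmetry. apply Pval_eq. lra.
    - apply continuity_pt_minus; [apply continuity_pt_const; now intros ? ?|].
      apply alt_sum_continuous; auto using weight_1. }
  assert (HY : continuity_pt Yval nu).
  { apply continuity_pt_ext_loc with (alt_sum (fun n => INR n + 1)).
    - exists (mkposreal (nu + 1) ltac:(lra)). intros x Hx.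
      unfold ball in Hx; simpl in Hx; unfold AbsRing_ball, abs, minus, plus, opp in Hx; simpl in Hx.
      apply Rabs_lt_between in Hx. symmetry. apply Yval_eq. lra.
    - apply alt_sum_continuous; auto using weight_id. }
  apply continuity_pt_minus.
  - now apply continuity_pt_mult.
  - apply continuity_pt_mult; [apply continuity_pt_const; now intros ? ?|assumption].
Qed.

(** Below [a] only the sign of [F] is prescribed: the function attached to
    [f_norm] need not be monotone for orders below -1/2. *)
Lemma root_of_increasing (F : R -> R) a b :
  -1 < a < b -> (forall nu, -1 < nu -> continuity_pt F nu) ->
  (forall nu, -1 < nu <= a -> F nu < 0) ->
  (forall nu nu', a <= nu -> nu < nu' -> F nu < F nu') -> 0 < F b ->
  exists nu0, a < nu0 /\ F nu0 = 0 /\ forall nu, -1 < nu -> (0 <= F nu <-> nu0 <= nu) /\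
    (F nu = 0 -> nu0 = nu).
Proof.
  intros Hab Hc Hneg Hinc Hpos.
  destruct (Ranalysis5.IVT_interv F a b) as [nu0 [[H1 H2] H3]]; try lra.
  { intros x Hx. apply Hc. lra. }
  { apply Hneg. lra. }
  assert (Ha : a < nu0).
  { destruct H1 as [H1|H1]; auto. exfalso. subst. assert (H := Hneg nu0 ltac:(lra)). lra. }
  exists nu0. split; [exact Ha|]. split; [exact H3|]. intros nu Hnu.
  destruct (Rtotal_order nu nu0) as [Hlt|[Heq|Hgt]].
  - assert (F nu < 0).
    { destruct (Rle_lt_dec nu a); [apply Hneg; lra|]. rewrite <- H3. apply Hinc; lra. }
    split; [split|]; lra.
  - subst. split; [split|]; lra.
  - assert (F nu0 < F nu) by (apply Hinc; lra). split; [split|]; lra.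
Qed.

(** * Elementary inequalities on the closed disk *)

Lemma Cmod_pow_le_1 (w : C) n : Cmod w <= 1 -> Cmod (w ^ n) <= 1.
Proof.
  intros Hw. rewrite Cmod_pow, <- (pow1 n). apply pow_incr. split; auto. apply Cmod_ge_0.
Qed.

Lemma Cmod_minus_sqr (w : C) : Cmod w <= 1 -> Cmod (1 - w) ^ 2 <= 2 * (1 - Re w).
Proof.
  intros Hw. assert (H := Cmod_sqr w). assert (H' := Cmod2_alt (1 - w)).
  assert (H0 := Cmod_ge_0 w). rewrite H'. destruct w as [x y]; simpl in *. nra.
Qed.

Lemma Re_minus_nonneg (w : C) : Cmod w <= 1 -> 0 <= 1 - Re w.
Proof. intros Hw. assert (H := re_le_Cmod w). apply Rabs_le_between in H. lra. Qed.

Lemma Re_minus_pos (w : C) : Cmod w < 1 -> 0 < 1 - Re w.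
Proof. intros Hw. assert (H := re_le_Cmod w). apply Rabs_le_between in H. lra. Qed.

Lemma Cmod_pow_diff (w z : C) n : Cmod w <= 1 -> Cmod z <= 1 ->
  Cmod (w ^ n - z ^ n) <= INR n * Cmod (w - z).
Proof.
  intros Hw Hz. induction n.
  - simpl. replace (1 - 1)%C with (RtoC 0) by ring. rewrite Cmod_0. lra.
  - replace (w ^ S n - z ^ S n)%C with (w * (w ^ n - z ^ n) + z ^ n * (w - z))%C by (simpl; ring).
    apply Rle_trans with (1 := Cmod_triangle _ _). rewrite !Cmod_mult, S_INR.
    assert (H := Cmod_pow_le_1 z n Hz). assert (H1 := Cmod_ge_0 (w - z)).
    assert (H2 := Cmod_ge_0 (w ^ n - z ^ n)). assert (H3 := Cmod_ge_0 w). nra.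
Qed.

(** On the circle this is [1 - cos (n t) <= n ^ 2 (1 - cos t)].  Unlike the
    bound on the modulus, it is linear in [1 - Re w]. *)
Lemma Re_minus_pow (w : C) n : Cmod w <= 1 -> 1 - Re (w ^ n) <= INR n ^ 2 * (1 - Re w).
Proof.
  intros Hw. induction n.
  - simpl. lra.
  - assert (H : 1 - Re (w ^ S n)
       = (1 - Re (w ^ n)) + (1 - Re w) - Re ((1 - w ^ n) * (1 - w))).
    { simpl Cpow. destruct (w ^ n)%C, w. simpl. ring. }
    rewrite H, S_INR.
    assert (H1 := re_le_Cmod ((1 - w ^ n) * (1 - w))). rewrite Cmod_mult in H1.
    assert (H2 := Cmod_pow_diff 1 w n ltac:(rewrite Cmod_1; lra) Hw).
    rewrite Cpow_1_l in H2. apply Rabs_le_between in H1.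
    assert (H3 := Cmod_minus_sqr w Hw). assert (H4 := Cmod_ge_0 (1 - w)).
    assert (H5 := pos_INR n). nra.
Qed.

Lemma ex_series_Rext (a b : nat -> R) :
  (forall n, a n = b n) -> ex_series a -> ex_series b.
Proof. exact (ex_series_ext a b). Qed.

(** * Power series with real coefficients on the closed disk *)

Definition Cps (b : nat -> R) (w : C) : C := CSeries (fun n => RtoC (b n) * w ^ n)%C.

(** The quadratic weight serves both the estimates near 1 and the
    differentiability on the disk. *)
Definition summable2 (b : nat -> R) : Prop := ex_series (fun n => INR n ^ 2 * Rabs (b n)).

Lemma summable2_abs b : summable2 b -> ex_series (fun n => Rabs (b n)).
Proof.
  intros H. apply ex_series_incr_1. apply ex_series_incr_1 in H.
  apply (ex_series_le (V := R_CompleteNormedModule)) with (2 := H).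
  intros n. change (Rabs (Rabs (b (S n))) <= INR (S n) ^ 2 * Rabs (b (S n))).
  rewrite Rabs_Rabsolu.
  assert (H1 := INR_S_ge_1 n). assert (H2 := Rabs_pos (b (S n))).
  assert (H3 : 1 <= INR (S n) ^ 2) by now apply pow_R1_Rle.
  rewrite <- (Rmult_1_l (Rabs (b (S n)))) at 1. now apply Rmult_le_compat_r.
Qed.

Lemma Cps_bound (b : nat -> R) (v : nat -> C) (k : nat -> R) :
  ex_series (fun n => k n * Rabs (b n)) -> (forall n, Cmod (v n) <= k n) ->
  Csummable (fun n => RtoC (b n) * v n)%C /\
  Cmod (CSeries (fun n => RtoC (b n) * v n)%C) <= Series (fun n => k n * Rabs (b n)).
Proof.
  intros Hb Hv.
  assert (Hn : forall n, 0 <= Cmod (RtoC (b n) * v n) <= k n * Rabs (b n)).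
  { intros n. split; [apply Cmod_ge_0|]. rewrite Cmod_mult, Cmod_R, Rmult_comm.
    apply Rmult_le_compat_r; [apply Rabs_pos|apply Hv]. }
  assert (Hs : Csummable (fun n => RtoC (b n) * v n)%C).
  { apply (ex_series_le (V := R_CompleteNormedModule)) with (2 := Hb).
    intros n. unfold norm; simpl; unfold abs; simpl.
    rewrite Rabs_pos_eq; apply Hn. }
  split; [exact Hs|].
  apply Rle_trans with (1 := Cmod_CSeries_le _ Hs).
  apply Series_le; assumption.
Qed.

Lemma Cps_summable b w : summable2 b -> Cmod w <= 1 -> Csummable (fun n => RtoC (b n) * w ^ n)%C.
Proof.
  intros Hb Hw. apply (Cps_bound b (fun n => w ^ n)%C (fun _ => 1)).
  - apply ex_series_Rext with (fun n => Rabs (b n)); [intros; ring|now apply summable2_abs].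
  - intros n. now apply Cmod_pow_le_1.
Qed.

Lemma Cps_diff b w z : summable2 b -> Cmod w <= 1 -> Cmod z <= 1 ->
  is_CSeries (fun n => RtoC (b n) * (z ^ n - w ^ n))%C (Cps b z - Cps b w)%C.
Proof.
  intros Hb Hw Hz.
  assert (H1 := CSeries_correct _ (Cps_summable b z Hb Hz)).
  assert (H2 := CSeries_correct _ (Cps_summable b w Hb Hw)).
  assert (H3 := is_CSeries_plus _ _ _ _ H1 (is_CSeries_scal (- (1)) _ _ H2)).
  fold (Cps b z) (Cps b w) in H3.
  replace (Cps b z - Cps b w)%C with (Cps b z + - (1) * Cps b w)%C by ring.
  eapply is_CSeries_ext; [|exact H3]. intros n. cbv beta. ring.
Qed.

Definition weight2 (b : nat -> R) : R := Series (fun n => INR n ^ 2 * Rabs (b n)).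

Lemma Cps_lipschitz b w z : summable2 b -> Cmod w <= 1 -> Cmod z <= 1 ->
  Cmod (Cps b z - Cps b w) <= weight2 b * Cmod (z - w).
Proof.
  intros Hb Hw Hz.
  rewrite <- (is_CSeries_unique _ _ (Cps_diff b w z Hb Hw Hz)).
  unfold weight2. rewrite Rmult_comm, <- Series_scal_l.
  rewrite (Series_ext _ (fun n => (INR n ^ 2 * Cmod (z - w)) * Rabs (b n))) by (intros; ring).
  apply (Cps_bound b (fun n => z ^ n - w ^ n)%C).
  - apply ex_series_Rext with (fun n => Cmod (z - w) * (INR n ^ 2 * Rabs (b n)));
      [intros; ring|now apply (ex_series_scal (V := R_NormedModule))].
  - intros n. apply Rle_trans with (1 := Cmod_pow_diff z w n Hz Hw).
    apply Rmult_le_compat_r; [apply Cmod_ge_0|].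
    destruct n; [simpl; lra|]. assert (H := INR_S_ge_1 n). nra.
Qed.

Lemma weight2_nonneg b : summable2 b -> 0 <= weight2 b.
Proof.
  intros Hb. unfold weight2. rewrite <- (Rmult_0_l (Series (fun _ => 0))), <- Series_scal_l.
  apply Series_le; [|exact Hb]. intros n. rewrite Rmult_0_l. split; [lra|].
  apply Rmult_le_pos; [apply pow_le, pos_INR|apply Rabs_pos].
Qed.

(** The real part and the modulus are bounded separately: the first is of
    second order on the circle near 1, the modulus only of first order. *)
Lemma Cps_near_1 b w : summable2 b -> Cmod w <= 1 ->
  Rabs (Re (Cps b 1 - Cps b w)) <= weight2 b * (1 - Re w) /\
  Cmod (Cps b 1 - Cps b w) <= weight2 b * Cmod (1 - w).
Proof.
  intros Hb Hw.
  assert (H1 : Cmod 1 <= 1) by (rewrite Cmod_1; lra).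
  assert (Hd := Cps_diff b w 1 Hb Hw H1).
  split.
  - destruct Hd as [Hre _]. rewrite <- (is_series_unique _ _ Hre).
    assert (Hk : forall n, Rabs (Re (RtoC (b n) * (RtoC 1 ^ n - w ^ n)))
                   <= (1 - Re w) * (INR n ^ 2 * Rabs (b n))).
    { intros n. rewrite Cpow_1_l.
      replace (Re (RtoC (b n) * (RtoC 1 - w ^ n))) with (b n * (1 - Re (w ^ n)))
        by (destruct (w ^ n)%C; simpl; ring).
      rewrite Rabs_mult, (Rabs_pos_eq (1 - _))
        by (apply Re_minus_nonneg, Cmod_pow_le_1, Hw).
      replace ((1 - Re w) * (INR n ^ 2 * Rabs (b n)))
        with (Rabs (b n) * (INR n ^ 2 * (1 - Re w))) by ring.
      apply Rmult_le_compat_l; [apply Rabs_pos|now apply Re_minus_pow]. }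
    assert (Hs : ex_series (fun n => (1 - Re w) * (INR n ^ 2 * Rabs (b n))))
      by now apply (ex_series_scal (V := R_NormedModule)).
    unfold weight2. rewrite Rmult_comm, <- Series_scal_l.
    assert (Ha : ex_series (fun n => Rabs (Re (RtoC (b n) * (RtoC 1 ^ n - w ^ n))))).
    { apply (ex_series_le (V := R_CompleteNormedModule)) with (2 := Hs).
      intros n. unfold norm; simpl; unfold abs; simpl. rewrite Rabs_Rabsolu. apply Hk. }
    apply Rle_trans with (1 := Series_Rabs _ Ha).
    apply Series_le; [|exact Hs]. intros n. split; [apply Rabs_pos|apply Hk].
  - now apply Cps_lipschitz.
Qed.

Definition tail2 (b : nat -> R) (n : nat) : R := match n with O => 0 | S O => 0 | _ => b n end.

Lemma tail2_summable b : summable2 b -> summable2 (tail2 b).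
Proof.
  intros H. apply (ex_series_le (V := R_CompleteNormedModule)) with (2 := H).
  intros n. unfold norm; simpl; unfold abs; simpl.
  rewrite !Rmult_1_r, Rabs_mult, Rabs_Rabsolu.
  assert (H1 := Rle_0_sqr (INR n)). unfold Rsqr in H1.
  rewrite (Rabs_pos_eq (INR n * INR n)) by assumption.
  apply Rmult_le_compat_l; [assumption|].
  destruct n as [|[|n]]; simpl; rewrite ?Rabs_R0; try apply Rabs_pos. lra.
Qed.

Lemma Cps_head b w : summable2 b -> Cmod w <= 1 ->
  Cps b w = (RtoC (b 0%nat) + RtoC (b 1%nat) * w + Cps (tail2 b) w)%C.
Proof.
  intros Hb Hw.
  assert (H := CSeries_correct _ (Cps_summable _ w (tail2_summable b Hb) Hw)).
  fold (Cps (tail2 b) w) in H. apply is_CSeries_unique.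
  assert (H1 : is_CSeries (fun n => match n with O => RtoC (b 0%nat) | S O => RtoC (b 1%nat) * w
                             | _ => RtoC 0 end)%C (RtoC (b 0%nat) + RtoC (b 1%nat) * w)%C).
  { apply is_CSeries_decr_1, is_CSeries_decr_1. cbv beta iota.
    replace (_ - _)%C with (RtoC 0) by ring.
    apply is_CSeries_zero. }
  eapply is_CSeries_ext; [|exact (is_CSeries_plus _ _ _ _ H1 H)].
  intros [|[|n]]; cbv beta iota; simpl tail2; simpl Cpow; ring.
Qed.

(** * The function [P] near 1 *)

Definition scoef (nu : R) (c : nat -> R) (n : nat) : R := c n * pcoef nu n.

Lemma scoef_summable2 nu c K : -1 < nu -> 0 <= K ->
  (forall n, Rabs (c (S n)) <= K * INR (S n)) -> summable2 (scoef nu c).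
Proof.
  intros Hnu HK Hc.
  apply ex_series_Rext with (fun n => Rabs ((INR n ^ 2 * c n) * pcoef nu n)).
  - intros n. unfold scoef. rewrite !Rabs_mult.
    rewrite (Rabs_pos_eq (INR n ^ 2)) by (apply pow_le, pos_INR). ring.
  - apply (weighted_summable nu (fun n => INR n ^ 2 * c n) K); auto.
    intros n. rewrite Rabs_mult, Rabs_pos_eq by (apply pow_le, pos_INR).
    specialize (Hc n). assert (H := pos_INR (S n)).
    replace (K * INR (S n) ^ 3) with (INR (S n) ^ 2 * (K * INR (S n))) by ring.
    apply Rmult_le_compat_l; [apply pow_le, pos_INR|assumption].
Qed.

Lemma cube_bound n : INR (S (S n)) ^ 3 <= 8 * 4 ^ n.
Proof.
  induction n; [simpl; lra|]. rewrite S_INR.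
  change (4 ^ S n) with (4 * 4 ^ n).
  assert (H : 2 <= INR (S (S n))) by (rewrite !S_INR; assert (H := pos_INR n); lra).
  set (x := INR (S (S n))) in *.
  apply Rle_trans with (4 * x ^ 3); [|lra].
  assert (0 <= (x - 2) * (x * x)) by (apply Rmult_le_pos; [lra|apply Rle_0_sqr]).
  simpl. nra.
Qed.

Lemma tail2_weight nu (b : nat -> R) K : -1 < nu -> 0 <= K ->
  (forall n, Rabs (b (S (S n))) <= K * (INR (S (S n)) * tcoef nu (S (S n)))) ->
  weight2 (tail2 b) <= K * (9 * tcoef nu 2).
Proof.
  intros Hnu HK Hb.
  assert (Hg : ex_series (fun n => K * (8 * tcoef nu 2) * (1 / 96) ^ n)).
  { apply (ex_series_scal (V := R_NormedModule)), ex_series_geom. rewrite Rabs_pos_eq; lra. }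
  assert (Ht : forall n, tcoef nu (S (S n)) <= tcoef nu 2 * (1 / 384) ^ n).
  { intros n. apply (geometric_decay (fun k => tcoef nu (S k))); [lra|]. intros k.
    rewrite (tcoef_succ nu (S (S k))), Rmult_comm by assumption.
    apply Rmult_le_compat_r; [left; now apply tcoef_pos|now apply tratio_le]. }
  assert (Hn : forall n, 0 <= INR (S (S n)) ^ 2 * Rabs (b (S (S n)))
                 <= K * (8 * tcoef nu 2) * (1 / 96) ^ n).
  { intros n. split; [apply Rmult_le_pos; [apply pow_le, pos_INR|apply Rabs_pos]|].
    apply Rle_trans with (INR (S (S n)) ^ 2 * (K * (INR (S (S n)) * tcoef nu (S (S n))))).
    - apply Rmult_le_compat_l; [apply pow_le, pos_INR|apply Hb].
    - replace (INR (S (S n)) ^ 2 * (K * (INR (S (S n)) * tcoef nu (S (S n)))))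
        with (K * (INR (S (S n)) ^ 3 * tcoef nu (S (S n)))) by ring.
      replace (K * (8 * tcoef nu 2) * (1 / 96) ^ n)
        with (K * ((8 * 4 ^ n) * (tcoef nu 2 * (1 / 384) ^ n))).
      + apply Rmult_le_compat_l; [assumption|]. apply Rmult_le_compat.
        * apply pow_le, pos_INR.
        * left; now apply tcoef_pos.
        * apply cube_bound.
        * apply Ht.
      + replace (1 / 96) with (4 * (1 / 384)) by field. rewrite Rpow_mult_distr. ring. }
  assert (He2 : ex_series (fun n => INR (S (S n)) ^ 2 * Rabs (b (S (S n))))).
  { apply (ex_series_le (V := R_CompleteNormedModule)) with (2 := Hg).
    intros n. unfold norm; simpl norm; unfold abs; simpl abs.
    rewrite Rabs_pos_eq; apply Hn. }
  unfold weight2.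
  rewrite (Series_incr_1 (fun n => INR n ^ 2 * Rabs (tail2 b n)))
    by (apply ex_series_incr_1, ex_series_incr_1; exact He2).
  rewrite (Series_incr_1 (fun n => INR (S n) ^ 2 * Rabs (tail2 b (S n))))
    by (apply ex_series_incr_1; exact He2).
  simpl tail2. rewrite Rabs_R0, !Rmult_0_r, !Rplus_0_l.
  apply Rle_trans with (1 := Series_le _ _ Hn Hg).
  rewrite Series_scal_l, Series_geom by (rewrite Rabs_pos_eq; lra).
  assert (H := tcoef_pos nu 2 Hnu).
  assert (0 <= K * tcoef nu 2) by (apply Rmult_le_pos; lra). lra.
Qed.

(** Expansion at 1 to first order in [1 - w], with the error measured in the
    two ways in which it is used. *)
Lemma scoef_near_1 nu c K w : -1 < nu -> 0 <= K -> (forall n, Rabs (c (S n)) <= K * INR (S n)) ->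
  Cmod w <= 1 ->
  exists E : C,
    Cps (scoef nu c) w
      = (Cps (scoef nu c) 1 + RtoC (c 1%nat * tcoef nu 1) * (1 - w) - E)%C /\
    Rabs (Re E) <= K * (9 * tcoef nu 2) * (1 - Re w) /\
    Cmod E <= K * (9 * tcoef nu 2) * Cmod (1 - w).
Proof.
  intros Hnu HK Hc Hw.
  assert (Hs := scoef_summable2 nu c K Hnu HK Hc).
  assert (H1 : Cmod 1 <= 1) by (rewrite Cmod_1; lra).
  exists (Cps (tail2 (scoef nu c)) 1 - Cps (tail2 (scoef nu c)) w)%C.
  destruct (Cps_near_1 _ w (tail2_summable _ Hs) Hw) as [Ha Hb].
  assert (Ht : weight2 (tail2 (scoef nu c)) <= K * (9 * tcoef nu 2)).
  { apply tail2_weight; auto. intros n. unfold scoef. rewrite Rabs_mult, pcoef_abs by assumption.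
    rewrite <- Rmult_assoc. apply Rmult_le_compat_r; [left; now apply tcoef_pos|apply Hc]. }
  split; [|split].
  - rewrite (Cps_head _ w Hs Hw), (Cps_head _ 1 Hs H1).
    replace (c 1%nat * tcoef nu 1) with (- scoef nu c 1) by (unfold scoef, pcoef; simpl; ring).
    rewrite RtoC_opp. ring.
  - apply Rle_trans with (1 := Ha). apply Rmult_le_compat_r; [now apply Re_minus_nonneg|assumption].
  - apply Rle_trans with (1 := Hb). apply Rmult_le_compat_r; [apply Cmod_ge_0|assumption].
Qed.

(** * Real parts of P and of its logarithmic derivative *)

(** The Euler derivative [w P'(w)]. *)
Definition theta (nu : R) (w : C) : C := Cps (fun n => INR n * pcoef nu n) w.

(** The combination [x P(w) + y w P'(w)], whose series is estimated as one. *)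
Definition affine (x y : R) (n : nat) : R := x + y * INR n.

Lemma affine_bound x y n : 0 <= x -> 0 <= y -> Rabs (affine x y (S n)) <= (x + y) * INR (S n).
Proof.
  intros Hx Hy. unfold affine. assert (H := INR_S_ge_1 n).
  rewrite Rabs_pos_eq by nra. nra.
Qed.

Lemma affine_summable nu x y : -1 < nu -> 0 <= x -> 0 <= y -> summable2 (scoef nu (affine x y)).
Proof.
  intros Hnu Hx Hy. apply scoef_summable2 with (x + y); auto; [lra|].
  intros n. now apply affine_bound.
Qed.

Lemma Pfun_affine nu w : Pfun nu w = Cps (scoef nu (affine 1 0)) w.
Proof.
  apply CSeries_ext. intros n. do 2 f_equal. unfold scoef, affine. ring.
Qed.

Lemma theta_affine nu w : theta nu w = Cps (scoef nu (affine 0 1)) w.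
Proof.
  apply CSeries_ext. intros n. do 2 f_equal. unfold scoef, affine. ring.
Qed.

Lemma Cps_affine nu x y w : -1 < nu -> Cmod w <= 1 ->
  Cps (scoef nu (affine x y)) w = (RtoC x * Pfun nu w + RtoC y * theta nu w)%C.
Proof.
  intros Hnu Hw.
  assert (HP := CSeries_correct _ (Cps_summable _ w (affine_summable nu 1 0 Hnu ltac:(lra) ltac:(lra)) Hw)).
  assert (HT := CSeries_correct _ (Cps_summable _ w (affine_summable nu 0 1 Hnu ltac:(lra) ltac:(lra)) Hw)).
  fold (Cps (scoef nu (affine 1 0)) w) in HP. fold (Cps (scoef nu (affine 0 1)) w) in HT.
  rewrite <- Pfun_affine in HP. rewrite <- theta_affine in HT.
  apply is_CSeries_unique.
  eapply is_CSeries_ext;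
    [|exact (is_CSeries_plus _ _ _ _ (is_CSeries_scal (RtoC x) _ _ HP) (is_CSeries_scal (RtoC y) _ _ HT))].
  intros n. cbv beta. rewrite !Cmult_assoc, <- !RtoC_mult, <- Cmult_plus_distr_r, <- RtoC_plus.
  do 2 f_equal. unfold scoef, affine. ring.
Qed.

Lemma theta_1 nu : -1 < nu -> theta nu 1 = RtoC (- Yval nu).
Proof.
  intros Hnu. apply is_CSeries_unique.
  assert (H := Series_correct _ (ex_series_Rabs _ (pcoef_deriv_summable nu Hnu))).
  assert (H1 := is_series_opp _ _ H). fold (Yval nu) in H1.
  eapply is_CSeries_ext; [|exact (is_series_RtoC _ _ H1)].
  intros n. cbv beta. rewrite Cpow_1_l, Cmult_1_r. f_equal. unfold opp; simpl. ring.
Qed.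

Lemma affine_near_1 nu x y w : -1 < nu -> 0 <= x -> 0 <= y -> Cmod w <= 1 ->
  exists E : C,
    (RtoC x * Pfun nu w + RtoC y * theta nu w)%C
      = (RtoC (x * Pval nu - y * Yval nu) + RtoC ((x + y) * tcoef nu 1) * (1 - w) - E)%C /\
    Rabs (Re E) <= (x + y) * (9 * tcoef nu 2) * (1 - Re w) /\
    Cmod E <= (x + y) * (9 * tcoef nu 2) * Cmod (1 - w).
Proof.
  intros Hnu Hx Hy Hw.
  destruct (scoef_near_1 nu (affine x y) (x + y) w Hnu ltac:(lra)
              (fun n => affine_bound x y n Hx Hy) Hw) as [E [H1 [H2 H3]]].
  exists E. split; [|now split].
  rewrite Cps_affine in H1 by assumption. rewrite H1.
  rewrite Cps_affine, Pfun_1, theta_1 by (auto; rewrite Cmod_1; lra).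
  do 2 f_equal.
  - rewrite <- !RtoC_mult, <- RtoC_plus. f_equal. ring.
  - do 2 f_equal. unfold affine. simpl. ring.
Qed.

Lemma Re_affine_lower nu x y w : -1 < nu -> 0 <= x -> 0 <= y -> Cmod w <= 1 ->
  x * Pval nu - y * Yval nu + (x + y) * (tcoef nu 1 - 9 * tcoef nu 2) * (1 - Re w)
  <= Re (RtoC x * Pfun nu w + RtoC y * theta nu w).
Proof.
  intros Hnu Hx Hy Hw.
  destruct (affine_near_1 nu x y w Hnu Hx Hy Hw) as [E [H1 [H2 _]]].
  rewrite H1. apply Rabs_le_between in H2.
  replace (Re (RtoC (x * Pval nu - y * Yval nu) + RtoC ((x + y) * tcoef nu 1) * (1 - w) - E))
    with (x * Pval nu - y * Yval nu + (x + y) * tcoef nu 1 * (1 - Re w) - Re E)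
    by (destruct w, E; simpl; ring).
  lra.
Qed.

Lemma tcoef_2_bound nu : -1 < nu -> 0 < tcoef nu 2 <= tcoef nu 1 / 384.
Proof.
  intros Hnu. split; [now apply tcoef_pos|]. rewrite (tcoef_succ nu 1) by assumption.
  assert (H := tratio_le nu 0 Hnu). assert (H1 := tcoef_pos nu 1 Hnu). nra.
Qed.

(** For [x = 1] and [y = m] the combination is the derivative of [z P(z^m)],
    whose real part is thus smallest at 1. *)
Lemma Re_affine_pos nu x y w : -1 < nu -> 0 < x -> 0 <= y ->
  0 <= x * Pval nu - y * Yval nu -> Cmod w < 1 ->
  0 < Re (RtoC x * Pfun nu w + RtoC y * theta nu w).
Proof.
  intros Hnu Hx Hy H0 Hw.
  assert (H := Re_affine_lower nu x y w Hnu ltac:(lra) Hy ltac:(lra)).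
  assert (H1 := tcoef_2_bound nu Hnu). assert (H2 := Re_minus_pos w Hw).
  assert (0 < (x + y) * (tcoef nu 1 - 9 * tcoef nu 2) * (1 - Re w)).
  { repeat apply Rmult_lt_0_compat; lra. }
  lra.
Qed.

Lemma Re_Pfun_lower nu w : -1 < nu -> Cmod w <= 1 ->
  Pval nu + (tcoef nu 1 - 9 * tcoef nu 2) * (1 - Re w) <= Re (Pfun nu w).
Proof.
  intros Hnu Hw. assert (H := Re_affine_lower nu 1 0 w Hnu ltac:(lra) ltac:(lra) Hw).
  rewrite Cmult_0_l, Cmult_1_l, Cplus_0_r in H. lra.
Qed.

Lemma Re_Pfun_pos nu w : -1 < nu -> 0 < Pval nu -> Cmod w <= 1 -> 0 < Re (Pfun nu w).
Proof.
  intros Hnu HP Hw. assert (H := Re_Pfun_lower nu w Hnu Hw).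
  assert (H1 := tcoef_2_bound nu Hnu). assert (H2 := Re_minus_nonneg w Hw).
  assert (0 <= (tcoef nu 1 - 9 * tcoef nu 2) * (1 - Re w)) by (apply Rmult_le_pos; lra).
  lra.
Qed.

Lemma Rabs_Re_conj x y : Rabs (Re (x * Cconj y)) <= Cmod x * Cmod y.
Proof. rewrite <- (Cmod_conj y), <- Cmod_mult. apply re_le_Cmod. Qed.

(** With [u = Y / P(1)], the function [V(w) = w P'(w) + u P(w)] vanishes at 1,
    and the claim is that [Re (V(w) conj P(w)) > 0].  To first order in
    [d = 1 - w] both factors are known: [V = v d - E] and [P = P(1) + t d - E'].
    The term [v t |d| ^ 2] is nonnegative, and the errors are bounded by small
    multiples of [Re d], because [|d| ^ 2 <= 2 Re d]. *)
Lemma Re_theta_over_P nu w : -1 < nu -> 0 < Pval nu -> Yval nu <= Pval nu -> Cmod w < 1 ->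
  - (Yval nu / Pval nu) < Re (theta nu w / Pfun nu w).
Proof.
  intros Hnu HP HYP Hw.
  assert (Hw1 : Cmod w <= 1) by lra.
  set (u := Yval nu / Pval nu).
  assert (Ht1 := tcoef_pos nu 1 Hnu). assert (Ht2 := tcoef_2_bound nu Hnu).
  assert (HPb := Pval_bounds nu Hnu). assert (HYb := Yval_bounds nu Hnu).
  assert (Hu : 0 <= u <= 1).
  { split; unfold u.
    - apply Rdiv_le_0_compat; lra.
    - apply Rmult_le_reg_r with (Pval nu); [assumption|]. field_simplify; lra. }
  assert (HRe := Re_Pfun_pos nu w Hnu HP Hw1).
  assert (HPw : Pfun nu w <> RtoC 0) by (intros E; rewrite E in HRe; simpl in HRe; lra).
  destruct (affine_near_1 nu u 1 w Hnu ltac:(lra) ltac:(lra) Hw1) as [E [HE [HE1 HE2]]].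
  destruct (affine_near_1 nu 1 0 w Hnu ltac:(lra) ltac:(lra) Hw1) as [E' [HE' [_ HE3]]].
  replace (u * Pval nu - 1 * Yval nu) with 0 in HE by (unfold u; field; lra).
  clearbody u.
  replace (RtoC u * Pfun nu w + RtoC 1 * theta nu w)%C
    with (theta nu w + RtoC u * Pfun nu w)%C in HE by ring.
  replace (RtoC 1 * Pfun nu w + RtoC 0 * theta nu w)%C with (Pfun nu w) in HE' by ring.
  replace (1 * Pval nu - 0 * Yval nu) with (Pval nu) in HE' by ring.
  replace ((1 + 0) * tcoef nu 1) with (tcoef nu 1) in HE' by ring.
  set (V := (theta nu w + RtoC u * Pfun nu w)%C) in *.
  set (d := (1 - w)%C) in *.
  set (a := 1 - Re w) in *.
  set (t := tcoef nu 1) in *. set (v := (u + 1) * t) in *.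
  assert (Ha : 0 < a) by (apply Re_minus_pos, Hw).
  assert (Hd : Cmod d ^ 2 <= 2 * a) by now apply Cmod_minus_sqr.
  assert (Hda : Re d = a) by (destruct w; unfold d, a; simpl; ring).
  assert (HVP : Re (V * Cconj (Pfun nu w))
    = Pval nu * (v * a - Re E)
      + (v * t * Cmod d ^ 2 - v * Re (d * Cconj E') - t * Re (E * Cconj d) + Re (E * Cconj E'))).
  { rewrite HE, HE'. rewrite Cmod2_alt, <- Hda.
    destruct d as [d1 d2], E as [e1 e2], E' as [f1 f2]. simpl. ring. }
  assert (K1 := Rabs_Re_conj d E'). assert (K2 := Rabs_Re_conj E d). assert (K3 := Rabs_Re_conj E E').
  apply Rabs_le_between in K1. apply Rabs_le_between in K2. apply Rabs_le_between in K3.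
  apply Rabs_le_between in HE1.
  assert (Hd0 := Cmod_ge_0 d). assert (HEp := Cmod_ge_0 E). assert (HEp' := Cmod_ge_0 E').
  set (s := 9 / 384).
  assert (B1 : Rabs (Re E) <= 2 * s * t * a).
  { apply Rabs_le_between.
    assert ((u + 1) * (9 * tcoef nu 2) * a <= 2 * s * t * a).
    { apply Rmult_le_compat_r; [lra|].
      apply Rle_trans with (2 * (9 * tcoef nu 2)); [apply Rmult_le_compat_r; lra|].
      unfold s. lra. }
    lra. }
  assert (B2 : Cmod E <= 2 * s * t * Cmod d).
  { apply Rle_trans with (1 := HE2). apply Rmult_le_compat_r; [assumption|].
    apply Rle_trans with (2 * (9 * tcoef nu 2)); [apply Rmult_le_compat_r; lra|].
    unfold s. lra. }
  assert (B3 : Cmod E' <= s * t * Cmod d).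
  { apply Rle_trans with (1 := HE3). apply Rmult_le_compat_r; [assumption|]. unfold s. lra. }
  apply Rabs_le_between in B1.
  set (D2 := Cmod d ^ 2) in *.
  assert (M1 : v * (Cmod d * Cmod E') <= 2 * s * t * t * D2).
  { apply Rle_trans with (2 * t * (Cmod d * (s * t * Cmod d))).
    - apply Rmult_le_compat.
      + unfold v; nra.
      + now apply Rmult_le_pos.
      + unfold v; nra.
      + now apply Rmult_le_compat_l.
    - right. unfold D2. ring. }
  assert (M2 : t * (Cmod E * Cmod d) <= 2 * s * t * t * D2).
  { apply Rle_trans with (t * (2 * s * t * Cmod d * Cmod d)).
    - apply Rmult_le_compat_l; [lra|]. now apply Rmult_le_compat_r.
    - right. unfold D2. ring. }
  assert (M3 : Cmod E * Cmod E' <= 2 * s * s * t * t * D2).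
  { apply Rle_trans with (2 * s * t * Cmod d * (s * t * Cmod d)).
    - now apply Rmult_le_compat.
    - right. unfold D2. ring. }
  assert (HD2 : 0 <= D2) by (unfold D2; apply pow2_ge_0).
  assert (N1 : v * Re (d * Cconj E') <= v * (Cmod d * Cmod E'))
    by (apply Rmult_le_compat_l; [unfold v; nra|lra]).
  assert (N2 : t * Re (E * Cconj d) <= t * (Cmod E * Cmod d))
    by (apply Rmult_le_compat_l; lra).
  assert (N0 : 0 <= v * t * D2)
    by (repeat apply Rmult_le_pos; lra).
  assert (Hpos : 0 < Re (V * Cconj (Pfun nu w))).
  { rewrite HVP.
    assert (Q1 : 49 / 100 * (t * a - 2 * s * t * a) <= Pval nu * (v * a - Re E)).
    { assert (0 <= u * (t * a)) by (repeat apply Rmult_le_pos; lra).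
      assert (0 < t * a) by (apply Rmult_lt_0_compat; lra).
      assert (v * a = t * a + u * (t * a)) by (unfold v; ring).
      unfold s in *. apply Rmult_le_compat; [lra|lra|lra|]. lra. }
    assert (Q2 : t * t * D2 <= 51 / 100 * (t * (2 * a))).
    { replace (t * t * D2) with (t * (t * D2)) by ring.
      replace (51 / 100 * (t * (2 * a))) with (t * (51 / 100 * (2 * a))) by ring.
      apply Rmult_le_compat_l; [lra|]. apply Rmult_le_compat; lra. }
    assert (0 < t * a) by (apply Rmult_lt_0_compat; lra).
    unfold s in *. lra. }
  assert (Hquot : (theta nu w / Pfun nu w + RtoC u)%C
                  = (V * Cconj (Pfun nu w) * RtoC (/ Cmod (Pfun nu w) ^ 2))%C).
  { assert (HPm := proj1 (Cmod_gt_0 _) HPw).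
    assert (HP2 : Cmod (Pfun nu w) ^ 2 <> 0) by (apply pow_nonzero; lra).
    rewrite RtoC_inv, Cmod2_conj by assumption.
    unfold V. field. split; auto.
    intros Hc. apply HPw. rewrite <- (Cconj_conj (Pfun nu w)), Hc. apply injective_projections; simpl; ring. }
  assert (Hfin : 0 < Re (theta nu w / Pfun nu w + RtoC u)).
  { rewrite Hquot.
    assert (HPm := proj1 (Cmod_gt_0 _) HPw).
    assert (Hi : 0 < / Cmod (Pfun nu w) ^ 2) by (apply Rinv_0_lt_compat, pow_lt; lra).
    destruct (V * Cconj (Pfun nu w))%C as [r1 r2]. simpl in *. nra. }
  replace (Re (theta nu w / Pfun nu w + RtoC u)) with (Re (theta nu w / Pfun nu w) + u) in Hfin
    by reflexivity.
  lra.
Qed.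

(** The derivative of [P]. *)
Definition dP (nu : R) (w : C) : C := Cps (fun n => INR (S n) * pcoef nu (S n)) w.

Lemma dP_weight nu : -1 < nu ->
  summable2 (fun n => INR (S n) * pcoef nu (S n)) /\
  weight2 (fun n => INR (S n) * pcoef nu (S n)) <= 9 * tcoef nu 2.
Proof.
  intros Hnu.
  set (b := fun n => INR n * pcoef nu n).
  assert (Hb : summable2 b).
  { apply (scoef_summable2 nu INR 1 Hnu ltac:(lra)).
    intros n. rewrite Rabs_pos_eq by apply pos_INR. lra. }
  assert (Ht := tail2_summable b Hb).
  assert (Hw : weight2 (tail2 b) <= 1 * (9 * tcoef nu 2)).
  { apply tail2_weight; [assumption|lra|]. intros n. unfold b.
    rewrite Rabs_mult, pcoef_abs, (Rabs_pos_eq (INR _)) by (auto; apply pos_INR). lra. }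
  assert (Hs := proj1 (ex_series_incr_1 _) Ht).
  assert (Hle : forall n, 0 <= INR n ^ 2 * Rabs (b (S n))
                   <= INR (S n) ^ 2 * Rabs (tail2 b (S n))).
  { intros n. split; [apply Rmult_le_pos; [apply pow_le, pos_INR|apply Rabs_pos]|].
    destruct n; [simpl tail2; simpl (INR 0); rewrite Rabs_R0; lra|]. simpl tail2.
    apply Rmult_le_compat_r; [apply Rabs_pos|]. apply pow_incr.
    split; [apply pos_INR|]. rewrite (S_INR (S n)). lra. }
  split.
  - apply (ex_series_le (V := R_CompleteNormedModule)) with (2 := Hs).
    intros n. change (Rabs (INR n ^ 2 * Rabs (b (S n))) <= INR (S n) ^ 2 * Rabs (tail2 b (S n))).
    rewrite Rabs_pos_eq; apply Hle.
  - unfold weight2 in *. rewrite (Series_incr_1 _ Ht) in Hw. simpl (INR 0) in Hw.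
    assert (H := Series_le _ _ Hle Hs). unfold b in H at 1. lra.
Qed.

(** Dividing [theta] by [w] matters for [f_norm], where the bound on the
    logarithmic derivative is needed without the factor [w]. *)
Lemma dP_theta nu w : -1 < nu -> Cmod w <= 1 -> (w * dP nu w)%C = theta nu w.
Proof.
  intros Hnu Hw. symmetry. apply is_CSeries_unique, is_CSeries_decr_1.
  destruct (dP_weight nu Hnu) as [Hs _].
  assert (H := is_CSeries_scal w _ _ (CSeries_correct _ (Cps_summable _ w Hs Hw))).
  fold (Cps (fun n => INR (S n) * pcoef nu (S n)) w) in H. fold (dP nu w) in H.
  simpl (INR 0). rewrite Rmult_0_l, Cmult_0_l.
  replace (w * dP nu w - RtoC 0)%C with (w * dP nu w)%C by ring.
  eapply is_CSeries_ext; [|exact H]. intros n. cbv beta. simpl Cpow. ring.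
Qed.

(** Write [P'(w) = P'(1) - del].  In
    [|P'(w)|^2 = P'(1)^2 - 2 P'(1) Re del + |del|^2] both error terms are
    bounded by multiples of [1 - Re w], although [|del|] itself is not.  The
    hypothesis on the second coefficient makes the constant 1/75 small
    compared with the growth of [Re P] away from 1. *)
Lemma Cmod_dP_upper nu w : -1 < nu -> Cmod w <= 1 -> 756 * tcoef nu 2 <= tcoef nu 1 ->
  Cmod (dP nu w) <= Yval nu + tcoef nu 1 / 75 * (1 - Re w).
Proof.
  intros Hnu Hw Ht.
  destruct (dP_weight nu Hnu) as [Hs HT].
  destruct (Cps_near_1 _ w Hs Hw) as [H1 H2].
  fold (dP nu 1) in H1, H2. fold (dP nu w) in H1, H2.
  assert (HT2 := tcoef_2_bound nu Hnu).
  assert (HY := Yval_bounds nu Hnu). assert (Ht1 := tcoef_pos nu 1 Hnu).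
  assert (Hd1 : dP nu 1 = RtoC (- Yval nu)).
  { rewrite <- theta_1, <- dP_theta by (auto; rewrite Cmod_1; lra). ring. }
  rewrite Hd1 in H1, H2.
  set (T := weight2 (fun n => INR (S n) * pcoef nu (S n))) in *.
  set (del := (RtoC (- Yval nu) - dP nu w)%C) in *.
  assert (Ha := Re_minus_nonneg w Hw). assert (Hd := Cmod_minus_sqr w Hw).
  set (a := 1 - Re w) in *. set (y := Yval nu) in *. set (t := tcoef nu 1) in *.
  assert (HT0 : 0 <= T) by now apply weight2_nonneg.
  assert (HTt : T <= t * (9 / 756)) by lra.
  assert (E2 : Cmod (dP nu w) ^ 2 = y ^ 2 + 2 * y * Re del + Cmod del ^ 2).
  { rewrite !Cmod2_alt. unfold del. destruct (dP nu w) as [p q]. simpl. ring. }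
  apply Rabs_le_between in H1.
  assert (E3 : Cmod del ^ 2 <= T * T * (2 * a)).
  { apply Rle_trans with ((T * Cmod (1 - w)) ^ 2).
    - apply pow_incr. split; [apply Cmod_ge_0|assumption].
    - rewrite Rpow_mult_distr. replace (T ^ 2) with (T * T) by ring.
      apply Rmult_le_compat_l; [now apply Rmult_le_pos|assumption]. }
  assert (E4 : T * T * (2 * a) <= 2 * y * (t / 900 * a)).
  { replace (2 * y * (t / 900 * a)) with ((y * (t / 900)) * (2 * a)) by field.
    apply Rmult_le_compat_r; [lra|].
    apply Rle_trans with (t * (9 / 756) * (t * (9 / 756))); [apply Rmult_le_compat; lra|].
    assert (t * (94 / 95) * (t / 900) <= y * (t / 900)) by (apply Rmult_le_compat_r; lra).
    assert (0 <= t * t) by apply Rle_0_sqr. lra. }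
  assert (E5 : 2 * y * Re del <= 2 * y * (t * (9 / 756) * a)).
  { apply Rmult_le_compat_l; [lra|].
    apply Rle_trans with (T * a); [lra|]. now apply Rmult_le_compat_r. }
  apply Rsqr_incr_0_var; [|assert (0 <= t / 75 * a) by (apply Rmult_le_pos; lra); lra].
  unfold Rsqr.
  assert (E6 : 0 <= y * (t * a)) by (repeat apply Rmult_le_pos; lra).
  assert (E7 : 0 <= (t / 75 * a) * (t / 75 * a)) by apply Rle_0_sqr.
  replace (Cmod (dP nu w) * Cmod (dP nu w)) with (Cmod (dP nu w) ^ 2) by ring.
  rewrite E2. lra.
Qed.

Lemma tcoef_2_bound_half nu : - (1 / 2) < nu -> 756 * tcoef nu 2 <= tcoef nu 1.
Proof.
  intros Hnu. rewrite (tcoef_succ nu 1) by lra.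
  assert (Ht := tcoef_pos nu 1 ltac:(lra)).
  assert (H : tratio nu 1 <= 1 / 756).
  { unfold tratio. simpl INR. replace (1 / 756) with (/ (16 * 2 * (3 / 2) * (7 / 2) * (9 / 2))) by field.
    apply Rinv_le_contravar; [lra|]. repeat apply Rmult_le_compat; lra. }
  nra.
Qed.

(** The logarithmic derivative of [P(z ^ 4) ^ (1 / (2 nu + 1))] is bounded by 1
    as soon as it is at the point 1, because [|P'|] grows more slowly than
    [Re P] away from 1.  Orders from -45/100 on have [2 nu + 1 >= 1/10],
    which exceeds the factor 4/75 lost in [Cmod_dP_upper]. *)
Lemma dP_over_P nu w : - (45 / 100) <= nu -> 4 * Yval nu <= (2 * nu + 1) * Pval nu ->
  Cmod w <= 1 -> 4 * Cmod (dP nu w) <= (2 * nu + 1) * Cmod (Pfun nu w).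
Proof.
  intros Hnu HY Hw.
  assert (Ht := tcoef_2_bound_half nu ltac:(lra)).
  assert (H1 := Cmod_dP_upper nu w ltac:(lra) Hw Ht).
  assert (H2 := Re_Pfun_lower nu w ltac:(lra) Hw).
  assert (H3 : Re (Pfun nu w) <= Cmod (Pfun nu w))
    by (apply Rle_trans with (2 := re_le_Cmod _); apply Rle_abs).
  assert (Ht1 := tcoef_pos nu 1 ltac:(lra)). assert (Ha := Re_minus_nonneg w Hw).
  set (a := 1 - Re w) in *. set (t := tcoef nu 1) in *.
  assert (Hta : 0 <= t * a) by (apply Rmult_le_pos; lra).
  assert (H4 : (2 * nu + 1) * (Pval nu + (t - 9 * tcoef nu 2) * a)
               <= (2 * nu + 1) * Cmod (Pfun nu w)) by (apply Rmult_le_compat_l; lra).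
  assert (H5 : 1 / 10 * (t * (747 / 756) * a) <= (2 * nu + 1) * ((t - 9 * tcoef nu 2) * a)).
  { apply Rmult_le_compat; try lra. apply Rmult_le_compat_r; lra. }
  lra.
Qed.

(** * Complex differentiability *)

(** Differentiability with a single modulus for source and target, which avoids
    the coexisting uniform structures on [C]. *)
Definition Cder (f : C -> C) (z l : C) : Prop :=
  forall eps : R, 0 < eps -> exists delta : R, 0 < delta /\
    forall w : C, Cmod (w - z) < delta ->
      Cmod (f w - f z - l * (w - z)) <= eps * Cmod (w - z).

Lemma Cder_is_derive f z l : Cder f z l ->
  is_derive (K := C_AbsRing) (V := C_NormedModule) f z l.
Proof.
  intros H. split.
  - apply (is_linear_scal_l (K := C_AbsRing) (V := C_NormedModule)).
  - intros x Hx eps.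
    assert (E : z = x).
    { apply (is_filter_lim_locally_unique (K := C_AbsRing) (V := AbsRing_NormedModule C_AbsRing)). exact Hx. }
    rewrite <- E. clear x Hx E.
    destruct (H eps (cond_pos eps)) as [d [Hd Hw]].
    exists (mkposreal d Hd). intros w Hb.
    assert (Hb' : Cmod (w - z) < d) by exact Hb.
    specialize (Hw w Hb').
    change (Cmod (f w - f z - (w - z) * l) <= eps * Cmod (w - z)).
    replace ((w - z) * l)%C with (l * (w - z))%C by ring. exact Hw.
Qed.

Lemma Cder_unique f z l : Cder f z l -> C_derive f z = l.
Proof. intros H. now apply is_C_derive_unique, Cder_is_derive. Qed.

Lemma Cder_ext_loc f g z l r : 0 < r -> (forall w, Cmod (w - z) < r -> f w = g w) ->
  Cder f z l -> Cder g z l.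
Proof.
  intros Hr Hfg H eps Heps. destruct (H eps Heps) as [d [Hd Hw]].
  exists (Rmin d r). split; [now apply Rmin_pos|]. intros w Hwz.
  rewrite <- (Hfg w), <- (Hfg z).
  - apply Hw. apply Rlt_le_trans with (1 := Hwz), Rmin_l.
  - replace (z - z)%C with (RtoC 0) by ring. now rewrite Cmod_0.
  - apply Rlt_le_trans with (1 := Hwz), Rmin_r.
Qed.

Lemma Cder_const c z : Cder (fun _ => c) z 0.
Proof.
  intros eps Heps. exists 1. split; [lra|]. intros w _.
  replace (c - c - 0 * (w - z))%C with (RtoC 0) by ring. rewrite Cmod_0.
  apply Rmult_le_pos; [lra|apply Cmod_ge_0].
Qed.

Lemma Cder_id z : Cder (fun w => w) z 1.
Proof.
  intros eps Heps. exists 1. split; [lra|]. intros w _.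
  replace (w - z - 1 * (w - z))%C with (RtoC 0) by ring. rewrite Cmod_0.
  apply Rmult_le_pos; [lra|apply Cmod_ge_0].
Qed.

Lemma Cder_lipschitz f z l : Cder f z l ->
  exists delta, 0 < delta /\ forall w, Cmod (w - z) < delta ->
    Cmod (f w - f z) <= (Cmod l + 1) * Cmod (w - z).
Proof.
  intros H. destruct (H 1 Rlt_0_1) as [d [Hd Hw]]. exists d. split; auto.
  intros w Hwz. specialize (Hw w Hwz).
  replace (f w - f z)%C with ((f w - f z - l * (w - z)) + l * (w - z))%C by ring.
  apply Rle_trans with (1 := Cmod_triangle _ _). rewrite Cmod_mult. lra.
Qed.

Lemma Cder_comp f g z l m : Cder g z m -> Cder f (g z) l -> Cder (fun w => f (g w)) z (l * m).
Proof.
  intros Hg Hf eps Heps.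
  destruct (Cder_lipschitz g z m Hg) as [d1 [Hd1 H1]].
  set (M := Cmod m + 1) in *.
  assert (HM : 0 < M) by (unfold M; assert (H := Cmod_ge_0 m); lra).
  set (L := Cmod l + 1).
  assert (HL : 0 < L) by (unfold L; assert (H := Cmod_ge_0 l); lra).
  destruct (Hf (eps / 2 / M)) as [d2 [Hd2 H2]]; [repeat apply Rdiv_lt_0_compat; lra|].
  destruct (Hg (eps / 2 / L)) as [d3 [Hd3 H3]]; [repeat apply Rdiv_lt_0_compat; lra|].
  exists (Rmin (Rmin d1 d3) (d2 / M)).
  split; [repeat apply Rmin_pos; auto; now apply Rdiv_lt_0_compat|].
  intros w Hw.
  assert (Hw1 : Cmod (w - z) < d1).
  { apply Rlt_le_trans with (1 := Hw). eapply Rle_trans; [apply Rmin_l|apply Rmin_l]. }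
  assert (Hw3 : Cmod (w - z) < d3).
  { apply Rlt_le_trans with (1 := Hw). eapply Rle_trans; [apply Rmin_l|apply Rmin_r]. }
  assert (Hw2 : Cmod (w - z) < d2 / M) by (apply Rlt_le_trans with (1 := Hw), Rmin_r).
  specialize (H1 w Hw1). specialize (H3 w Hw3).
  assert (Hg2 : Cmod (g w - g z) < d2).
  { apply Rle_lt_trans with (1 := H1). apply Rmult_lt_reg_l with (/ M); [now apply Rinv_0_lt_compat|].
    replace (/ M * (M * Cmod (w - z))) with (Cmod (w - z)) by (field; lra).
    replace (/ M * d2) with (d2 / M) by (field; lra). exact Hw2. }
  specialize (H2 _ Hg2).
  replace (f (g w) - f (g z) - l * m * (w - z))%C
    with ((f (g w) - f (g z) - l * (g w - g z)) + l * (g w - g z - m * (w - z)))%C by ring.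
  apply Rle_trans with (1 := Cmod_triangle _ _). rewrite Cmod_mult.
  assert (Hn := Cmod_ge_0 (w - z)).
  apply Rle_trans with (eps / 2 / M * (M * Cmod (w - z)) + L * (eps / 2 / L * Cmod (w - z))).
  - apply Rplus_le_compat.
    + apply Rle_trans with (1 := H2). apply Rmult_le_compat_l; [|exact H1].
      left. repeat apply Rdiv_lt_0_compat; lra.
    + apply Rmult_le_compat; try apply Cmod_ge_0; [unfold L; lra|exact H3].
  - right. field. lra.
Qed.

Lemma Cder_plus f g z l m : Cder f z l -> Cder g z m -> Cder (fun w => f w + g w)%C z (l + m).
Proof.
  intros Hf Hg eps Heps.
  destruct (Hf (eps / 2)) as [d1 [Hd1 H1]]; [lra|].
  destruct (Hg (eps / 2)) as [d2 [Hd2 H2]]; [lra|].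
  exists (Rmin d1 d2). split; [now apply Rmin_pos|]. intros w Hw.
  specialize (H1 w (Rlt_le_trans _ _ _ Hw (Rmin_l _ _))).
  specialize (H2 w (Rlt_le_trans _ _ _ Hw (Rmin_r _ _))).
  replace (f w + g w - (f z + g z) - (l + m) * (w - z))%C
    with ((f w - f z - l * (w - z)) + (g w - g z - m * (w - z)))%C by ring.
  apply Rle_trans with (1 := Cmod_triangle _ _). lra.
Qed.

Lemma Cder_sqr z : Cder (fun w => w * w)%C z (2 * z).
Proof.
  intros eps Heps. exists eps. split; [assumption|]. intros w Hw.
  replace (w * w - z * z - 2 * z * (w - z))%C with ((w - z) * (w - z))%C by ring.
  rewrite Cmod_mult. apply Rmult_le_compat_r; [apply Cmod_ge_0|lra].
Qed.

Lemma Cder_scal c f z l : Cder f z l -> Cder (fun w => c * f w)%C z (c * l).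
Proof.
  intros Hf. apply (Cder_comp (fun y => c * y)%C f z c l Hf).
  intros eps Heps. exists 1. split; [lra|]. intros w _.
  replace (c * w - c * f z - c * (w - f z))%C with (RtoC 0) by ring. rewrite Cmod_0.
  apply Rmult_le_pos; [lra|apply Cmod_ge_0].
Qed.

(** By polarization the product rule follows from that for squares. *)
Lemma Cder_mult f g z l m : Cder f z l -> Cder g z m ->
  Cder (fun w => f w * g w)%C z (l * g z + f z * m).
Proof.
  intros Hf Hg.
  assert (Hs := Cder_comp _ _ _ _ _ (Cder_plus _ _ _ _ _ Hf Hg) (Cder_sqr _)).
  assert (Hd := Cder_comp _ _ _ _ _
    (Cder_plus _ _ _ _ _ Hf (Cder_scal (RtoC (- (1))) _ _ _ Hg)) (Cder_sqr _)).
  assert (H := Cder_plus _ _ _ _ _ (Cder_scal (RtoC (1 / 4)) _ _ _ Hs)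
                 (Cder_scal (RtoC (- (1 / 4))) _ _ _ Hd)).
  cbv beta in H.
  assert (E4 : RtoC (1 / 4) = (1 / 4)%C) by (rewrite RtoC_div by lra; reflexivity).
  rewrite (RtoC_opp (1 / 4)), (RtoC_opp 1), E4 in H.
  match type of H with Cder _ _ ?d => replace d with (l * g z + f z * m)%C in H by (field; intros E; injection E; lra) end.
  apply (Cder_ext_loc _ _ z _ 1 Rlt_0_1) with (2 := H).
  intros w _. field; intros E; injection E; lra.
Qed.

Lemma Cder_pow n z : Cder (fun w => w ^ S n)%C z (RtoC (INR (S n)) * z ^ n).
Proof.
  induction n.
  - apply (Cder_ext_loc (fun w => w) _ z _ 1 Rlt_0_1).
    + intros w _. simpl. ring.
    + simpl. rewrite !Cmult_1_r. apply Cder_id.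
  - assert (H := Cder_mult _ _ _ _ _ (Cder_id z) IHn). cbv beta in H.
    match type of H with Cder _ _ ?d => replace (RtoC (INR (S (S n))) * z ^ S n)%C with d end.
    + exact H.
    + rewrite (S_INR (S n)), RtoC_plus. simpl Cpow. ring.
Qed.

Lemma Cmod_pow_taylor (w z : C) n : Cmod w <= 1 -> Cmod z <= 1 ->
  Cmod (w ^ n - z ^ n - match n with O => 0 | S k => RtoC (INR n) * z ^ k end * (w - z))
  <= INR n ^ 2 * Cmod (w - z) ^ 2.
Proof.
  intros Hw Hz.
  set (dp := fun n => match n with O => RtoC 0 | S k => RtoC (INR n) * z ^ k end%C).
  change (Cmod (w ^ n - z ^ n - dp n * (w - z)) <= INR n ^ 2 * Cmod (w - z) ^ 2).
  assert (Hdp : forall n, Cmod (dp n) <= INR n /\ dp (S n) = (z ^ n + z * dp n)%C).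
  { intros k. split.
    - destruct k; [simpl dp; rewrite Cmod_0; simpl; lra|].
      unfold dp. rewrite Cmod_mult, Cmod_R, Rabs_pos_eq by apply pos_INR.
      assert (H := Cmod_pow_le_1 z k Hz). assert (H1 := pos_INR (S k)). nra.
    - destruct k; unfold dp; [simpl; ring|]. rewrite (S_INR (S k)), RtoC_plus. simpl Cpow. ring. }
  induction n.
  - simpl. replace (1 - 1 - 0 * (w - z))%C with (RtoC 0) by ring. rewrite Cmod_0. lra.
  - destruct (Hdp n) as [H1 ->].
    replace (w ^ S n - z ^ S n - (z ^ n + z * dp n) * (w - z))%C
      with (w * (w ^ n - z ^ n - dp n * (w - z)) + dp n * ((w - z) * (w - z)))%C
      by (simpl; ring).
    apply Rle_trans with (1 := Cmod_triangle _ _). rewrite !Cmod_mult, S_INR.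
    assert (H2 := Cmod_ge_0 (w - z)). assert (H3 := Cmod_ge_0 w).
    assert (H4 := Cmod_ge_0 (w ^ n - z ^ n - dp n * (w - z))).
    assert (H5 := pos_INR n).
    assert (H6 : Cmod w * Cmod (w ^ n - z ^ n - dp n * (w - z)) <= 1 * (INR n ^ 2 * Cmod (w - z) ^ 2))
      by now apply Rmult_le_compat.
    assert (H7 : 0 <= Cmod (w - z) ^ 2) by apply pow2_ge_0.
    assert (H8 : Cmod (dp n) * (Cmod (w - z) * Cmod (w - z)) <= INR n * Cmod (w - z) ^ 2).
    { replace (Cmod (w - z) * Cmod (w - z)) with (Cmod (w - z) ^ 2) by ring.
      now apply Rmult_le_compat_r. }
    replace ((INR n + 1) ^ 2 * Cmod (w - z) ^ 2)
      with (INR n ^ 2 * Cmod (w - z) ^ 2 + INR n * Cmod (w - z) ^ 2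
            + (INR n + 1) * Cmod (w - z) ^ 2) by ring.
    assert (0 <= (INR n + 1) * Cmod (w - z) ^ 2) by (apply Rmult_le_pos; lra). lra.
Qed.

(** The remainder of degree [n] is at most [n^2 |w - z|^2] throughout the
    closed disk, so that one summable weight serves all points. *)
Lemma Cder_Cps b z : summable2 b -> summable2 (PS_derive b) -> Cmod z < 1 ->
  Cder (Cps b) z (Cps (PS_derive b) z).
Proof.
  intros Hb Hb' Hz.
  set (dp := fun n => match n with O => RtoC 0 | S k => RtoC (INR n) * z ^ k end%C).
  assert (Hdp : is_CSeries (fun n => RtoC (b n) * dp n)%C (Cps (PS_derive b) z)).
  { apply is_CSeries_decr_1. simpl (dp 0%nat). rewrite Cmult_0_r.
    replace (Cps (PS_derive b) z - 0)%C
      with (Cps (PS_derive b) z) by ring.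
    eapply is_CSeries_ext; [|exact (CSeries_correct _ (Cps_summable _ z Hb' ltac:(lra)))].
    intros n. unfold PS_derive, dp. rewrite RtoC_mult. ring. }
  intros eps Heps.
  assert (HT := weight2_nonneg b Hb).
  exists (Rmin (1 - Cmod z) (eps / (weight2 b + 1))).
  split; [apply Rmin_pos; [lra|apply Rdiv_lt_0_compat; lra]|].
  intros w Hw.
  assert (Hw1 : Cmod w <= 1).
  { replace w with ((w - z) + z)%C by ring. apply Rle_trans with (1 := Cmod_triangle _ _).
    assert (H := Rlt_le_trans _ _ _ Hw (Rmin_l _ _)). lra. }
  assert (Hw2 := Rlt_le_trans _ _ _ Hw (Rmin_r _ _)).
  assert (Hs := is_CSeries_plus _ _ _ _ (Cps_diff b z w Hb ltac:(lra) Hw1)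
                  (is_CSeries_scal (- (w - z)) _ _ Hdp)).
  replace (Cps b w - Cps b z - Cps (PS_derive b) z * (w - z))%C
    with (Cps b w - Cps b z + - (w - z) * Cps (PS_derive b) z)%C by ring.
  assert (Hk : ex_series (fun n => (INR n ^ 2 * Cmod (w - z) ^ 2) * Rabs (b n))).
  { apply ex_series_Rext with (fun n => Cmod (w - z) ^ 2 * (INR n ^ 2 * Rabs (b n)));
      [intros; ring|now apply (ex_series_scal (V := R_NormedModule))]. }
  destruct (Cps_bound b (fun n => w ^ n - z ^ n - dp n * (w - z))%C _ Hk
              (fun n => Cmod_pow_taylor w z n Hw1 ltac:(lra))) as [_ Hbd].
  rewrite <- (is_CSeries_unique _ _ Hs).
  rewrite (CSeries_ext _ (fun n => RtoC (b n) * (w ^ n - z ^ n - dp n * (w - z)))%C)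
    by (intros; ring).
  apply Rle_trans with (1 := Hbd).
  rewrite (Series_ext _ (fun n => Cmod (w - z) ^ 2 * (INR n ^ 2 * Rabs (b n)))) by (intros; ring).
  rewrite Series_scal_l. fold (weight2 b).
  replace (Cmod (w - z) ^ 2 * weight2 b) with ((Cmod (w - z) * weight2 b) * Cmod (w - z)) by ring.
  apply Rmult_le_compat_r; [apply Cmod_ge_0|].
  apply Rle_trans with (eps / (weight2 b + 1) * (weight2 b + 1)).
  - apply Rmult_le_compat; try lra. apply Cmod_ge_0.
  - right. field. lra.
Qed.

(** * Exponential and logarithm *)

Lemma Cmod_le_sum (z : C) : Cmod z <= Rabs (Re z) + Rabs (Im z).
Proof.
  replace z with (RtoC (Re z) + Ci * RtoC (Im z))%C at 1 by (destruct z; unfold Ci; apply injective_projections; simpl; ring).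
  apply Rle_trans with (1 := Cmod_triangle _ _). rewrite Cmod_mult, Cmod_Ci, !Cmod_R. lra.
Qed.

Lemma derivable_at_0_bound f l : derivable_pt_lim f 0 l -> forall eps, 0 < eps ->
  exists d, 0 < d /\ forall h, Rabs h < d -> Rabs (f h - f 0 - l * h) <= eps * Rabs h.
Proof.
  intros H eps Heps. destruct (H eps Heps) as [d Hd]. exists d. split; [apply cond_pos|].
  intros h Hh. destruct (Req_dec h 0) as [->|Hn].
  - replace (f 0 - f 0 - l * 0) with 0 by ring. rewrite Rabs_R0. lra.
  - specialize (Hd h Hn Hh). rewrite Rplus_0_l in Hd.
    replace (f h - f 0 - l * h) with (((f h - f 0) / h - l) * h) by (field; assumption).
    rewrite Rabs_mult. apply Rmult_le_compat_r; [apply Rabs_pos|lra].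
Qed.

Lemma Cder_Cexp_0 : Cder Cexp 0 1.
Proof.
  intros eps Heps. set (e := Rmin (eps / 6) (1 / 2)).
  assert (He : 0 < e) by (apply Rmin_pos; lra).
  assert (He1 : e <= eps / 6) by apply Rmin_l. assert (He2 : e <= 1 / 2) by apply Rmin_r.
  destruct (derivable_at_0_bound exp 1 derivable_pt_lim_exp_0 e He) as [d1 [Hd1 H1]].
  assert (Hc := derivable_pt_lim_cos 0). rewrite sin_0, Ropp_0 in Hc.
  destruct (derivable_at_0_bound cos 0 Hc e He) as [d2 [Hd2 H2]].
  destruct (derivable_at_0_bound sin 1 derivable_pt_lim_sin_0 e He) as [d3 [Hd3 H3]].
  exists (Rmin (Rmin d1 d2) (Rmin d3 (e / 2))).
  split; [repeat apply Rmin_pos; lra|].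
  intros w Hw.
  assert (L1 := Rlt_le_trans _ _ _ Hw (Rmin_l _ _)).
  assert (L2 := Rlt_le_trans _ _ _ Hw (Rmin_r _ _)).
  assert (L3 := Rlt_le_trans _ _ _ L1 (Rmin_l _ _)).
  assert (L4 := Rlt_le_trans _ _ _ L1 (Rmin_r _ _)).
  assert (L5 := Rlt_le_trans _ _ _ L2 (Rmin_l _ _)).
  assert (L6 := Rlt_le_trans _ _ _ L2 (Rmin_r _ _)).
  clear Hw L1 L2.
  replace (w - 0)%C with w in * by ring.
  rewrite (Cexp_RtoC 0), exp_0. rewrite Cmult_1_l.
  assert (Hx := re_le_Cmod w). assert (Hy := Im_le_Cmod w).
  specialize (H1 (Re w) ltac:(lra)). specialize (H2 (Im w) ltac:(lra)). specialize (H3 (Im w) ltac:(lra)).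
  rewrite exp_0 in H1. rewrite cos_0 in H2. rewrite sin_0 in H3.
  set (x := Re w) in *. set (y := Im w) in *. set (r := Cmod w) in *.
  assert (Hr : 0 <= r) by apply Cmod_ge_0.
  apply Rle_trans with (1 := Cmod_le_sum _).
  replace (Re (Cexp w - 1 - w)) with ((exp x - 1 - 1 * x) + exp x * (cos y - 1 - 0 * y))
    by (unfold x, y; destruct w; simpl; ring).
  replace (Im (Cexp w - 1 - w)) with ((exp x - 1) * sin y + (sin y - 0 - 1 * y))
    by (unfold x, y; destruct w; simpl; ring).
  assert (X1 : Rabs (exp x - 1) <= e).
  { replace (exp x - 1) with ((exp x - 1 - 1 * x) + x) by ring.
    apply Rle_trans with (1 := Rabs_triang _ _).
    assert (e * Rabs x <= 1 / 2 * Rabs x) by (apply Rmult_le_compat_r; [apply Rabs_pos|lra]). lra. }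
  assert (X2 : Rabs (exp x) <= 2).
  { replace (exp x) with ((exp x - 1) + 1) by ring.
    apply Rle_trans with (1 := Rabs_triang _ _). rewrite Rabs_R1. lra. }
  assert (X3 : Rabs (sin y) <= 2 * r).
  { replace (sin y) with ((sin y - 0 - 1 * y) + y) by ring.
    apply Rle_trans with (1 := Rabs_triang _ _).
    assert (e * Rabs y <= 1 * Rabs y) by (apply Rmult_le_compat_r; [apply Rabs_pos|lra]). lra. }
  assert (Y1 : e * Rabs x <= e * r) by (apply Rmult_le_compat_l; lra).
  assert (Y2 : e * Rabs y <= e * r) by (apply Rmult_le_compat_l; lra).
  assert (Z1 := Rabs_triang (exp x - 1 - 1 * x) (exp x * (cos y - 1 - 0 * y))).
  assert (Z2 := Rabs_triang ((exp x - 1) * sin y) (sin y - 0 - 1 * y)).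
  rewrite Rabs_mult in Z1, Z2.
  assert (W1 : Rabs (exp x) * Rabs (cos y - 1 - 0 * y) <= 2 * (e * r))
    by (apply Rmult_le_compat; try apply Rabs_pos; lra).
  assert (W2 : Rabs (exp x - 1) * Rabs (sin y) <= e * (2 * r))
    by (apply Rmult_le_compat; try apply Rabs_pos; lra).
  assert (e * r <= eps / 6 * r) by (apply Rmult_le_compat_r; lra). lra.
Qed.

Lemma Cder_Cexp a : Cder Cexp a (Cexp a).
Proof.
  assert (Hsh : Cder (fun w => w + (- a))%C a (1 + 0))
    by (apply Cder_plus; [apply Cder_id|apply Cder_const]).
  assert (H0 : Cder Cexp (a + - a) 1).
  { replace (a + - a)%C with (RtoC 0) by ring. exact Cder_Cexp_0. }
  assert (H := Cder_scal (Cexp a) _ _ _ (Cder_comp _ _ _ _ _ Hsh H0)).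
  replace (Cexp a * (1 * (1 + 0)))%C with (Cexp a) in H by ring.
  apply (Cder_ext_loc _ _ a _ 1 Rlt_0_1) with (2 := H).
  intros w _. rewrite <- Cexp_plus. f_equal. ring.
Qed.

Lemma Carg_atan (z : C) : 0 < Re z -> Carg z = atan (Im z / Re z).
Proof.
  intros Hz. assert (Hz0 : z <> RtoC 0) by (intros E; rewrite E in Hz; simpl in Hz; lra).
  destruct (Carg_cos_sin z Hz0) as [H1 H2]. assert (Hb := Carg_bounds z Hz0).
  assert (Hm := proj1 (Cmod_gt_0 z) Hz0).
  assert (Hcos : 0 < cos (Carg z)) by nra.
  assert (Hr : - (PI / 2) < Carg z < PI / 2).
  { split; apply Rnot_le_lt; intros Hle.
    - rewrite <- cos_neg in Hcos.
      assert (cos (- Carg z) <= 0) by (apply cos_le_0; lra). lra.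
    - assert (cos (Carg z) <= 0) by (apply cos_le_0; lra). lra. }
  rewrite <- (atan_tan (Carg z)) by lra. f_equal. unfold tan. rewrite <- H1, <- H2.
  field. lra.
Qed.

Lemma Clog_continuous (p : C) : 0 < Re p -> forall eps, 0 < eps ->
  exists d, 0 < d /\ forall q, Cmod (q - p) < d -> Cmod (Clog q - Clog p) < eps.
Proof.
  intros Hp eps Heps.
  set (e := mkposreal (eps / 2) ltac:(lra)).
  assert (Hfst : continuous (fun q : C => fst q) p) by apply continuous_fst.
  assert (Hsnd : continuous (fun q : C => snd q) p) by apply continuous_snd.
  assert (HA : continuous (fun q : C => atan (snd q * / fst q)) p).
  { apply (continuous_comp (fun q : C => snd q * / fst q) atan).
    - apply (continuous_mult (K := R_AbsRing)); [assumption|].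
      apply (continuous_comp (fun q : C => fst q) Rinv); [assumption|].
      apply continuous_Rinv. unfold Re in Hp. lra.
    - apply (ex_derive_continuous atan). eexists. apply is_derive_atan. }
  assert (HM : continuous (fun q : C => ln (Cmod q)) p).
  { apply (continuous_comp Cmod ln).
    - unfold Cmod. apply (continuous_comp (fun q : C => fst q ^ 2 + snd q ^ 2) sqrt).
      + apply (continuous_plus (V := R_NormedModule)).
        * simpl. apply (continuous_mult (K := R_AbsRing)); [assumption|].
          apply (continuous_mult (K := R_AbsRing)); [assumption|apply continuous_const].
        * simpl. apply (continuous_mult (K := R_AbsRing)); [assumption|].
          apply (continuous_mult (K := R_AbsRing)); [assumption|apply continuous_const].
      + apply continuous_sqrt.
    - apply continuous_ln, Cmod_gt_0. intros E; rewrite E in Hp; simpl in Hp; lra. }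
  assert (HA' := HA _ (locally_ball _ e)). assert (HM' := HM _ (locally_ball _ e)).
  destruct HA' as [d1 H1]. destruct HM' as [d2 H2].
  exists (Rmin (Rmin d1 d2) (Re p)).
  split; [repeat apply Rmin_pos; auto; apply cond_pos|].
  intros q Hq.
  assert (L1 := Rlt_le_trans _ _ _ Hq (Rmin_l _ _)).
  assert (L2 := Rlt_le_trans _ _ _ Hq (Rmin_r _ _)).
  assert (L3 := Rlt_le_trans _ _ _ L1 (Rmin_l _ _)).
  assert (L4 := Rlt_le_trans _ _ _ L1 (Rmin_r _ _)).
  assert (Hre := re_le_Cmod (q - p)). assert (Him := Im_le_Cmod (q - p)).
  assert (Hq0 : 0 < Re q).
  { apply Rabs_le_between in Hre. replace (Re (q - p)) with (Re q - Re p) in Hre by reflexivity. lra. }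
  assert (B : forall d : posreal, Cmod (q - p) < d -> ball p d q).
  { intros d Hd. split; [apply Rle_lt_trans with (1 := Hre)|apply Rle_lt_trans with (1 := Him)]; assumption. }
  specialize (H1 q (B _ L3)). specialize (H2 q (B _ L4)).
  apply Rle_lt_trans with (1 := Cmod_le_sum _).
  replace (Re (Clog q - Clog p)) with (ln (Cmod q) - ln (Cmod p)) by reflexivity.
  replace (Im (Clog q - Clog p)) with (Carg q - Carg p) by reflexivity.
  rewrite !Carg_atan by assumption.
  assert (G1 : Rabs (atan (Im q / Re q) - atan (Im p / Re p)) < eps / 2) by exact H1.
  assert (G2 : Rabs (ln (Cmod q) - ln (Cmod p)) < eps / 2) by exact H2.
  lra.
Qed.

(** The logarithm is a continuous right inverse of the exponential, whose
    derivative does not vanish. *)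
Lemma Cder_Clog (p : C) : 0 < Re p -> Cder Clog p (/ p).
Proof.
  intros Hp eps Heps.
  assert (Hp0 : p <> RtoC 0) by (intros E; rewrite E in Hp; simpl in Hp; lra).
  assert (Hm := proj1 (Cmod_gt_0 p) Hp0). set (r := Cmod p) in *.
  set (e := Rmin (r / 2) (eps * r * r / 2)).
  assert (He : 0 < e).
  { apply Rmin_pos; [lra|]. assert (0 < eps * r * r) by (repeat apply Rmult_lt_0_compat; lra). lra. }
  destruct (Cder_Cexp (Clog p) e He) as [d1 [Hd1 H1]].
  destruct (Clog_continuous p Hp d1 Hd1) as [d2 [Hd2 H2]].
  exists (Rmin d2 (Re p)). split; [now apply Rmin_pos|]. intros q Hq.
  assert (L1 := Rlt_le_trans _ _ _ Hq (Rmin_l _ _)).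
  assert (L2 := Rlt_le_trans _ _ _ Hq (Rmin_r _ _)).
  assert (Hq0 : q <> RtoC 0).
  { intros E. assert (Hre := re_le_Cmod (q - p)). rewrite E in Hre at 1.
    replace (Re (0 - p)) with (- Re p) in Hre by (simpl; unfold Re; ring).
    rewrite Rabs_Ropp, Rabs_pos_eq in Hre by lra. lra. }
  specialize (H1 _ (H2 q L1)). rewrite !Cexp_Clog in H1 by assumption.
  set (D := (Clog q - Clog p)%C) in *.
  (* the increment of the logarithm is at most twice the expected one *)
  assert (HD : r * Cmod D <= 2 * Cmod (q - p)).
  { assert (r * Cmod D <= Cmod (q - p) + e * Cmod D).
    { unfold r. rewrite <- Cmod_mult.
      replace (p * D)%C with ((q - p) + - (q - p - p * D))%C by ring.
      apply Rle_trans with (1 := Cmod_triangle _ _). rewrite Cmod_opp. lra. }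
    assert (e * Cmod D <= r / 2 * Cmod D)
      by (apply Rmult_le_compat_r; [apply Cmod_ge_0|apply Rmin_l]). lra. }
  replace (D - / p * (q - p))%C with (- (q - p - p * D) * / p)%C by (field; assumption).
  rewrite Cmod_mult, Cmod_opp, Cmod_inv by assumption. fold r.
  apply Rmult_le_reg_r with r; [assumption|].
  rewrite Rmult_assoc, Rinv_l, Rmult_1_r by lra.
  apply Rle_trans with (1 := H1).
  apply Rle_trans with (eps * r * r / 2 * Cmod D).
  - apply Rmult_le_compat_r; [apply Cmod_ge_0|apply Rmin_r].
  - assert (0 < eps * r) by now apply Rmult_lt_0_compat.
    assert (eps * r * (r * Cmod D) <= eps * r * (2 * Cmod (q - p))) by (apply Rmult_le_compat_l; lra).
    lra.
Qed.

(** * Mean values along segments *)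

(** The real mean value theorem for [s |-> Re (c f(w + s (z - w)))]; the factor
    [c] selects the direction in which the increment is measured. *)
Lemma mean_value_Re (f f' : C -> C) (z w c : C) :
  (forall s, 0 <= s <= 1 -> Cder f (w + RtoC s * (z - w)) (f' (w + RtoC s * (z - w))%C)) ->
  exists s, 0 <= s <= 1 /\
    Re (c * (f z - f w)) = Re (c * (f' (w + RtoC s * (z - w))%C * (z - w))).
Proof.
  intros Hf.
  set (g := fun s : R => (w + RtoC s * (z - w))%C) in *.
  set (phi := fun s => Re (c * f (g s))).
  destruct (MVT_cor2 phi (fun s => Re (c * (f' (g s) * (z - w)))) 0 1) as [s [Hs1 Hs2]]; [lra| |].
  - intros s Hs eps Heps.
    set (K := Cmod c * Cmod (z - w) + 1).
    assert (HK : 0 < K).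
    { unfold K. assert (0 <= Cmod c * Cmod (z - w)) by (apply Rmult_le_pos; apply Cmod_ge_0). lra. }
    destruct (Hf s Hs (eps / K / 2)) as [d [Hd H]].
    { apply Rdiv_lt_0_compat; [now apply Rdiv_lt_0_compat|lra]. }
    assert (Hd' : 0 < d / (Cmod (z - w) + 1)).
    { apply Rdiv_lt_0_compat; auto. assert (H0 := Cmod_ge_0 (z - w)). lra. }
    exists (mkposreal _ Hd'). intros h Hh0 Hh. simpl in Hh.
    assert (Hg : (g (s + h)%R - g s)%C = (RtoC h * (z - w))%C).
    { unfold g. rewrite RtoC_plus. ring. }
    assert (Hn := Cmod_ge_0 (z - w)).
    assert (Hgd : Cmod (g (s + h)%R - g s) < d).
    { rewrite Hg, Cmod_mult, Cmod_R.
      apply Rle_lt_trans with (Rabs h * (Cmod (z - w) + 1)).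
      - apply Rmult_le_compat_l; [apply Rabs_pos|lra].
      - apply Rlt_le_trans with (d / (Cmod (z - w) + 1) * (Cmod (z - w) + 1)).
        + apply Rmult_lt_compat_r; lra.
        + right. field. lra. }
    specialize (H _ Hgd).
    assert (Hh1 : 0 < Rabs h) by now apply Rabs_pos_lt.
    replace ((phi (s + h) - phi s) / h - Re (c * (f' (g s) * (z - w))%C))
      with (Re (c * (f (g (s + h)%R) - f (g s) - f' (g s) * (g (s + h)%R - g s))) / h).
    + unfold Rdiv. rewrite Rabs_mult, Rabs_inv.
      apply Rmult_lt_reg_r with (Rabs h); [assumption|].
      rewrite Rmult_assoc, Rinv_l, Rmult_1_r by lra.
      apply Rle_lt_trans with (1 := re_le_Cmod _). rewrite Cmod_mult.
      apply Rle_lt_trans with (Cmod c * (eps / K / 2 * Cmod (g (s + h)%R - g s))).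
      * apply Rmult_le_compat_l; [apply Cmod_ge_0|exact H].
      * rewrite Hg, Cmod_mult, Cmod_R.
        replace (Cmod c * (eps / K / 2 * (Rabs h * Cmod (z - w))))
          with ((eps * Rabs h / K / 2) * (Cmod c * Cmod (z - w))) by (field; lra).
        apply Rle_lt_trans with (eps * Rabs h / K / 2 * K).
        -- apply Rmult_le_compat_l; [|unfold K; lra].
           assert (0 < eps * Rabs h) by now apply Rmult_lt_0_compat.
           left. repeat apply Rdiv_lt_0_compat; lra.
        -- replace (eps * Rabs h / K / 2 * K) with (eps * Rabs h / 2) by (field; lra).
           assert (0 < eps * Rabs h) by now apply Rmult_lt_0_compat. lra.
    + rewrite Hg. unfold phi.
      replace (c * (f (g (s + h)%R) - f (g s) - f' (g s) * (RtoC h * (z - w))))%C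
        with (c * f (g (s + h)%R) - c * f (g s) - RtoC h * (c * (f' (g s) * (z - w))))%C by ring.
      destruct (c * (f' (g s) * (z - w)))%C, (c * f (g (s + h)%R))%C, (c * f (g s))%C.
      simpl. field. assumption.
  - exists s. split; [lra|]. fold (g s). rewrite Rminus_0_r, Rmult_1_r in Hs1. rewrite <- Hs1.
    unfold phi, g.
    replace (w + 1 * (z - w))%C with z by ring. replace (w + 0 * (z - w))%C with w by ring.
    replace (c * (f z - f w))%C with (c * f z - c * f w)%C by ring. reflexivity.
Qed.

Lemma segment_in_disk (z w : C) s : Cmod z < 1 -> Cmod w < 1 -> 0 <= s <= 1 ->
  Cmod (w + RtoC s * (z - w)) < 1.
Proof.
  intros Hz Hw Hs.
  replace (w + RtoC s * (z - w))%C with (RtoC (1 - s) * w + RtoC s * z)%C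
    by (rewrite RtoC_minus; ring).
  apply Rle_lt_trans with (1 := Cmod_triangle _ _).
  rewrite !Cmod_mult, !Cmod_R, !Rabs_pos_eq by lra.
  destruct (Req_dec s 0) as [->|Hs0]; [lra|].
  assert (s * Cmod z < s * 1) by (apply Rmult_lt_compat_l; lra).
  assert ((1 - s) * Cmod w <= (1 - s) * 1) by (apply Rmult_le_compat_l; lra). lra.
Qed.

(** The mean value theorem in the direction of [conj (z - w)]. *)
Lemma injective_of_Re_derivative_pos (f f' : C -> C) :
  (forall z, Cmod z < 1 -> Cder f z (f' z)) -> (forall z, Cmod z < 1 -> 0 < Re (f' z)) ->
  forall z w, Cmod z < 1 -> Cmod w < 1 -> f z = f w -> z = w.
Proof.
  intros Hf Hpos z w Hz Hw Heq.
  destruct (Ceq_dec (z - w) 0) as [E|E].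
  { replace z with ((z - w) + w)%C by ring. rewrite E. ring. }
  exfalso.
  destruct (mean_value_Re f f' z w (Cconj (z - w))) as [s [Hs H]].
  { intros s Hs. apply Hf. now apply segment_in_disk. }
  rewrite Heq in H. specialize (Hpos _ (segment_in_disk z w s Hz Hw Hs)).
  assert (Hm : 0 < Cmod (z - w) ^ 2) by (apply pow_lt; now apply Cmod_gt_0).
  rewrite Cmod2_alt in Hm.
  set (l := f' (w + RtoC s * (z - w))%C) in *. set (d := (z - w)%C) in *.
  replace (Re (Cconj d * (f w - f w))) with 0 in H by (destruct d, (f w); simpl; ring).
  replace (Re (Cconj d * (l * d))) with (Re l * (Re d ^ 2 + Im d ^ 2)) in H
    by (destruct d, l; simpl; ring).
  assert (0 < Re l * (Re d ^ 2 + Im d ^ 2)) by now apply Rmult_lt_0_compat.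
  lra.
Qed.

Lemma mean_value_bound (f f' : C -> C) (z w : C) :
  (forall s, 0 <= s <= 1 -> Cder f (w + RtoC s * (z - w)) (f' (w + RtoC s * (z - w))%C)) ->
  (forall s, 0 <= s <= 1 -> Cmod (f' (w + RtoC s * (z - w))%C) <= 1) ->
  Cmod (f z - f w) <= Cmod (z - w).
Proof.
  intros Hf Hb. destruct (mean_value_Re f f' z w (Cconj (f z - f w)) Hf) as [s [Hs H]].
  specialize (Hb s Hs). set (D := (f z - f w)%C) in *.
  assert (H1 : Cmod D * Cmod D <= Cmod D * Cmod (z - w)).
  { replace (Cmod D * Cmod D) with (Re (Cconj D * D)).
    - rewrite H. apply Rle_trans with (1 := Rle_abs _).
      apply Rle_trans with (1 := re_le_Cmod _). rewrite !Cmod_mult, Cmod_conj.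
      apply Rmult_le_compat_l; [apply Cmod_ge_0|].
      rewrite <- (Rmult_1_l (Cmod (z - w))) at 2.
      apply Rmult_le_compat_r; [apply Cmod_ge_0|assumption].
    - rewrite Cmod_sqr. destruct D; simpl; ring. }
  destruct (Req_dec (Cmod D) 0) as [E|E]; [rewrite E; apply Cmod_ge_0|].
  apply Rmult_le_reg_l with (Cmod D); [|assumption].
  assert (H0 := Cmod_ge_0 D). lra.
Qed.

Lemma Cmod_Cexp_minus_1 (a : C) : Re a <= 0 -> Cmod (Cexp a - 1) <= Cmod a.
Proof.
  intros Ha.
  assert (H := mean_value_bound Cexp Cexp a 0).
  rewrite Cexp_RtoC, exp_0 in H. replace (a - 0)%C with a in H by ring. apply H.
  - intros. apply Cder_Cexp.
  - intros s Hs. rewrite Cmod_Cexp. rewrite <- exp_0.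
    replace (Re (0 + RtoC s * a)) with (s * Re a) by (destruct a; simpl; ring).
    assert (s * Re a <= 0) by nra.
    destruct (Rle_lt_or_eq_dec _ _ H0) as [Hl|He].
    + left. now apply exp_increasing.
    + rewrite He. lra.
Qed.

(** If [z e^q(z) = w e^q(w)] with [|w| <= |z|], then [w = z e^a], where
    [a = q(z) - q(w)] has nonpositive real part; hence
    [|z - w| <= |z| |a| < |a| <= |z - w|]. *)
Lemma injective_exp_multiple (q q' : C -> C) :
  (forall z, Cmod z < 1 -> Cder q z (q' z)) -> (forall z, Cmod z < 1 -> Cmod (q' z) <= 1) ->
  forall z w, Cmod z < 1 -> Cmod w < 1 ->
    (z * Cexp (q z))%C = (w * Cexp (q w))%C -> z = w.
Proof.
  intros Hq Hb.
  assert (Hwlog : forall z w, Cmod z < 1 -> Cmod w < 1 -> Cmod w <= Cmod z ->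
    (z * Cexp (q z))%C = (w * Cexp (q w))%C -> z = w).
  { intros z w Hz Hw Hle Heq.
    destruct (Ceq_dec w 0) as [E|Hw0].
    { rewrite E in Heq. rewrite Cmult_0_l in Heq. rewrite E.
      destruct (Ceq_dec z 0) as [Hz0|Hz0]; [assumption|].
      exfalso. revert Heq. apply Cmult_neq_0; [assumption|apply Cexp_neq_0]. }
    set (a := (q z - q w)%C).
    assert (Hwz : w = (z * Cexp a)%C).
    { replace a with (q z + - q w)%C by (unfold a; ring).
      rewrite Cexp_plus, Cmult_assoc, Heq, <- Cmult_assoc, <- Cexp_plus.
      replace (q w + - q w)%C with (RtoC 0) by ring. rewrite Cexp_RtoC, exp_0. ring. }
    assert (Hmw := proj1 (Cmod_gt_0 w) Hw0).
    assert (Hre : Re a <= 0).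
    { assert (Hm : Cmod w = Cmod z * exp (Re a)) by (rewrite Hwz at 1; now rewrite Cmod_mult, Cmod_Cexp).
      apply Rnot_lt_le. intros Hlt.
      assert (1 < exp (Re a)) by (rewrite <- exp_0; now apply exp_increasing). nra. }
    assert (Ha : Cmod a <= Cmod (z - w)).
    { apply (mean_value_bound q q').
      - intros s Hs. now apply Hq, segment_in_disk.
      - intros s Hs. now apply Hb, segment_in_disk. }
    assert (Hd : Cmod (z - w) <= Cmod z * Cmod a).
    { rewrite Hwz. replace (z - z * Cexp a)%C with (- (z * (Cexp a - 1)))%C by ring.
      rewrite Cmod_opp, Cmod_mult. apply Rmult_le_compat_l; [apply Cmod_ge_0|].
      now apply Cmod_Cexp_minus_1. }
    assert (H0 := Cmod_ge_0 (z - w)).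
    assert (Hz0 : Cmod (z - w) = 0) by nra.
    apply Cmod_eq_0 in Hz0. replace z with ((z - w) + w)%C by ring. rewrite Hz0. ring. }
  intros z w Hz Hw Heq. destruct (Rle_lt_dec (Cmod w) (Cmod z)).
  - now apply Hwlog.
  - symmetry. apply Hwlog; auto. lra.
Qed.

(** * From the radius to the point 1 *)

Lemma Cps_real b (x : R) : summable2 b -> Rabs x <= 1 -> Im (Cps b (RtoC x)) = 0.
Proof.
  intros Hb Hx.
  assert (H := CSeries_correct _ (Cps_summable b (RtoC x) Hb ltac:(now rewrite Cmod_R))).
  assert (H' : is_CSeries (fun n => RtoC (b n * x ^ n)) (Cps b (RtoC x))).
  { eapply is_CSeries_ext; [|exact H]. intros n. cbv beta. now rewrite RtoC_mult, RtoC_pow. }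
  assert (HR := is_CSeries_unique _ _ (is_series_RtoC _ _ (proj1 H'))).
  assert (E : Cps b (RtoC x) = RtoC (Re (Cps b (RtoC x))))
    by (etransitivity; [symmetry; exact (is_CSeries_unique _ _ H')|exact HR]).
  rewrite E. reflexivity.
Qed.

Definition Preal (nu x : R) : R := Re (Pfun nu (RtoC x)).
Definition thetareal (nu x : R) : R := Re (theta nu (RtoC x)).

Lemma Pfun_real nu x : -1 < nu -> Rabs x <= 1 -> Pfun nu (RtoC x) = RtoC (Preal nu x).
Proof.
  intros Hnu Hx. unfold Preal. rewrite Pfun_affine.
  assert (H := Cps_real _ x (affine_summable nu 1 0 Hnu ltac:(lra) ltac:(lra)) Hx).
  destruct (Cps _ _). unfold Im in H; simpl in *. now rewrite H.
Qed.

Lemma theta_real nu x : -1 < nu -> Rabs x <= 1 -> theta nu (RtoC x) = RtoC (thetareal nu x).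
Proof.
  intros Hnu Hx. unfold thetareal. rewrite theta_affine.
  assert (H := Cps_real _ x (affine_summable nu 0 1 Hnu ltac:(lra) ltac:(lra)) Hx).
  destruct (Cps _ _). unfold Im in H; simpl in *. now rewrite H.
Qed.

Lemma Preal_lipschitz nu : -1 < nu -> exists L, 0 < L /\ forall x y, Rabs x <= 1 -> Rabs y <= 1 ->
  Rabs (Preal nu x - Preal nu y) <= L * Rabs (x - y) /\
  Rabs (thetareal nu x - thetareal nu y) <= L * Rabs (x - y).
Proof.
  intros Hnu.
  assert (S1 := affine_summable nu 1 0 Hnu ltac:(lra) ltac:(lra)).
  assert (S2 := affine_summable nu 0 1 Hnu ltac:(lra) ltac:(lra)).
  set (L := Rabs (weight2 (scoef nu (affine 1 0))) + Rabs (weight2 (scoef nu (affine 0 1))) + 1).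
  assert (P1 := Rabs_pos (weight2 (scoef nu (affine 1 0)))).
  assert (P2 := Rabs_pos (weight2 (scoef nu (affine 0 1)))).
  exists L. split; [unfold L; lra|]. intros x y Hx Hy.
  assert (Hx' : Cmod (RtoC x) <= 1) by now rewrite Cmod_R.
  assert (Hy' : Cmod (RtoC y) <= 1) by now rewrite Cmod_R.
  assert (L1 := Cps_lipschitz _ _ _ S1 Hy' Hx'). assert (L2 := Cps_lipschitz _ _ _ S2 Hy' Hx').
  rewrite <- !Pfun_affine in L1. rewrite <- !theta_affine in L2.
  rewrite <- RtoC_minus, Cmod_R in L1, L2.
  assert (P0 := Rabs_pos (x - y)).
  assert (B1 := Rle_abs (weight2 (scoef nu (affine 1 0)))).
  assert (B2 := Rle_abs (weight2 (scoef nu (affine 0 1)))).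
  split.
  - apply Rle_trans with (Cmod (Pfun nu (RtoC x) - Pfun nu (RtoC y)));
      [exact (re_le_Cmod (Pfun nu (RtoC x) - Pfun nu (RtoC y)))|].
    apply Rle_trans with (1 := L1). apply Rmult_le_compat_r; [assumption|unfold L; lra].
  - apply Rle_trans with (Cmod (theta nu (RtoC x) - theta nu (RtoC y)));
      [exact (re_le_Cmod (theta nu (RtoC x) - theta nu (RtoC y)))|].
    apply Rle_trans with (1 := L2). apply Rmult_le_compat_r; [assumption|unfold L; lra].
Qed.

Lemma Preal_1 nu : -1 < nu -> Preal nu 1 = Pval nu.
Proof. intros Hnu. unfold Preal. now rewrite Pfun_1. Qed.

Lemma thetareal_1 nu : -1 < nu -> thetareal nu 1 = - Yval nu.
Proof. intros Hnu. unfold thetareal. now rewrite theta_1. Qed.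

Lemma Pfun_0 nu : Pfun nu (RtoC 0) = RtoC 1.
Proof.
  apply is_CSeries_unique, is_CSeries_decr_1.
  simpl Cpow. replace (RtoC 1 - RtoC (pcoef nu 0) * 1)%C with (RtoC 0).
  2:{ unfold pcoef. rewrite tcoef_0. simpl. rewrite Rmult_1_l. ring. }
  eapply is_CSeries_ext; [|exact is_CSeries_zero]. intros n. cbv beta. ring.
Qed.

(** On the radius [P] cannot vanish and starts from the value 1, so it stays
    positive; the condition on the radius then passes to the limit 1. *)
Lemma balance_of_radius nu alpha m : -1 < nu ->
  (forall x, 0 < x < 1 -> Preal nu x <> 0 /\
     alpha < 1 + m * (thetareal nu x / Preal nu x)) ->
  m * Yval nu <= (1 - alpha) * Pval nu.
Proof.
  intros Hnu H.
  destruct (Preal_lipschitz nu Hnu) as [L [HL Hlip]].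
  assert (Hpos : forall x, 0 < x < 1 -> 0 < Preal nu x).
  { intros x Hx. apply Rnot_le_lt. intros Hle.
    assert (Hneg : Preal nu x < 0) by (destruct (H x Hx) as [Hn _]; lra).
    destruct (Ranalysis5.IVT_interv (fun y => - Preal nu y) 0 x) as [y [[Hy1 Hy2] Hy3]]; try lra.
    - intros y Hy eps Heps. exists (Rmin (eps / L / 2) (1 - x)).
      assert (0 < eps / L) by now apply Rdiv_lt_0_compat.
      split; [apply Rmin_pos; lra|]. intros y' [_ Hy']. simpl in *. unfold R_dist in *.
      assert (K1 := Rlt_le_trans _ _ _ Hy' (Rmin_l _ _)).
      assert (K2 := Rlt_le_trans _ _ _ Hy' (Rmin_r _ _)).
      replace (- Preal nu y' - - Preal nu y) with (- (Preal nu y' - Preal nu y)) by ring.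
      rewrite Rabs_Ropp.
      assert (Hb : Rabs y' <= 1).
      { apply Rabs_le. apply Rabs_lt_between in K2. lra. }
      assert (Hb' : Rabs y <= 1) by (apply Rabs_le; lra).
      destruct (Hlip y' y Hb Hb') as [K3 _].
      apply Rle_lt_trans with (1 := K3).
      apply Rlt_le_trans with (L * (eps / L / 2)); [apply Rmult_lt_compat_l; lra|].
      replace (L * (eps / L / 2)) with (eps / 2) by (field; lra). lra.
    - unfold Preal. rewrite Pfun_0. simpl. lra.
    - destruct (Req_dec y 0) as [E|E].
      + rewrite E in Hy3. unfold Preal in Hy3. rewrite Pfun_0 in Hy3. simpl in Hy3. lra.
      + destruct (H y ltac:(lra)) as [Hn _]. lra. }
  assert (Hx : forall x, 0 < x < 1 -> 0 < (1 - alpha) * Preal nu x + m * thetareal nu x).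
  { intros x Hx. specialize (Hpos x Hx). destruct (H x Hx) as [_ Hlt].
    replace ((1 - alpha) * Preal nu x + m * thetareal nu x)
      with (Preal nu x * (1 + m * (thetareal nu x / Preal nu x) - alpha)) by (field; lra).
    apply Rmult_lt_0_compat; lra. }
  apply Rnot_lt_le. intros Hlt.
  set (c := m * Yval nu - (1 - alpha) * Pval nu) in *.
  assert (Hc : 0 < c) by (unfold c; lra).
  set (M := Rabs (1 - alpha) + Rabs m + 1).
  assert (HM : 0 < M).
  { unfold M. assert (A1 := Rabs_pos (1 - alpha)). assert (A2 := Rabs_pos m). lra. }
  set (h := Rmin (1 / 2) (c / (L * M))).
  assert (HLM : 0 < L * M) by now apply Rmult_lt_0_compat.
  assert (Hh : 0 < h) by (apply Rmin_pos; [lra|now apply Rdiv_lt_0_compat]).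
  assert (Hh1 : h <= 1 / 2) by apply Rmin_l. assert (Hh2 : h <= c / (L * M)) by apply Rmin_r.
  specialize (Hx (1 - h) ltac:(lra)).
  destruct (Hlip (1 - h) 1) as [K1 K2]; [apply Rabs_le; lra|apply Rabs_le; lra|].
  rewrite Preal_1, thetareal_1 in * by assumption.
  replace (1 - h - 1) with (- h) in * by ring. rewrite Rabs_Ropp, (Rabs_pos_eq h) in * by lra.
  set (p := Preal nu (1 - h)) in *. set (q := thetareal nu (1 - h)) in *.
  assert (Hsum : (1 - alpha) * p + m * q = - c + ((1 - alpha) * (p - Pval nu) + m * (q - - Yval nu)))
    by (unfold c; ring).
  assert (R1 : (1 - alpha) * (p - Pval nu) <= Rabs (1 - alpha) * (L * h)).
  { apply Rle_trans with (1 := Rle_abs _). rewrite Rabs_mult.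
    apply Rmult_le_compat_l; [apply Rabs_pos|assumption]. }
  assert (R2 : m * (q - - Yval nu) <= Rabs m * (L * h)).
  { apply Rle_trans with (1 := Rle_abs _). rewrite Rabs_mult.
    apply Rmult_le_compat_l; [apply Rabs_pos|assumption]. }
  assert (R3 : L * M * h <= c).
  { apply Rle_trans with (L * M * (c / (L * M))); [apply Rmult_le_compat_l; lra|].
    right. field. split; lra. }
  assert (R4 : L * M * h = Rabs (1 - alpha) * (L * h) + Rabs m * (L * h) + L * h)
    by (unfold M; ring).
  assert (0 < L * h) by now apply Rmult_lt_0_compat.
  lra.
Qed.

(** * Starlikeness from explicit derivatives *)

Lemma starlike_intro alpha (F k k' : C -> C) :
  (forall z, Cmod z <= 1 -> F z = k z) -> (forall z, Cmod z < 1 -> Cder k z (k' z)) ->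
  k (RtoC 0) = RtoC 0 -> k' (RtoC 0) = RtoC 1 ->
  (forall z w, Cmod z < 1 -> Cmod w < 1 -> k z = k w -> z = w) ->
  (forall z, Cmod z < 1 -> z <> RtoC 0 -> alpha < Re (z * k' z / k z)) ->
  starlike_of_order alpha F.
Proof.
  intros HF Hk H0 H1 Hinj Hre.
  assert (HC0 : Cmod (RtoC 0) < 1) by (rewrite Cmod_0; lra).
  assert (HD : forall z, Cmod z < 1 -> Cder F z (k' z)).
  { intros z Hz. apply (Cder_ext_loc k F z _ (1 - Cmod z)); [lra| |now apply Hk].
    intros w Hw. symmetry. apply HF. replace w with ((w - z) + z)%C by ring.
    apply Rle_trans with (1 := Cmod_triangle _ _). lra. }
  split; [|split; [|split; [|split]]].
  - intros z Hz. eexists. now apply Cder_is_derive, HD.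
  - rewrite HF; [exact H0|lra].
  - rewrite (Cder_unique F (RtoC 0) _ (HD _ HC0)). exact H1.
  - intros z w Hz Hw. rewrite !HF by lra. now apply Hinj.
  - intros z Hz Hz0. rewrite (Cder_unique F z _ (HD z Hz)), HF by lra. now apply Hre.
Qed.

Lemma starlike_elim alpha (F k k' : C -> C) :
  (forall z, Cmod z <= 1 -> F z = k z) -> (forall z, Cmod z < 1 -> Cder k z (k' z)) ->
  k (RtoC 0) = RtoC 0 -> starlike_of_order alpha F ->
  forall z, Cmod z < 1 -> z <> RtoC 0 -> k z <> RtoC 0 /\ alpha < Re (z * k' z / k z).
Proof.
  intros HF Hk H0 [_ [_ [_ [Hinj Hre]]]] z Hz Hz0.
  assert (HC0 : Cmod (RtoC 0) < 1) by (rewrite Cmod_0; lra).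
  assert (HD : Cder F z (k' z)).
  { apply (Cder_ext_loc k F z _ (1 - Cmod z)); [lra| |now apply Hk].
    intros w Hw. symmetry. apply HF. replace w with ((w - z) + z)%C by ring.
    apply Rle_trans with (1 := Cmod_triangle _ _). lra. }
  specialize (Hre z Hz Hz0). rewrite (Cder_unique F z _ HD), HF in Hre by lra.
  split; [|exact Hre]. intros E. apply Hz0. apply Hinj; auto.
  rewrite !HF by lra. now rewrite E, H0.
Qed.

Lemma Cder_Pfun nu w : -1 < nu -> Cmod w < 1 -> Cder (Pfun nu) w (dP nu w).
Proof.
  intros Hnu Hw.
  assert (H := affine_summable nu 1 0 Hnu ltac:(lra) ltac:(lra)).
  assert (Hp : summable2 (pcoef nu)).
  { apply ex_series_Rext with (2 := H). intros n. unfold scoef, affine. do 2 f_equal. ring. }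
  destruct (dP_weight nu Hnu) as [Hs _].
  exact (Cder_Cps (pcoef nu) w Hp Hs Hw).
Qed.

Lemma Cmod_pow_lt_1 (z : C) n : Cmod z < 1 -> Cmod (z ^ S n) < 1.
Proof.
  intros Hz. rewrite Cmod_pow. assert (H := Cmod_ge_0 z).
  assert (H1 : Cmod z ^ n <= 1) by (rewrite <- (pow1 n); apply pow_incr; lra).
  assert (H2 : 0 <= Cmod z ^ n) by now apply pow_le. simpl. nra.
Qed.

Lemma Cder_Pfun_pow nu n z : -1 < nu -> Cmod z < 1 ->
  Cder (fun w => Pfun nu (w ^ S n)) z (dP nu (z ^ S n) * (RtoC (INR (S n)) * z ^ n)).
Proof.
  intros Hnu Hz. apply (Cder_comp (Pfun nu)); [apply Cder_pow|].
  apply Cder_Pfun; auto. now apply Cmod_pow_lt_1.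
Qed.

Lemma Cder_times_Pfun nu n z : -1 < nu -> Cmod z < 1 ->
  Cder (fun w => w * Pfun nu (w ^ S n))%C z
    (Pfun nu (z ^ S n) + RtoC (INR (S n)) * theta nu (z ^ S n)).
Proof.
  intros Hnu Hz.
  assert (H := Cder_mult _ _ _ _ _ (Cder_id z) (Cder_Pfun_pow nu n z Hnu Hz)).
  cbv beta in H. rewrite <- dP_theta by (auto; apply Rlt_le, Cmod_pow_lt_1, Hz).
  match type of H with Cder _ _ ?d =>
    replace (Pfun nu (z ^ S n) + RtoC (INR (S n)) * (z ^ S n * dP nu (z ^ S n)))%C with d end.
  - exact H.
  - change (z ^ S n)%C with (z * z ^ n)%C. ring.
Qed.

Lemma Cpow_real_root x n : 0 < x < 1 ->
  exists r, 0 < r < 1 /\ (RtoC r ^ S n)%C = RtoC x.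
Proof.
  intros Hx. exists (Rpower x (/ INR (S n))).
  assert (Hn := INR_S_ge_1 n).
  assert (Hpow : Rpower x (/ INR (S n)) ^ S n = x).
  { rewrite <- Rpower_pow by apply exp_pos. rewrite Rpower_mult, Rinv_l by lra. apply Rpower_1; lra. }
  split; [|now rewrite <- RtoC_pow, Hpow].
  split; [apply exp_pos|]. apply Rnot_le_lt. intros Hle.
  assert (H := pow_R1_Rle _ (S n) Hle). lra.
Qed.

Lemma theta_0 nu : -1 < nu -> theta nu (RtoC 0) = RtoC 0.
Proof. intros Hnu. rewrite <- dP_theta by (auto; rewrite Cmod_0; lra). ring. Qed.

Lemma Cpow_0_S n : (RtoC 0 ^ S n)%C = RtoC 0.
Proof. simpl. ring. Qed.

(** The two functions [g_norm] and [h_norm] are the cases [n = 3] and [n = 0]. *)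
Lemma starlike_times_Pfun nu n alpha (F : C -> C) : -1 < nu -> 0 <= alpha < 1 ->
  (forall z, Cmod z <= 1 -> F z = (z * Pfun nu (z ^ S n))%C) ->
  (starlike_of_order alpha F <-> 0 <= balance (fun _ => 1 - alpha) (INR (S n)) nu).
Proof.
  intros Hnu Hal HF. unfold balance.
  set (m := INR (S n)). assert (Hm : 1 <= m) by apply INR_S_ge_1.
  assert (HY := Yval_bounds nu Hnu). assert (Ht := tcoef_pos nu 1 Hnu).
  split.
  - intros Hst.
    assert (H := starlike_elim alpha F _ _ HF (fun z Hz => Cder_times_Pfun nu n z Hnu Hz)
                   (Cmult_0_l _) Hst).
    assert (Hb : m * Yval nu <= (1 - alpha) * Pval nu); [|lra].
    apply balance_of_radius; auto. intros x Hx.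
    destruct (Cpow_real_root x n Hx) as [r [Hr Hrx]].
    assert (Hx1 : Rabs x <= 1) by (apply Rabs_le; lra).
    destruct (H (RtoC r)) as [Hk Hre].
    { rewrite Cmod_R, Rabs_pos_eq; lra. }
    { intros E. injection E. lra. }
    rewrite Hrx, Pfun_real, ?theta_real in * by assumption.
    assert (HP : Preal nu x <> 0).
    { intros E. apply Hk. rewrite E. ring. }
    split; [exact HP|].
    replace (RtoC r * (RtoC (Preal nu x) + RtoC (INR (S n)) * RtoC (thetareal nu x))
             / (RtoC r * RtoC (Preal nu x)))%C
      with (RtoC (1 + m * (thetareal nu x / Preal nu x))) in Hre; [exact Hre|].
    rewrite RtoC_plus, RtoC_mult, RtoC_div by assumption. fold m. field.
    split; intros E; injection E; lra.
  - intros Hb.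
    assert (HP : 0 < Pval nu).
    { apply Rnot_le_lt. intros Hle. assert ((1 - alpha) * Pval nu <= 0) by nra. nra. }
    assert (Hb1 : m * Yval nu <= Pval nu) by nra.
    assert (HYP : Yval nu <= Pval nu) by nra.
    apply (starlike_intro alpha F _ _ HF (fun z Hz => Cder_times_Pfun nu n z Hnu Hz)).
    + apply Cmult_0_l.
    + rewrite Cpow_0_S, Pfun_0, theta_0 by assumption. ring.
    + apply injective_of_Re_derivative_pos with
        (fun z => Pfun nu (z ^ S n) + RtoC (INR (S n)) * theta nu (z ^ S n))%C.
      * intros z Hz. now apply Cder_times_Pfun.
      * intros z Hz. rewrite <- (Cmult_1_l (Pfun nu (z ^ S n))). fold m.
        apply Re_affine_pos; auto; try lra. now apply Cmod_pow_lt_1.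
    + intros z Hz Hz0. assert (Hw := Cmod_pow_lt_1 z n Hz). set (w := (z ^ S n)%C) in *.
      assert (HR := Re_theta_over_P nu w Hnu HP HYP Hw).
      assert (HPw := Re_Pfun_pos nu w Hnu HP ltac:(lra)).
      replace (z * (Pfun nu w + RtoC (INR (S n)) * theta nu w) / (z * Pfun nu w))%C
        with (1 + RtoC m * (theta nu w / Pfun nu w))%C.
      * replace (Re (1 + RtoC m * (theta nu w / Pfun nu w)))
          with (1 + m * Re (theta nu w / Pfun nu w))
          by (destruct (theta nu w / Pfun nu w)%C; simpl; ring).
        assert (m * - (Yval nu / Pval nu) < m * Re (theta nu w / Pfun nu w))
          by (apply Rmult_lt_compat_l; lra).
        assert (m * (Yval nu / Pval nu) <= 1 - alpha).
        { apply Rmult_le_reg_r with (Pval nu); [assumption|].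
          replace (m * (Yval nu / Pval nu) * Pval nu) with (m * Yval nu) by (field; lra). lra. }
        lra.
      * fold m. field. split; auto. intros E. rewrite E in HPw. simpl in HPw. lra.
Qed.

(** * The function [f] *)

Lemma Pval_pos_half nu : - (1 / 2) < nu -> 1 / 2 <= Pval nu /\ Yval nu <= Pval nu.
Proof.
  intros Hnu. assert (HP := Pval_bounds nu ltac:(lra)). assert (HY := Yval_bounds nu ltac:(lra)).
  assert (Ht : tcoef nu 1 <= 1 / 30).
  { rewrite tcoef_1. replace (1 / 30) with (/ (16 * (1 / 2) * (3 / 2) * (5 / 2))) by field.
    apply Rinv_le_contravar; [lra|]. repeat apply Rmult_le_compat; lra. }
  lra.
Qed.

Definition log_f (nu : R) (z : C) : C := (RtoC (1 / (2 * nu + 1)) * Clog (Pfun nu (z ^ 4)))%C.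

Definition log_f' (nu : R) (z : C) : C :=
  (RtoC (1 / (2 * nu + 1)) * (/ Pfun nu (z ^ 4) * (dP nu (z ^ 4) * (RtoC (INR 4) * z ^ 3))))%C.

Lemma Cder_log_f nu z : - (1 / 2) < nu -> Cmod z < 1 -> Cder (log_f nu) z (log_f' nu z).
Proof.
  intros Hnu Hz. apply Cder_scal.
  apply (Cder_comp Clog (fun w => Pfun nu (w ^ 4))).
  - apply Cder_Pfun_pow; [lra|assumption].
  - apply Cder_Clog, Re_Pfun_pos; [lra| |].
    + assert (H := Pval_pos_half nu Hnu). lra.
    + apply Rlt_le, Cmod_pow_lt_1, Hz.
Qed.

Lemma f_norm_log nu z : - (1 / 2) < nu -> Cmod z <= 1 -> f_norm nu z = (z * Cexp (log_f nu z))%C.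
Proof.
  intros Hnu Hz. rewrite f_norm_eq by lra. rewrite Cpower_def; [reflexivity|].
  assert (HP := Pval_pos_half nu Hnu).
  assert (H := Re_Pfun_pos nu (z ^ 4) ltac:(lra) ltac:(lra) (Cmod_pow_le_1 z 4 Hz)).
  intros E. rewrite E in H. simpl in H. lra.
Qed.

Lemma Cder_f nu z : - (1 / 2) < nu -> Cmod z < 1 ->
  Cder (fun z => z * Cexp (log_f nu z))%C z (Cexp (log_f nu z) * (1 + z * log_f' nu z)).
Proof.
  intros Hnu Hz.
  assert (H := Cder_mult _ _ _ _ _ (Cder_id z)
    (Cder_comp _ _ _ _ _ (Cder_log_f nu z Hnu Hz) (Cder_Cexp _))).
  cbv beta in H. match type of H with Cder _ _ ?d =>
    replace (Cexp (log_f nu z) * (1 + z * log_f' nu z))%C with d by ring end. exact H.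
Qed.

Lemma log_f'_theta nu z : - (1 / 2) < nu -> Cmod z < 1 ->
  (z * log_f' nu z)%C
  = (RtoC (4 / (2 * nu + 1)) * (theta nu (z ^ 4) / Pfun nu (z ^ 4)))%C.
Proof.
  intros Hnu Hz. rewrite <- dP_theta by (try lra; apply Rlt_le, Cmod_pow_lt_1, Hz).
  unfold log_f', Cdiv. simpl (INR 4). replace (1 + 1 + 1 + 1) with 4 by ring.
  replace (4 / (2 * nu + 1)) with (1 / (2 * nu + 1) * 4) by (field; lra).
  rewrite RtoC_mult. change (z ^ 4)%C with (z * z ^ 3)%C. ring.
Qed.

(** The root in [f_norm] is the exponential of [log_f], so that
    [injective_exp_multiple] applies. *)
Lemma starlike_f nu alpha : - (45 / 100) <= nu -> 0 <= alpha < 1 ->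
  0 <= balance (fun x => (1 - alpha) * (2 * x + 1)) 4 nu ->
  starlike_of_order alpha (f_norm nu).
Proof.
  intros Hnu45 Hal Hb. unfold balance in Hb. assert (Hnu : - (1 / 2) < nu) by lra.
  destruct (Pval_pos_half nu Hnu) as [HP HYP].
  assert (Hk : 4 * Yval nu <= (2 * nu + 1) * Pval nu).
  { assert (0 <= alpha * ((2 * nu + 1) * Pval nu)) by (repeat apply Rmult_le_pos; lra). lra. }
  apply (starlike_intro alpha _ _ _ (fun z Hz => f_norm_log nu z Hnu Hz)
           (fun z Hz => Cder_f nu z Hnu Hz)).
  - apply Cmult_0_l.
  - rewrite Cmult_0_l, Cplus_0_r, Cmult_1_r. unfold log_f.
    rewrite (Cpow_0_S 3), Pfun_0.
    assert (HC1 : RtoC 1 <> RtoC 0) by (intros E; injection E; lra).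
    rewrite <- Cpower_def by assumption. apply Cpower_1_l.
  - apply injective_exp_multiple with (log_f' nu).
    + intros z Hz. now apply Cder_log_f.
    + intros z Hz.
      assert (Hw := Rlt_le _ _ (Cmod_pow_lt_1 z 3 Hz)).
      assert (HRe := Re_Pfun_pos nu (z ^ 4) ltac:(lra) ltac:(lra) Hw).
      assert (HPw : Pfun nu (z ^ 4) <> RtoC 0) by (intros E; rewrite E in HRe; simpl in HRe; lra).
      assert (HPm := proj1 (Cmod_gt_0 _) HPw).
      assert (Hq := dP_over_P nu (z ^ 4) Hnu45 Hk Hw).
      assert (Hz3 := Cmod_pow_le_1 z 3 ltac:(lra)).
      assert (Hz3' := Cmod_ge_0 (z ^ 3)). assert (HdP := Cmod_ge_0 (dP nu (z ^ 4))).
      unfold log_f'. rewrite !Cmod_mult, Cmod_inv, !Cmod_R by assumption.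
      simpl (INR 4). replace (1 + 1 + 1 + 1) with 4 by ring.
      rewrite (Rabs_pos_eq 4), (Rabs_pos_eq (1 / _)) by (try apply Rdiv_le_0_compat; lra).
      set (D := Cmod (dP nu (z ^ 4))) in *. set (Q := Cmod (Pfun nu (z ^ 4))) in *.
      assert (H2 : 0 < (2 * nu + 1) * Q) by (apply Rmult_lt_0_compat; lra).
      apply Rmult_le_reg_r with ((2 * nu + 1) * Q); [assumption|].
      replace (1 / (2 * nu + 1) * (/ Q * (D * (4 * Cmod (z ^ 3)))) * ((2 * nu + 1) * Q))
        with (4 * D * Cmod (z ^ 3)) by (field; lra).
      rewrite Rmult_1_l. apply Rle_trans with (4 * D * 1); [apply Rmult_le_compat_l; lra|lra].
  - intros z Hz Hz0. assert (Hw := Cmod_pow_lt_1 z 3 Hz).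
    replace (z * (Cexp (log_f nu z) * (1 + z * log_f' nu z)) / (z * Cexp (log_f nu z)))%C
      with (1 + z * log_f' nu z)%C by (field; split; [apply Cexp_neq_0|assumption]).
    rewrite log_f'_theta by assumption.
    assert (HR := Re_theta_over_P nu (z ^ 4) ltac:(lra) ltac:(lra) HYP Hw).
    set (m := 4 / (2 * nu + 1)).
    assert (Hm : 0 < m) by (apply Rdiv_lt_0_compat; lra).
    set (R0 := (theta nu (z ^ 4) / Pfun nu (z ^ 4))%C) in *.
    replace (Re (1 + RtoC m * R0)) with (1 + m * Re R0) by (destruct R0; simpl; ring).
    assert (m * - (Yval nu / Pval nu) < m * Re R0) by (apply Rmult_lt_compat_l; lra).
    assert (m * (Yval nu / Pval nu) <= 1 - alpha).
    { apply Rmult_le_reg_r with ((2 * nu + 1) * Pval nu); [apply Rmult_lt_0_compat; lra|].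
      replace (m * (Yval nu / Pval nu) * ((2 * nu + 1) * Pval nu)) with (4 * Yval nu)
        by (unfold m; field; lra). lra. }
    lra.
Qed.

Lemma balance_of_starlike_f nu alpha : - (1 / 2) < nu ->
  starlike_of_order alpha (f_norm nu) ->
  0 <= balance (fun x => (1 - alpha) * (2 * x + 1)) 4 nu.
Proof.
  intros Hnu Hst. unfold balance.
  destruct (Pval_pos_half nu Hnu) as [HP HYP].
  assert (H := starlike_elim alpha _ _ _ (fun z Hz => f_norm_log nu z Hnu Hz)
           (fun z Hz => Cder_f nu z Hnu Hz) (Cmult_0_l _) Hst).
  assert (Hb : 4 / (2 * nu + 1) * Yval nu <= (1 - alpha) * Pval nu).
  { apply balance_of_radius; [lra|]. intros x Hx.
    destruct (Cpow_real_root x 3 Hx) as [r [Hr Hrx]].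
    assert (Hx1 : Rabs x <= 1) by (apply Rabs_le; lra).
    assert (HRe := Re_Pfun_pos nu (RtoC x) ltac:(lra) ltac:(lra) ltac:(now rewrite Cmod_R)).
    assert (HPx : Preal nu x <> 0) by (unfold Preal; lra).
    split; [exact HPx|].
    assert (Hrm : Cmod (RtoC r) < 1) by (rewrite Cmod_R, Rabs_pos_eq; lra).
    assert (Hr0 : RtoC r <> RtoC 0) by (intros E; injection E; lra).
    destruct (H (RtoC r) Hrm Hr0) as [_ Hre].
    replace (RtoC r * (Cexp (log_f nu (RtoC r)) * (1 + RtoC r * log_f' nu (RtoC r)))
             / (RtoC r * Cexp (log_f nu (RtoC r))))%C
      with (1 + RtoC r * log_f' nu (RtoC r))%C in Hre
      by (field; split; [apply Cexp_neq_0|assumption]).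
    rewrite log_f'_theta, Hrx, Pfun_real, theta_real in Hre by (auto; lra).
    rewrite <- RtoC_div, <- RtoC_mult, <- RtoC_plus in Hre by assumption. exact Hre. }
  assert (Hn : 0 < 2 * nu + 1) by lra.
  assert (H1 : (2 * nu + 1) * (4 / (2 * nu + 1) * Yval nu) <= (2 * nu + 1) * ((1 - alpha) * Pval nu))
    by (apply Rmult_le_compat_l; lra).
  replace ((2 * nu + 1) * (4 / (2 * nu + 1) * Yval nu)) with (4 * Yval nu) in H1 by (field; lra).
  lra.
Qed.

(** * The critical orders *)

Lemma balance_const_incr alpha m nu nu' : alpha < 1 -> 0 < m -> -1 < nu -> nu < nu' ->
  balance (fun _ => 1 - alpha) m nu < balance (fun _ => 1 - alpha) m nu'.
Proof.
  intros Hal Hm Hnu Hlt. unfold balance.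
  assert (HP := Pval_incr nu nu' Hnu Hlt). assert (HY := Yval_decr nu nu' Hnu Hlt). nra.
Qed.

Lemma balance_f_incr alpha nu nu' : alpha < 1 -> - (1 / 2) < nu -> nu < nu' ->
  balance (fun x => (1 - alpha) * (2 * x + 1)) 4 nu
  < balance (fun x => (1 - alpha) * (2 * x + 1)) 4 nu'.
Proof.
  intros Hal Hnu Hlt. unfold balance.
  assert (HP := Pval_incr nu nu' ltac:(lra) Hlt). assert (HY := Yval_decr nu nu' ltac:(lra) Hlt).
  destruct (Pval_pos_half nu Hnu) as [HP0 _].
  assert ((2 * nu + 1) * Pval nu <= (2 * nu' + 1) * Pval nu') by (apply Rmult_le_compat; lra).
  assert ((1 - alpha) * ((2 * nu + 1) * Pval nu) <= (1 - alpha) * ((2 * nu' + 1) * Pval nu'))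
    by (apply Rmult_le_compat_l; lra).
  lra.
Qed.

(** At an order of size [1 / (1 - alpha)] the first coefficient is negligible
    against [1 - alpha]. *)
Lemma large_order alpha : 0 <= alpha < 1 ->
  exists b, 0 < b /\ 4 * Yval b < (1 - alpha) * Pval b.
Proof.
  intros Hal. set (e := 1 - alpha). assert (He : 0 < e <= 1) by (unfold e; lra).
  assert (Hi : 0 < / e) by (apply Rinv_0_lt_compat; lra).
  exists (/ e). split; [assumption|].
  assert (HP := Pval_bounds (/ e) ltac:(lra)). assert (HY := Yval_bounds (/ e) ltac:(lra)).
  assert (Ht : tcoef (/ e) 1 <= e / 96).
  { rewrite tcoef_1. replace (e / 96) with (/ (16 * / e * 2 * 3)) by (field; lra).
    apply Rinv_le_contravar; [repeat apply Rmult_lt_0_compat; lra|].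
    repeat apply Rmult_le_compat; repeat apply Rmult_le_pos; lra. }
  assert (e * (95 / 96) <= e * Pval (/ e)) by (apply Rmult_le_compat_l; lra).
  lra.
Qed.

Lemma tcoef_1_at nu x : 16 * (nu + 1) * (nu + 2) * (nu + 3) = x -> tcoef nu 1 = / x.
Proof. intros <-. apply tcoef_1. Qed.

(** For orders below -1/2 the factor [2 nu + 1] is negative, but then [P(1)], if
    negative, is at least [1 - t_1], which is outweighed by [4 P'(1)]. *)
Lemma f_balance_neg alpha nu : 0 <= alpha < 1 -> -1 < nu <= - (45 / 100) ->
  balance (fun x => (1 - alpha) * (2 * x + 1)) 4 nu < 0.
Proof.
  intros Hal Hnu.
  destruct (Rle_lt_dec nu (- (1 / 2))) as [Hle|Hlt].
  - unfold balance. assert (HP := Pval_bounds nu ltac:(lra)). assert (HY := Yval_bounds nu ltac:(lra)).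
    assert (Ht := tcoef_pos nu 1 ltac:(lra)).
    assert (Hc : 0 <= (1 - alpha) * - (2 * nu + 1) <= 1) by (split; nra).
    set (c := (1 - alpha) * - (2 * nu + 1)) in *.
    replace ((1 - alpha) * (2 * nu + 1)) with (- c) by (unfold c; ring). nra.
  - apply Rle_lt_trans with (balance (fun x => (1 - alpha) * (2 * x + 1)) 4 (- (45 / 100))).
    { destruct (Req_dec nu (- (45 / 100))) as [->|Hn]; [lra|].
      left. apply balance_f_incr; lra. }
    unfold balance.
    assert (HP := Pval_bounds (- (45 / 100)) ltac:(lra)).
    assert (HY := Yval_bounds (- (45 / 100)) ltac:(lra)).
    rewrite (tcoef_1_at (- (45 / 100)) (34782 / 1000)) in * by field.
    replace (/ (34782 / 1000)) with (1000 / 34782) in * by field.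
    assert ((1 - alpha) * (1 / 10 * Pval (- (45 / 100))) <= 1 * (1 / 10 * Pval (- (45 / 100))))
      by (apply Rmult_le_compat_r; lra).
    lra.
Qed.

Lemma const_balance_neg alpha m a nu : 0 <= alpha < 1 -> 0 < m -> -1 < nu <= a -> 0 <= Pval a ->
  Pval a < m * Yval a -> balance (fun _ => 1 - alpha) m nu < 0.
Proof.
  intros Hal Hm Hnu HP0 Ha.
  apply Rle_lt_trans with (balance (fun _ => 1 - alpha) m a).
  - destruct (Req_dec nu a) as [->|Hn]; [lra|]. left. apply balance_const_incr; lra.
  - unfold balance. nra.
Qed.

(** The common treatment of [g_norm] and [h_norm].  The sign of [balance] at [a]
    for the order 0 of starlikeness decides it for all [alpha], because
    [alpha P(a)] is subtracted; hence one lower end [a] serves for all of them. *)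
Lemma critical_order_const (nf : R -> C -> C) (eqn : R -> R -> Prop) m a b :
  0 < m <= 4 -> -1 < a < b -> b < 0 ->
  (forall alpha nu, -1 < nu -> (eqn alpha nu <-> (1 - alpha) * Pval nu = m * Yval nu)) ->
  (forall alpha nu, -1 < nu -> 0 <= alpha < 1 ->
    (starlike_of_order alpha (nf nu) <-> 0 <= balance (fun _ => 1 - alpha) m nu)) ->
  0 <= Pval a < m * Yval a -> m * Yval b <= Pval b ->
  (forall alpha, 0 <= alpha < 1 -> exists nu_alpha,
     is_unique_root (eqn alpha) nu_alpha /\
     forall nu, -1 < nu -> (starlike_of_order alpha (nf nu) <-> nu_alpha <= nu)) /\
  (exists nu_0, is_unique_root (eqn 0) nu_0 /\ a < nu_0 <= b /\
     forall nu, -1 < nu -> (starlike (nf nu) <-> nu_0 <= nu)).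
Proof.
  intros Hm Hab Hb0 Heqn Hst Ha Hb.
  assert (Hroot : forall alpha, 0 <= alpha < 1 -> exists nu0, a < nu0 /\
     is_unique_root (eqn alpha) nu0 /\
     forall nu, -1 < nu -> (starlike_of_order alpha (nf nu) <-> nu0 <= nu)).
  { intros alpha Hal.
    destruct (large_order alpha Hal) as [B [HB0 HB]].
    assert (HYB := Yval_bounds B ltac:(lra)). assert (HtB := tcoef_pos B 1 ltac:(lra)).
    destruct (root_of_increasing (balance (fun _ => 1 - alpha) m) a B) as [nu0 [Hn1 [Hn2 Hn3]]].
    - lra.
    - intros nu Hnu. apply balance_continuous; [assumption|].
      apply continuity_pt_const. now intros ? ?.
    - intros nu Hnu. apply const_balance_neg with a; tauto.
    - intros. apply balance_const_incr; lra.
    - unfold balance. nra.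
    - exists nu0. split; [assumption|]. split.
      + split.
        * split; [lra|]. apply Heqn; [lra|]. unfold balance in Hn2. lra.
        * intros nu [Hnu He]. apply Hn3; [assumption|].
          apply Heqn in He; [|assumption]. unfold balance. lra.
      + intros nu Hnu. rewrite Hst by assumption. now apply Hn3. }
  split.
  - intros alpha Hal. destruct (Hroot alpha Hal) as [nu0 [_ H]]. now exists nu0.
  - assert (H01 : 0 <= 0 < 1) by lra.
    destruct (Hroot 0 H01) as [nu0 [H1 [H2 H3]]]. exists nu0. split; [exact H2|].
    split; [|exact H3]. split; [assumption|].
    apply H3; [lra|]. apply Hst; [lra|exact H01|]. unfold balance. lra.
Qed.

Theorem theorem18 :
  (* (a) *)
  ((forall alpha : R, 0 <= alpha < 1 ->
      exists nu_alpha : R,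
        is_unique_root (f_equation alpha) nu_alpha /\
        forall nu : R, - (1 / 2) < nu ->
          (starlike_of_order alpha (f_norm nu) <-> nu_alpha <= nu)) /\
   (exists nu_0 : R,
      is_unique_root (f_equation 0) nu_0 /\
      - (45 / 100) < nu_0 <= - (44 / 100) /\
      forall nu : R, - (1 / 2) < nu ->
        (starlike (f_norm nu) <-> nu_0 <= nu)))
  /\
  (* (b) *)
  ((forall alpha : R, 0 <= alpha < 1 ->
      exists nu_alpha : R,
        is_unique_root (g_equation alpha) nu_alpha /\
        forall nu : R, -1 < nu ->
          (starlike_of_order alpha (g_norm nu) <-> nu_alpha <= nu)) /\
   (exists nu_0 : R,
      is_unique_root (g_equation 0) nu_0 /\
      - (88 / 100) < nu_0 <= - (87 / 100) /\
      forall nu : R, -1 < nu ->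
        (starlike (g_norm nu) <-> nu_0 <= nu)))
  /\
  (* (c) *)
  ((forall alpha : R, 0 <= alpha < 1 ->
      exists nu_alpha : R,
        is_unique_root (h_equation alpha) nu_alpha /\
        forall nu : R, -1 < nu ->
          (starlike_of_order alpha (h_norm nu) <-> nu_alpha <= nu)) /\
   (exists nu_0 : R,
      is_unique_root (h_equation 0) nu_0 /\
      - (95 / 100) < nu_0 <= - (94 / 100) /\
      forall nu : R, -1 < nu ->
        (starlike (h_norm nu) <-> nu_0 <= nu))).
Proof.
  split; [|split].
  - assert (Hroot : forall alpha, 0 <= alpha < 1 -> exists nu0, - (45 / 100) < nu0 /\
       is_unique_root (f_equation alpha) nu0 /\
       (forall nu, - (1 / 2) < nu -> (starlike_of_order alpha (f_norm nu) <-> nu0 <= nu)) /\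
       (forall nu, -1 < nu ->
          0 <= balance (fun x => (1 - alpha) * (2 * x + 1)) 4 nu -> nu0 <= nu)).
    { intros alpha Hal.
      destruct (large_order alpha Hal) as [B [HB0 HB]].
      destruct (root_of_increasing (balance (fun x => (1 - alpha) * (2 * x + 1)) 4) (- (45 / 100)) B)
        as [nu0 [Hn1 [Hn2 Hn3]]].
      - lra.
      - intros nu Hnu. apply balance_continuous; [assumption|].
        apply derivable_continuous_pt, ex_derive_Reals_0. auto_derive. trivial.
      - intros nu Hnu. now apply f_balance_neg.
      - intros. apply balance_f_incr; lra.
      - unfold balance. destruct (Pval_pos_half B ltac:(lra)) as [HPB _].
        assert (0 <= 2 * B * ((1 - alpha) * Pval B)) by (repeat apply Rmult_le_pos; lra). lra.
      - exists nu0. split; [assumption|]. split; [|split].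
        + split.
          * split; [lra|]. apply f_equation_iff; [lra|]. unfold balance in Hn2. lra.
          * intros nu [Hnu He]. apply Hn3; [assumption|].
            apply f_equation_iff in He; [|assumption]. unfold balance. lra.
        + intros nu Hnu. split.
          * intros Hs. apply Hn3; [lra|]. now apply balance_of_starlike_f.
          * intros Hle. apply starlike_f; [lra|assumption|]. apply Hn3; [lra|assumption].
        + intros nu Hnu. now apply Hn3. }
    split.
    + intros alpha Hal. destruct (Hroot alpha Hal) as [nu0 [_ [H1 [H2 _]]]]. now exists nu0.
    + assert (H01 : 0 <= 0 < 1) by lra.
      destruct (Hroot 0 H01) as [nu0 [H1 [H2 [H3 H4]]]]. exists nu0. split; [exact H2|].
      split; [|exact H3]. split; [assumption|]. apply H4; [lra|]. unfold balance.
      assert (HP := Pval_bounds (- (44 / 100)) ltac:(lra)).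
      assert (HY := Yval_bounds (- (44 / 100)) ltac:(lra)).
      rewrite (tcoef_1_at (- (44 / 100)) (35782656 / 1000000)) in * by field.
      lra.
  - apply (critical_order_const g_norm g_equation 4); try lra.
    + intros. now apply g_equation_iff.
    + intros alpha nu Hnu Hal.
      rewrite (starlike_times_Pfun nu 3 alpha (g_norm nu) Hnu Hal)
        by (intros; now apply g_norm_eq).
      replace (INR 4) with 4 by (simpl; ring). reflexivity.
    + assert (HP := Pval_bounds (- (88 / 100)) ltac:(lra)).
      assert (HY := Yval_bounds (- (88 / 100)) ltac:(lra)).
      rewrite (tcoef_1_at (- (88 / 100)) (4558848 / 1000000)) in * by field. lra.
    + assert (HP := Pval_bounds (- (87 / 100)) ltac:(lra)).
      assert (HY := Yval_bounds (- (87 / 100)) ltac:(lra)).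
      rewrite (tcoef_1_at (- (87 / 100)) (5006352 / 1000000)) in * by field. lra.
  - apply (critical_order_const h_norm h_equation 1); try lra.
    + intros. rewrite Rmult_1_l. now apply h_equation_iff.
    + intros alpha nu Hnu Hal.
      apply (starlike_times_Pfun nu 0 alpha (h_norm nu) Hnu Hal).
      intros z Hz. rewrite h_norm_eq by assumption. simpl. now rewrite Cmult_1_r.
    + assert (HP := Pval_bounds (- (95 / 100)) ltac:(lra)).
      assert (HY := Yval_bounds (- (95 / 100)) ltac:(lra)).
      rewrite (tcoef_1_at (- (95 / 100)) (1722 / 1000)) in * by field. lra.
    + assert (HP := Pval_bounds (- (94 / 100)) ltac:(lra)).
      assert (HY := Yval_bounds (- (94 / 100)) ltac:(lra)).
      rewrite (tcoef_1_at (- (94 / 100)) (2096256 / 1000000)) in * by field. lra.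
Qed.
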